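(* Let $\Phi_1\in\mathcal C(A_0B_0,A_1B_1)$, $\Phi_2\in\mathcal C(A'_0B_0,A'_1B_1)$ and $\epsilon\ge0$. The following are equivalent. (i) $\delta_{A|A'}(\Phi_1\|\Phi_2)\le\epsilon$. (ii) For all finite-dimensional systems $R_0,R_1$ and every $\rho\in\mathfrak S(R_0B_0R_1B_1)$, $$\sup_{\Theta\in\mathcal C_2(A',R)}\langle\rho,(\Theta\otimes\mathrm{id}_B)(\Phi_2)\rangle\le\sup_{\Theta\in\mathcal C_2(A,R)}\langle\rho,(\Theta\otimes\mathrm{id}_B)(\Phi_1)\rangle+\frac{\epsilon}{2}\|\rho\|^\diamond_{R_1B_1|R_0B_0}.$$ (iii) For all systems $R_0,R_1$, all $k,l\in\mathbb N$, every ensemble $\mathcal E=\{\lambda_{i,j},\rho_{i,j}\}_{i\le k,j\le l}$ on $R_0B_0R_1B_1$ and every fixed measurement $M\in\mathcal M_l(B_1B_1)$, $$P^{M}_{\Phi_2,k}(\mathcal E)\le P^{M}_{\Phi_1,k}(\mathcal E)+\frac{\epsilon}{2}P_{\rm succ}(\mathcal E).$$ Moreover, (i) is also equivalent to (ii), resp. (iii), required only for $R_0=A'_0$, $R_1=A'_1$.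
   Context: Finite-dimensional systems; $\mathcal C(X,Y)$ channels; $\mathcal M_k(X)$ measurements with $k$ outcomes on $X$; $\|\cdot\|_\diamond$ diamond norm. $B=B_0B_1$ is fixed. For $A=A_0A_1$, $A'=A'_0A'_1$, $\mathcal C_2(A,A')$ is the set of superchannels $\Theta$ given by an ancilla $U$, $\Theta_{\rm pre}\in\mathcal C(A'_0,UA_0)$, $\Theta_{\rm post}\in\mathcal C(UA_1,A'_1)$; for $\Phi\in\mathcal C(A_0B_0,A_1B_1)$, $(\Theta\otimes\mathrm{id}_B)(\Phi)=(\Theta_{\rm post}\otimes\mathrm{id}_{B_1})\circ(\mathrm{id}_U\otimes\Phi)\circ(\Theta_{\rm pre}\otimes\mathrm{id}_{B_0})\in\mathcal C(A'_0B_0,A'_1B_1)$. $\delta_{A|A'}(\Phi_1\|\Phi_2)=\min_{\Theta\in\mathcal C_2(A,A')}\|(\Theta\otimes\mathrm{id}_B)(\Phi_1)-\Phi_2\|_\diamond$. In (ii), $R=R_0R_1$. For $X\in\mathcal B_h(S_0S_1)$ and $\phi\in\mathcal L(S_0,S_1)$, $\langle X,\phi\rangle={\rm Tr}[XC_{\phi^*}]$ with Choi matrix $C_\psi=(\psi\otimes\mathrm{id})(|I\rangle\rangle\langle\langle I|)$ and $\phi^*$ the adjoint; $\|\rho\|^\diamond_{S_1|S_0}=\max_{\alpha\in\mathcal C(S_0,S_1)}\langle\rho,\alpha\rangle$. $P_{\rm succ}(\mathcal E,M)=\sum\lambda_{i}{\rm Tr}[\rho_iM_i]$, $P_{\rm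 succ}(\mathcal E)=\max_MP_{\rm succ}(\mathcal E,M)$. For $\Phi\in\mathcal C(A''_0B_0,A''_1B_1)$, $P^M_{\Phi,k}(\mathcal E)$ is the supremum over ancillas $U$, preprocessings $\alpha\in\mathcal C(R_0,A''_0U)$ and measurements $N\in\mathcal M_k(UA''_1R_1)$ of $\sum_{i,j}\lambda_{i,j}{\rm Tr}\big[\big(((\mathrm{id}_U\otimes\Phi)\circ(\alpha\otimes\mathrm{id}_{B_0}))\otimes\mathrm{id}_{R_1B_1}\big)(\rho_{i,j})\,(N_i\otimes M_j)\big]$, where $\alpha$ acts on the $R_0$ part of the ensemble, $B_0$ of the ensemble is fed into $\Phi$, $N$ measures $UA''_1R_1$ and $M$ measures the output $B_1$ of $\Phi$ together with the $B_1$ part of the ensemble. *)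

(* Defs.v *)
From HB Require Import structures.
From mathcomp Require Import all_boot all_order all_algebra.
From mathcomp Require Import complex mxtens.
From mathcomp Require Import classical_sets reals constructive_ereal ereal.

Set Implicit Arguments.
Unset Strict Implicit.
Unset Printing Implicit Defensive.

Import Order.TTheory GRing.Theory Num.Theory.
Local Open Scope ring_scope.
Local Open Scope classical_set_scope.
Local Open Scope complex_scope.

Section QuantumDefs.
Variable R : realType.
Local Notation C := R[i].

(* A finite-dimensional system is given by its dimension; a composite
   system XY has dimension (dim X * dim Y), with the Kronecker (mxtens)
   index convention. *)

Definition adjmx m n (A : 'M[C]_(m, n)) : 'M[C]_(n, m) := (map_mx Num.conj A)^T.

Definition psd n (A : 'M[C]_n) : Prop :=
  forall v : 'cV[C]_n, 0 <= (adjmx v *m A *m v) 0 0.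

Definition density n (rho : 'M[C]_n) : Prop := psd rho /\ \tr rho = 1.

Definition unitary n (U : 'M[C]_n) : Prop := U *m adjmx U = 1%:M.

Definition lmap (n m : nat) := 'M[C]_n -> 'M[C]_m.

Definition idmap n : lmap n n := fun X => X.

(* tensor product f (x) g of maps: defined on matrix units and extended
   linearly *)
Definition tmap n1 m1 n2 m2 (f : lmap n1 m1) (g : lmap n2 m2)
  : lmap (n1 * n2) (m1 * m2) :=
  fun X => \sum_(i < n1 * n2) \sum_(j < n1 * n2)
    X i j *: (f (delta_mx (mxtens_unindex i).1 (mxtens_unindex j).1)
             *t g (delta_mx (mxtens_unindex i).2 (mxtens_unindex j).2)).

Definition CP n m (f : lmap n m) : Prop :=
  forall k (X : 'M[C]_(n * k)), psd X -> psd (tmap f (@idmap k) X).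

Definition TP n m (f : lmap n m) : Prop := forall X, \tr (f X) = \tr X.

Definition channel n m (f : lmap n m) : Prop :=
  linear f /\ CP f /\ TP f.

Definition measurement (I : finType) n (M : I -> 'M[C]_n) : Prop :=
  (forall i, psd (M i)) /\ \sum_i M i = 1%:M.

Definition ensemble (I : finType) n (lam : I -> R) (rho : I -> 'M[C]_n) : Prop :=
  [/\ forall i, 0 <= lam i, \sum_i lam i = 1 & forall i, density (rho i)].

(* Choi matrix C_psi = (psi (x) id)(|I>><<I|) = sum_ij psi(E_ij) (x) E_ij *)
Definition choi n m (f : lmap n m) : 'M[C]_(m * n) :=
  \sum_(i < n) \sum_(j < n) (f (delta_mx i j) *t delta_mx i j).

(* Hilbert-Schmidt adjoint: Tr[phi*(Y)^dag X] = Tr[Y^dag phi(X)] *)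
Definition adjmap n m (f : lmap n m) : lmap m n :=
  fun Y => \sum_(i < n) \sum_(j < n)
    \tr (adjmx (f (delta_mx i j)) *m Y) *: delta_mx i j.

Definition pairing s0 s1 (X : 'M[C]_(s0 * s1)) (f : lmap s0 s1) : C :=
  \tr (X *m choi (adjmap f)).

(* trace norm ||X||_1 = max_{U unitary} |Tr(U X)| *)
Definition tnorm n (X : 'M[C]_n) : \bar R :=
  ereal_sup [set t | exists U : 'M[C]_n, unitary U /\ t = (complex.Re `|\tr (U *m X)|)%:E].

Definition dnorm n m (D : lmap n m) : \bar R :=
  ereal_sup [set t | exists k (X : 'M[C]_(n * k)),
    (tnorm X <= 1)%E /\ t = tnorm (tmap D (@idmap k) X)].

(* (Theta (x) id_B)(Phi) for Theta given by ancilla U, pre, post *)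
Definition supch_apply a0 a1 a0' a1' b0 b1 u
  (pre : lmap a0' (u * a0)) (post : lmap (u * a1) a1')
  (Phi : lmap (a0 * b0) (a1 * b1)) : lmap (a0' * b0) (a1' * b1) :=
  fun X => tmap post (@idmap b1)
    (castmx (mulnA u a1 b1, mulnA u a1 b1)
      (tmap (@idmap u) Phi
        (castmx (esym (mulnA u a0 b0), esym (mulnA u a0 b0))
          (tmap pre (@idmap b0) X)))).

Definition superch_outputs a0 a1 a0' a1' b0 b1 (Phi : lmap (a0 * b0) (a1 * b1))
  : set (lmap (a0' * b0) (a1' * b1)) :=
  [set Psi | exists u (pre : lmap a0' (u * a0)) (post : lmap (u * a1) a1'),
     [/\ (0 < u)%N, channel pre, channel post & Psi = @supch_apply a0 a1 a0' a1' b0 b1 u pre post Phi]].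

Definition deltaAA a0 a1 a0' a1' b0 b1
  (Phi1 : lmap (a0 * b0) (a1 * b1)) (Phi2 : lmap (a0' * b0) (a1' * b1)) : \bar R :=
  ereal_inf [set t | exists Psi, @superch_outputs a0 a1 a0' a1' b0 b1 Phi1 Psi /\
                       t = dnorm (fun X => Psi X - Phi2 X)].

Definition sup_pairing a0 a1 r0 r1 b0 b1
  (rho : 'M[C]_((r0 * b0) * (r1 * b1))) (Phi : lmap (a0 * b0) (a1 * b1)) : \bar R :=
  ereal_sup [set t | exists Psi, @superch_outputs a0 a1 r0 r1 b0 b1 Phi Psi /\
                       t = (complex.Re (pairing rho Psi))%:E].

Definition dual_dnorm s0 s1 (rho : 'M[C]_(s0 * s1)) : \bar R :=
  ereal_sup [set t | exists alpha : lmap s0 s1, channel alpha /\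
                       t = (complex.Re (pairing rho alpha))%:E].

Definition psucc_with (I : finType) n (lam : I -> R) (rho : I -> 'M[C]_n)
  (M : I -> 'M[C]_n) : R :=
  complex.Re (\sum_i (lam i)%:C * \tr (rho i *m M i)).

Definition psucc (I : finType) n (lam : I -> R) (rho : I -> 'M[C]_n) : \bar R :=
  ereal_sup [set t | exists M : I -> 'M[C]_n, measurement M /\
                       t = (psucc_with lam rho M)%:E].

Definition reorder_idx u a1 b1 r1 :
  'I_((u * (a1 * b1)) * (r1 * b1)) -> 'I_(((u * a1) * r1) * (b1 * b1)) :=
  fun p =>
    let xy := mxtens_unindex p in
    let ua := mxtens_unindex xy.1 in
    let ab := mxtens_unindex ua.2 in
    let rb := mxtens_unindex xy.2 in
    mxtens_index (mxtens_index (mxtens_index (ua.1, ab.1), rb.1),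
                  mxtens_index (ab.2, rb.2)).

Definition reindex p q (f : 'I_p -> 'I_q) (Z : 'M[C]_q) : 'M[C]_p :=
  \matrix_(i, j) Z (f i) (f j).

Definition PM a0 a1 b0 b1 r0 r1 k l (Phi : lmap (a0 * b0) (a1 * b1))
  (M : 'I_l -> 'M[C]_(b1 * b1)) (lam : 'I_k * 'I_l -> R)
  (rho : 'I_k * 'I_l -> 'M[C]_((r0 * b0) * (r1 * b1))) : \bar R :=
  ereal_sup [set t | exists u (alpha : lmap r0 (u * a0))
                        (N : 'I_k -> 'M[C]_((u * a1) * r1)),
    [/\ (0 < u)%N, channel alpha, measurement N &
     t = (complex.Re (\sum_(ij : 'I_k * 'I_l) (lam ij)%:C *
           \tr (tmap (fun Y => tmap (@idmap u) Phi
                        (castmx (esym (mulnA u a0 b0), esym (mulnA u a0 b0))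
                           (tmap alpha (@idmap b0) Y)))
                     (@idmap (r1 * b1)) (rho ij)
                *m reindex (@reorder_idx u a1 b1 r1) (N ij.1 *t M ij.2))))%:E]].

End QuantumDefs.

(* Main.v *)
Require Import Defs.
From HB Require Import structures.
From mathcomp Require Import all_boot all_order all_algebra.
From mathcomp Require Import complex mxtens spectral.
From mathcomp Require Import boolp classical_sets reals ereal.
From mathcomp Require Import ring lra.

Set Implicit Arguments.
Unset Strict Implicit.
Unset Printing Implicit Defensive.

Import Order.TTheory GRing.Theory Num.Theory.
Local Open Scope ring_scope.
Local Open Scope complex_scope.

Local Notation Re := complex.Re.
Local Notation "A ^t*" := (adjmx A) : ring_scope.

(**
  For a difference [D] of channels, half the diamond norm of [D] is the largest
  value of [Tr (D (x) id)(w) P] over states [w] and effects [0 <= P <= 1],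
  equivalently the largest pairing [<T, D>] with a test operator
  [0 <= T <= sigma (x) 1].  By semidefinite duality, [|rho|^diamond <= p] amounts
  to [rho <= p sigma (x) 1] for some state [sigma], which gives
  [<rho, D> <= |D|_diamond / 2 * |rho|^diamond].  As superchannels compose and do
  not increase the diamond norm, (i) implies (ii); it implies (iii) because an
  ensemble is a classical-quantum state whose dual norm is [P_succ].

  Conversely, the outputs of superchannels applied to [Phi1] form a convex set
  (direct sums of ancillas), so a minimax argument over this set and the test
  operators reduces (i) to the existence, for each test operator [T], of an output
  [Psi] with [<T, Phi2 - Psi> <= eps / 2].  This is (ii) for [rho] proportional to
  [T].  For (iii), twirl [rho] by unitary 1-designs on [R1] and [B1] and let [M] be
  the corresponding measurement built from the maximally entangled state: then
  measurements [N] of the player correspond to post-processing channels, and all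
  terms of (iii) are those of (ii) multiplied by a common factor.
*)

(** * Positive semidefinite matrices *)

Section PositiveSemidefinite.
Variable R : realType.
Local Notation C := R[i].

Lemma ReZ (a : R) (x : C) : Re (a%:C * x) = a * Re x.
Proof. by case: x => x y /=; rewrite mul0r subr0. Qed.

Lemma ReJ (x : C) : Re (Num.conj x) = Re x.
Proof. by case: x. Qed.

Lemma conjC_real (a : R) : Num.conj a%:C = a%:C :> C.
Proof. exact: conjc_real. Qed.

Lemma ge0_Re (x : C) : 0 <= x -> 0 <= Re x.
Proof. by rewrite lecE => /andP[]. Qed.

Lemma ge0_ReE (x : C) : 0 <= x -> x = (Re x)%:C.
Proof. by move=> /ger0_real /RRe_real. Qed.

Lemma Re_le_norm (x : C) : Re x <= Re `|x|.
Proof.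
rewrite normc_def /=; case: x => a b /=.
apply: (le_trans (ler_norm a)); rewrite -sqrtr_sqr ler_wsqrtr //.
by rewrite lerDl sqr_ge0.
Qed.

Lemma phase_exists (x : C) : exists2 z : C, z * Num.conj z = 1 & z * x = `|x|.
Proof.
have [->|x0] := eqVneq x 0.
  by exists 1; rewrite ?mul1r ?normr0 ?rmorph1 // mulr1.
have nx0 : `|x| != 0 by rewrite normr_eq0.
exists (Num.conj x / `|x|); last by rewrite mulrAC [_ * x]mulrC -normCK expr2 mulfK.
by rewrite -normCK normf_div norm_conjC normr_id divff // expr1n.
Qed.

Lemma adjmxE m n (A : 'M[C]_(m, n)) i j : (A^t*) i j = Num.conj (A j i).
Proof. by rewrite !mxE. Qed.

Lemma adjmxK m n : cancel (@adjmx R m n) (@adjmx R n m).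
Proof. by move=> A; apply/matrixP => i j; rewrite !adjmxE conjCK. Qed.

Fact adjmx_is_zmod_morphism m n : zmod_morphism (@adjmx R m n).
Proof. by move=> A B; apply/matrixP => i j; rewrite !mxE rmorphB. Qed.

HB.instance Definition _ m n :=
  GRing.isZmodMorphism.Build _ _ (@adjmx R m n) (@adjmx_is_zmod_morphism m n).

Lemma adjmxD m n (A B : 'M[C]_(m, n)) : (A + B)^t* = A^t* + B^t*.
Proof. exact: raddfD. Qed.

Lemma adjmxB m n (A B : 'M[C]_(m, n)) : (A - B)^t* = A^t* - B^t*.
Proof. exact: raddfB. Qed.

Lemma adjmx0 m n : (0 : 'M[C]_(m, n))^t* = 0.
Proof. exact: raddf0. Qed.

Lemma adjmxZ m n (a : C) (A : 'M[C]_(m, n)) : (a *: A)^t* = Num.conj a *: A^t*.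
Proof. by apply/matrixP => i j; rewrite !mxE rmorphM. Qed.

Lemma adjmxM m n p (A : 'M[C]_(m, n)) (B : 'M[C]_(n, p)) :
  (A *m B)^t* = B^t* *m A^t*.
Proof. by rewrite /adjmx map_mxM trmx_mul. Qed.

Lemma adjmx1 n : (1%:M : 'M[C]_n)^t* = 1%:M.
Proof. by rewrite /adjmx map_mx1 trmx1. Qed.

Lemma adjmx_delta m n (i : 'I_m) (j : 'I_n) :
  (delta_mx i j : 'M[C]__)^t* = delta_mx j i.
Proof. by rewrite /adjmx map_delta_mx trmx_delta. Qed.

Lemma adjmx_tens m n p q (A : 'M[C]_(m, n)) (B : 'M[C]_(p, q)) :
  (A *t B)^t* = A^t* *t B^t*.
Proof. by rewrite /adjmx map_mxT trmx_tens. Qed.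

Lemma mxtrace_adj n (A : 'M[C]_n) : \tr (A^t*) = Num.conj (\tr A).
Proof. by rewrite /adjmx mxtrace_tr trace_map_mx. Qed.

Definition retr n (A : 'M[C]_n) : R := Re (\tr A).

Fact retr_is_zmod_morphism n : zmod_morphism (@retr n).
Proof. by move=> A B; rewrite /retr !raddfB. Qed.

HB.instance Definition _ n :=
  GRing.isZmodMorphism.Build 'M[C]_n R (@retr n) (@retr_is_zmod_morphism n).

Lemma retrD n (A B : 'M[C]_n) : retr (A + B) = retr A + retr B.
Proof. exact: raddfD. Qed.

Lemma retrN n (A : 'M[C]_n) : retr (- A) = - retr A.
Proof. exact: raddfN. Qed.

Lemma retrB n (A B : 'M[C]_n) : retr (A - B) = retr A - retr B.
Proof. exact: raddfB. Qed.

Lemma retrZ n (a : R) (A : 'M[C]_n) : retr (a%:C *: A) = a * retr A.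
Proof. by rewrite /retr mxtraceZ ReZ. Qed.

Lemma retr_adj n (A : 'M[C]_n) : retr (A^t*) = retr A.
Proof. by rewrite /retr mxtrace_adj ReJ. Qed.

Lemma retr_mulC m n (A : 'M[C]_(m, n)) (B : 'M[C]_(n, m)) :
  retr (A *m B) = retr (B *m A).
Proof. by rewrite /retr mxtrace_mulC. Qed.

Lemma retr1 n : retr (1%:M : 'M[C]_n) = n%:R.
Proof. by rewrite /retr mxtrace1 -(rmorph_nat (real_complex R)). Qed.

Lemma unitaryC n (U : 'M[C]_n) : unitary U -> U^t* *m U = 1%:M.
Proof. exact: mulmx1C. Qed.

Lemma unitary_adj n (U : 'M[C]_n) : unitary U -> unitary (U^t*).
Proof. by move=> uU; rewrite /unitary adjmxK unitaryC. Qed.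

Lemma unitaryZ n (z : C) (U : 'M[C]_n) :
  z * Num.conj z = 1 -> unitary U -> unitary (z *: U).
Proof.
by move=> z1 uU; rewrite /unitary adjmxZ -scalemxAl -scalemxAr scalerA z1 scale1r.
Qed.

Lemma psd_gram n m (B : 'M[C]_(n, m)) : psd (B *m B^t*).
Proof.
move=> v; rewrite mulmxA -[_ *m B]adjmxK adjmxM adjmxK -mulmxA mxE.
by apply: sumr_ge0 => i _; rewrite adjmxE mulrC; exact: mul_conjC_ge0.
Qed.

Lemma psd_conj n m (K : 'M[C]_(m, n)) (A : 'M[C]_n) : psd A -> psd (K *m A *m K^t*).
Proof. by move=> hA v; have := hA (K^t* *m v); rewrite adjmxM adjmxK !mulmxA. Qed.

Lemma psd_conjV n m (K : 'M[C]_(n, m)) (A : 'M[C]_n) : psd A -> psd (K^t* *m A *m K).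
Proof. by move=> hA; rewrite -[X in _ *m X]adjmxK; exact: psd_conj. Qed.

Lemma psd0 n : psd (0 : 'M[C]_n).
Proof. by move=> v; rewrite mulmx0 mul0mx mxE. Qed.

Lemma psdD n (A B : 'M[C]_n) : psd A -> psd B -> psd (A + B).
Proof. by move=> hA hB v; rewrite mulmxDr mulmxDl mxE addr_ge0. Qed.

Lemma psdZ n (a : R) (A : 'M[C]_n) : 0 <= a -> psd A -> psd (a%:C *: A).
Proof. by move=> a0 hA v; rewrite -scalemxAr -scalemxAl mxE mulr_ge0 ?ler0c. Qed.

Lemma psd_sum n (I : Type) (s : seq I) (P : pred I) (F : I -> 'M[C]_n) :
  (forall i, P i -> psd (F i)) -> psd (\sum_(i <- s | P i) F i).
Proof.
by move=> h; elim/big_rec: _ => [|i A Pi hA]; [exact: psd0|exact: psdD (h i Pi) hA].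
Qed.

Lemma psd1 n : psd (1%:M : 'M[C]_n).
Proof. by rewrite -[1%:M]mulmx1 -[X in _ *m X]adjmx1; exact: psd_gram. Qed.

Lemma psd_delta n (i : 'I_n) : psd (delta_mx i i : 'M[C]_n).
Proof.
rewrite -(mul_delta_mx (0 : 'I_1)) -[X in _ *m X]adjmx_delta; exact: psd_gram.
Qed.

Lemma mulmx_delta_mulE m n p q (A : 'M[C]_(m, n)) (B : 'M[C]_(p, q)) x y i j :
  (A *m delta_mx x y *m B) i j = A i x * B y j.
Proof.
by rewrite -(mul_delta_mx (0 : 'I_1)) mulmxA -colE -mulmxA -rowE mxE big_ord1 !mxE.
Qed.

Lemma delta_mulmx_delta m n p q (i : 'I_m) (j : 'I_n) (k : 'I_p) (l : 'I_q)
    (A : 'M[C]_(n, p)) :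
  delta_mx i j *m A *m delta_mx k l = A j k *: delta_mx i l.
Proof.
apply/matrixP => x y; rewrite -[_ *m delta_mx k l]mulmx1 mulmx_delta_mulE -[delta_mx i j]mul1mx.
by rewrite mulmx_delta_mulE !mxE mulrAC -natrM mulnb mulrC [l == y]eq_sym.
Qed.

Lemma quad_form_delta n (A : 'M[C]_n) i j (z : C)
    (v := delta_mx i 0 + z *: delta_mx j 0 : 'cV[C]_n) :
  (v^t* *m A *m v) 0 0 =
  A i i + z * A i j + Num.conj z * A j i + Num.conj z * z * A j j.
Proof.
rewrite /v adjmxD adjmxZ !adjmx_delta !mulmxDl !mulmxDr -!scalemxAl -!scalemxAr.
by rewrite !delta_mulmx_delta !scalerA -!scalerDl mxE mxE eqxx mulr1 !addrA.
Qed.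

Lemma psd_diag_ge0 n (A : 'M[C]_n) i : psd A -> 0 <= A i i.
Proof.
move=> /(_ (delta_mx i 0)).
by rewrite adjmx_delta delta_mulmx_delta !mxE eqxx mulr1.
Qed.

Lemma psd_herm n (A : 'M[C]_n) : psd A -> A^t* = A.
Proof.
move=> hA; apply/matrixP => i j; rewrite adjmxE.
have diag_real k := ger0_Im (psd_diag_ge0 k hA).
have form_real z := ger0_Im (eq_ind _ (fun x : C => 0 <= x) (hA _) _ (quad_form_delta A i j z)).
have := form_real 1; have := form_real 'i%C; move: (diag_real i) (diag_real j).
case: (A i i) (A i j) (A j i) (A j j) => [a a'] [b b'] [c c'] [e e'] /= -> -> ? ?.
by apply/eqP; rewrite eq_complex /=; apply/andP; split; lra.
Qed.

Lemma psd_tr_ge0 n (A : 'M[C]_n) : psd A -> 0 <= \tr A.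
Proof. by move=> hA; apply: sumr_ge0 => i _; exact: psd_diag_ge0. Qed.

Lemma psd_retr_ge0 n (A : 'M[C]_n) : psd A -> 0 <= retr A.
Proof. by move=> /psd_tr_ge0/ge0_Re. Qed.

Lemma psd_trE n (A : 'M[C]_n) : psd A -> \tr A = (retr A)%:C.
Proof. by move=> /psd_tr_ge0/ge0_ReE. Qed.

(** * Functional calculus of Hermitian matrices *)

(* [U] holds an orthonormal eigenbasis in its rows. *)
Definition fcalc n (U : 'M[C]_n) (d : 'I_n -> C) : 'M[C]_n :=
  U^t* *m diag_mx (\row_i d i) *m U.

Lemma eq_fcalc n (U : 'M[C]_n) d e : d =1 e -> fcalc U d = fcalc U e.
Proof. by move=> /funext ->. Qed.

Lemma fcalcM n (U : 'M[C]_n) d e : unitary U ->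
  fcalc U d *m fcalc U e = fcalc U (fun i => d i * e i).
Proof.
move=> uU; rewrite /fcalc -!mulmxA [U *m (_ *m _)]mulmxA uU mul1mx.
rewrite [diag_mx _ *m (diag_mx _ *m _)]mulmxA mulmx_diag.
by congr (_ *m (diag_mx _ *m _)); apply/rowP => i; rewrite !mxE.
Qed.

Lemma fcalc_const n (U : 'M[C]_n) a : unitary U -> fcalc U (fun=> a) = a%:M.
Proof.
move=> uU; have -> : fcalc U (fun=> a) = U^t* *m a%:M *m U.
  by congr (_ *m _ *m _); apply/matrixP => i j; rewrite !mxE.
by rewrite mul_mx_scalar -scalemxAl unitaryC // scalemx1.
Qed.

Lemma adjmx_fcalc n (U : 'M[C]_n) d : (fcalc U d)^t* = fcalc U (fun i => Num.conj (d i)).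
Proof.
rewrite /fcalc !adjmxM adjmxK mulmxA; congr (_ *m _ *m _); apply/matrixP => i j.
by rewrite adjmxE !mxE eq_sym rmorphMn; case: eqVneq => [->|].
Qed.

Lemma fcalcZ n (U : 'M[C]_n) a d : fcalc U (fun i => a * d i) = a *: fcalc U d.
Proof.
rewrite /fcalc scalemxAl scalemxAr -linearZ; congr (_ *m diag_mx _ *m _).
by apply/rowP => i; rewrite !mxE.
Qed.

Lemma fcalcD n (U : 'M[C]_n) d e :
  fcalc U (fun i => d i + e i) = fcalc U d + fcalc U e.
Proof.
rewrite /fcalc -mulmxDl -mulmxDr -linearD; congr (_ *m diag_mx _ *m _).
by apply/rowP => i; rewrite !mxE.
Qed.

Lemma fcalcB n (U : 'M[C]_n) d e :
  fcalc U (fun i => d i - e i) = fcalc U d - fcalc U e.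
Proof.
by rewrite fcalcD -scaleN1r -fcalcZ; congr (_ + _); apply: eq_fcalc => i; rewrite mulN1r.
Qed.

Lemma mxtrace_fcalc n (U : 'M[C]_n) d : unitary U -> \tr (fcalc U d) = \sum_i d i.
Proof.
move=> uU; rewrite /fcalc -mulmxA mxtrace_mulC -mulmxA uU mulmx1 mxtrace_diag.
by apply: eq_bigr => i _; rewrite mxE.
Qed.

Lemma psd_fcalc n (U : 'M[C]_n) d : (forall i, 0 <= d i) -> psd (fcalc U d).
Proof.
move=> d_ge0; apply: psd_conjV.
have -> : diag_mx (\row_i d i) = \sum_i (Re (d i))%:C *: delta_mx i i.
  rewrite diag_mx_sum_delta; apply: eq_bigr => i _.
  by rewrite mxE -ge0_ReE.
by apply: psd_sum => i _; apply: psdZ; [exact: ge0_Re|exact: psd_delta].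
Qed.

Lemma psd_fcalcP n (A : 'M[C]_n) : psd A ->
  exists (U : 'M[C]_n) (d : 'I_n -> R),
    [/\ unitary U, forall i, 0 <= d i & A = fcalc U (fun i => (d i)%:C)].
Proof.
move=> hA; have A_herm : A \is hermsymmx.
  apply/is_hermitianmxP; rewrite expr0 scale1r -[LHS](psd_herm hA).
  by rewrite /adjmx map_trmx.
have uU := spectral_unitarymx A.
have := elimT (@orthomx_spectralP _ _ A) (hermitian_normalmx A_herm); rewrite (invmx_unitary uU).
move: (spectralmx A) (spectral_diag A) uU => U d /unitarymxP.
rewrite -map_trmx -/(adjmx U) => uU AE.
have d_ge0 i : 0 <= d 0 i.
  have := psd_diag_ge0 i (psd_conj U hA).
  by rewrite AE !mulmxA uU mul1mx -mulmxA uU mulmx1 !mxE eqxx.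
exists U, (fun i => Re (d 0 i)); split; [exact: uU|by move=> i; exact: ge0_Re|].
rewrite [LHS]AE; congr (_ *m diag_mx _ *m _); apply/rowP => i.
by rewrite mxE -ge0_ReE.
Qed.

Lemma psd_sqrt n (A : 'M[C]_n) : psd A -> exists2 B : 'M[C]_n, psd B & A = B *m B.
Proof.
move=> /psd_fcalcP[U [d [uU d_ge0 ->]]].
exists (fcalc U (fun i => (Num.sqrt (d i))%:C)).
  by apply: psd_fcalc => i; rewrite ler0c sqrtr_ge0.
rewrite (fcalcM _ _ uU); apply: eq_fcalc => i.
by rewrite -[in LHS](sqr_sqrtr (d_ge0 i)) expr2 rmorphM.
Qed.

Lemma psd_gramP n (A : 'M[C]_n) : psd A -> exists B : 'M[C]_n, A = B *m B^t*.
Proof. by move=> /psd_sqrt[B /psd_herm hB ->]; exists B; rewrite hB. Qed.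

Lemma psd_trM_ge0 n (A B : 'M[C]_n) : psd A -> psd B -> 0 <= retr (A *m B).
Proof.
move=> hA /psd_gramP[K ->]; rewrite mulmxA retr_mulC mulmxA.
exact/psd_retr_ge0/psd_conjV.
Qed.

Lemma psd_tr0 n (A : 'M[C]_n) : psd A -> retr A = 0 -> A = 0.
Proof.
move=> /psd_fcalcP[U [d [uU d_ge0 ->]]]; rewrite /retr (mxtrace_fcalc _ uU) -rmorph_sum /=.
move=> /psumr_eq0P d_eq0; rewrite -[RHS](scale0r (fcalc U (fun=> 1))) -fcalcZ.
by apply: eq_fcalc => i; rewrite mul0r d_eq0.
Qed.

Lemma psd_le_trace n (A : 'M[C]_n) : psd A -> psd ((\tr A)%:M - A).
Proof.
move=> /psd_fcalcP[U [d [uU d_ge0 ->]]]; rewrite -(fcalc_const _ uU) -fcalcB.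
apply: psd_fcalc => i; rewrite (mxtrace_fcalc _ uU) -rmorph_sum -rmorphB ler0c.
by rewrite subr_ge0 (bigD1 i) //= lerDl sumr_ge0.
Qed.

Lemma psdD_scalar_unit n (A : 'M[C]_n) (e : R) :
  0 < e -> psd A -> A + e%:C%:M \in unitmx.
Proof.
move=> e0 /psd_fcalcP[U [d [uU d_ge0 ->]]]; rewrite -(fcalc_const _ uU) -fcalcD.
have de0 i : d i + e != 0 by rewrite gt_eqF // ltr_wpDl.
have /mulmx1_unit[fcalc_unit _] : fcalc U (fun i => (d i)%:C + e%:C) *m
    fcalc U (fun i => (d i + e)^-1%:C) = 1%:M.
  rewrite (fcalcM _ _ uU) -(fcalc_const _ uU); apply: eq_fcalc => i.
  by rewrite -rmorphD -rmorphM /= divff.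
exact: fcalc_unit.
Qed.

Lemma psd_max_state n (A : 'M[C]_n) : (0 < n)%N -> psd A ->
  exists2 s : 'M[C]_n, density s & psd ((retr (A *m s))%:C%:M - A).
Proof.
move=> n0 /psd_fcalcP[U [d [uU d_ge0 AE]]].
pose k := [arg max_(i > Ordinal n0) d i]%O.
have dk i : d i <= d k by rewrite /k; case: arg_maxP => // j _; exact.
exists (fcalc U (fun i => (i == k)%:R)).
  split; first by apply: psd_fcalc => i; exact: ler0n.
  by rewrite mxtrace_fcalc // (@big_only1 _ _ _ _ k) ?eqxx // => i /negbTE ->.
rewrite AE (fcalcM _ _ uU) /retr (mxtrace_fcalc _ uU).
rewrite (@big_only1 _ _ _ _ k) // => [|i /negbTE-> _]; last by rewrite mulr0.
rewrite eqxx mulr1 -(fcalc_const _ uU) -fcalcB; apply: psd_fcalc => i.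
by rewrite -rmorphB ler0c subr_ge0.
Qed.

Lemma psd_tens m n (A : 'M[C]_m) (B : 'M[C]_n) : psd A -> psd B -> psd (A *t B).
Proof.
move=> /psd_gramP[K ->] /psd_gramP[L ->].
by rewrite -tensmx_mul -adjmx_tens; exact: psd_gram.
Qed.

Lemma psd_trmx n (A : 'M[C]_n) : psd A -> psd A^T.
Proof.
move=> /psd_gramP[B ->]; rewrite trmx_mul.
have -> : B^T = (B^t*)^T^t* by apply/matrixP => i j; rewrite adjmxE !mxE conjCK.
exact: psd_gram.
Qed.

Lemma psd_reindex p q (f : 'I_p -> 'I_q) (Z : 'M[C]_q) :
  psd Z -> psd (Defs.reindex f Z).
Proof.
move=> /psd_gramP[B ->].
have -> : Defs.reindex f (B *m B^t*) = rowsub f B *m (rowsub f B)^t*.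
  by apply/matrixP => i j; rewrite !mxE; apply: eq_bigr => k _; rewrite !mxE.
exact: psd_gram.
Qed.

Definition normalize n (A : 'M[C]_n) : 'M[C]_n := (retr A)^-1%:C *: A.

Lemma psd_normalize n (A : 'M[C]_n) : psd A -> psd (normalize A).
Proof. by move=> hA; apply: psdZ; rewrite // invr_ge0 psd_retr_ge0. Qed.

Lemma retr_normalize_le1 n (A : 'M[C]_n) : retr (normalize A) <= 1.
Proof.
by rewrite retrZ; have [->|A_neq0] := eqVneq (retr A) 0; rewrite ?mulr0 ?mulVf.
Qed.

Lemma psd_retr_gt0 n (A : 'M[C]_n) : psd A -> A != 0 -> 0 < retr A.
Proof.
move=> hA; apply: contraNT; rewrite lt_def (psd_retr_ge0 hA) andbT negbK.
by move=> /eqP/(psd_tr0 hA)->.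
Qed.

Lemma density_normalize n (A : 'M[C]_n) : psd A -> A != 0 -> density (normalize A).
Proof.
move=> hA /(psd_retr_gt0 hA) t_gt0.
split; first exact: psd_normalize.
by rewrite mxtraceZ psd_trE // -rmorphM /= mulVf // gt_eqF.
Qed.

Lemma scale_normalize n (A : 'M[C]_n) : psd A -> (retr A)%:C *: normalize A = A.
Proof.
move=> hA; have [->|/(psd_retr_gt0 hA) t_gt0] := eqVneq A 0.
  by rewrite /normalize !scaler0.
by rewrite scalerA -rmorphM /= divff ?gt_eqF // scale1r.
Qed.

Lemma density_delta n (i : 'I_n) : density (delta_mx i i : 'M[C]_n).
Proof.
split; first exact: psd_delta.
rewrite /mxtrace (@big_only1 _ _ _ _ i) // => [|j /negbTE ji _].
  by rewrite mxE eqxx.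
by rewrite mxE ji.
Qed.

Lemma density_convex n (t : R) (A B : 'M[C]_n) : 0 <= t <= 1 ->
  density A -> density B -> density (t%:C *: A + (1 - t)%:C *: B).
Proof.
move=> /andP[t0 t1] [hA A1] [hB B1]; split.
  by apply: psdD; apply: psdZ => //; rewrite subr_ge0.
by rewrite mxtraceD !mxtraceZ A1 B1 !mulr1 -rmorphD /= addrC subrK.
Qed.

Lemma psd_densityP n (A : 'M[C]_n) : A^t* = A ->
  (forall w, density w -> 0 <= retr (w *m A)) -> psd A.
Proof.
move=> hA h v; have hw : psd (v *m v^t*) by exact: psd_gram.
have -> : (v^t* *m A *m v) 0 0 = \tr (v *m v^t* *m A).
  by rewrite -[in RHS]mulmxA mxtrace_mulC /mxtrace big_ord1.
have -> : \tr (v *m v^t* *m A) = (retr (v *m v^t* *m A))%:C.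
  rewrite /retr RRe_real //; apply/CrealP; rewrite -mxtrace_adj !adjmxM adjmxK hA.
  by rewrite mxtrace_mulC.
rewrite ler0c; have [->|w_neq0] := eqVneq (v *m v^t*) 0; first by rewrite mul0mx raddf0.
rewrite -(scale_normalize hw) -scalemxAl retrZ.
by apply: mulr_ge0; [exact: psd_retr_ge0|exact/h/density_normalize].
Qed.

End PositiveSemidefinite.

(** * Tensor products *)

Section TensorProducts.
Variable R : realType.
Local Notation C := R[i].
Local Notation ix := mxtens_index.

Section LinearMaps.
Variables (U V : lmodType C) (f : U -> V).
Hypothesis f_lin : linear f.

Let F : {linear U -> V} := HB.pack f (GRing.isLinear.Build C U V *:%R f f_lin).

Lemma lin0 : f 0 = 0.
Proof. exact: (linear0 F). Qed.

Lemma linD u v : f (u + v) = f u + f v.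
Proof. exact: (linearD F). Qed.

Lemma linB u v : f (u - v) = f u - f v.
Proof. exact: (linearB F). Qed.

Lemma linZ a u : f (a *: u) = a *: f u.
Proof. exact: (linearZ_LR F). Qed.

Lemma lin_sum (I : Type) (s : seq I) (P : pred I) (E : I -> U) :
  f (\sum_(i <- s | P i) E i) = \sum_(i <- s | P i) f (E i).
Proof. exact: (linear_sum F). Qed.

End LinearMaps.

Lemma tensmxPl m n p q (B : 'M[C]_(p, q)) a (A A' : 'M[C]_(m, n)) :
  (a *: A + A') *t B = a *: (A *t B) + A' *t B.
Proof. by apply/matrixP => i j; rewrite !mxE mulrDl mulrA. Qed.

Lemma tensmxPr m n p q (A : 'M[C]_(m, n)) a (B B' : 'M[C]_(p, q)) :
  A *t (a *: B + B') = a *: (A *t B) + A *t B'.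
Proof. by apply/matrixP => i j; rewrite !mxE mulrDr mulrCA. Qed.

Lemma tensmxZl m n p q a (A : 'M[C]_(m, n)) (B : 'M[C]_(p, q)) :
  (a *: A) *t B = a *: (A *t B).
Proof. exact: linZ (tensmxPl B) a A. Qed.

Lemma tensmxZr m n p q a (A : 'M[C]_(m, n)) (B : 'M[C]_(p, q)) :
  A *t (a *: B) = a *: (A *t B).
Proof. exact: linZ (tensmxPr A) a B. Qed.

Lemma tensmxDl m n p q (A A' : 'M[C]_(m, n)) (B : 'M[C]_(p, q)) :
  (A + A') *t B = A *t B + A' *t B.
Proof. exact: linD (tensmxPl B) A A'. Qed.

Lemma tensmxBl m n p q (A A' : 'M[C]_(m, n)) (B : 'M[C]_(p, q)) :
  (A - A') *t B = A *t B - A' *t B.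
Proof. exact: linB (tensmxPl B) A A'. Qed.

Lemma tensmxBr m n p q (A : 'M[C]_(m, n)) (B B' : 'M[C]_(p, q)) :
  A *t (B - B') = A *t B - A *t B'.
Proof. exact: linB (tensmxPr A) B B'. Qed.

Lemma tensmx_suml m n p q (I : Type) (s : seq I) (P : pred I)
    (E : I -> 'M[C]_(m, n)) (B : 'M[C]_(p, q)) :
  (\sum_(i <- s | P i) E i) *t B = \sum_(i <- s | P i) (E i *t B).
Proof. exact: (lin_sum (f := fun A => A *t B) (tensmxPl B)). Qed.

Lemma tensmx_sumr m n p q (I : Type) (s : seq I) (P : pred I)
    (A : 'M[C]_(m, n)) (E : I -> 'M[C]_(p, q)) :
  A *t (\sum_(i <- s | P i) E i) = \sum_(i <- s | P i) (A *t E i).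
Proof. exact: (lin_sum (f := fun B => A *t B) (tensmxPr A)). Qed.

Lemma mulmxPl m n p a (A A' : 'M[C]_(m, n)) (B : 'M[C]_(n, p)) :
  (a *: A + A') *m B = a *: (A *m B) + A' *m B.
Proof. exact: linearPl. Qed.

Lemma mulmxPr m n p a (A : 'M[C]_(m, n)) (B B' : 'M[C]_(n, p)) :
  A *m (a *: B + B') = a *: (A *m B) + A *m B'.
Proof. exact: linearPr. Qed.

Lemma big_mxtens (V : nmodType) m n (F : 'I_(m * n) -> V) :
  \sum_k F k = \sum_i \sum_j F (ix (i, j)).
Proof.
rewrite pair_big (reindex (fun p : 'I_m * 'I_n => ix p)) /=.
  by apply: eq_bigr => -[i j].
by exists (@mxtens_unindex m n) => k _; rewrite ?mxtens_indexK ?mxtens_unindexK.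
Qed.

Lemma eq_mxtens_index m n (i j : 'I_m) (k l : 'I_n) :
  (ix (i, k) == ix (j, l)) = (i == j) && (k == l).
Proof. by rewrite (can_eq (@mxtens_indexK m n)). Qed.

Lemma mxtensP m n p q (A B : 'M[C]_(m * n, p * q)) :
  (forall i j k l, A (ix (i, j)) (ix (k, l)) = B (ix (i, j)) (ix (k, l))) -> A = B.
Proof.
move=> h; apply/matrixP => a b.
by case: (mxtens_indexP a) => i j; case: (mxtens_indexP b) => k l.
Qed.

Lemma mxtrace_tens m n (A : 'M[C]_m) (B : 'M[C]_n) : \tr (A *t B) = \tr A * \tr B.
Proof.
rewrite /mxtrace big_mxtens mulr_suml; apply: eq_bigr => i _.
by rewrite mulr_sumr; apply: eq_bigr => j _; rewrite tensmxE.
Qed.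

Lemma tensmx11 m n : (1%:M : 'M[C]_m) *t (1%:M : 'M[C]_n) = 1%:M.
Proof.
by apply: mxtensP => i j k l; rewrite tensmxE !mxE eq_mxtens_index -natrM mulnb.
Qed.

Lemma tensmx_delta m n p q (i : 'I_m) (j : 'I_n) (k : 'I_p) (l : 'I_q) :
  (delta_mx i j : 'M[C]__) *t (delta_mx k l : 'M[C]__) =
  delta_mx (ix (i, k)) (ix (j, l)).
Proof.
apply: mxtensP => a b c d; rewrite tensmxE !mxE !eq_mxtens_index -natrM mulnb.
by rewrite andbACA.
Qed.

Lemma sum_delta1 n : \sum_i (delta_mx i i : 'M[C]_n) = 1%:M.
Proof.
rewrite (matrix_sum_delta 1%:M); apply: eq_bigr => i _.
rewrite (@big_only1 _ _ _ _ i) // => [|j /negbTE ji _]; rewrite mxE ?eqxx ?scale1r //.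
by rewrite eq_sym ji scale0r.
Qed.

Lemma eq_linear_delta m n (V : lmodType C) (F G : 'M[C]_(m, n) -> V) :
  linear F -> linear G ->
  (forall i j, F (delta_mx i j) = G (delta_mx i j)) -> F =1 G.
Proof.
move=> lF lG h X; rewrite [X]matrix_sum_delta (lin_sum lF) (lin_sum lG).
apply: eq_bigr => i _; rewrite (lin_sum lF) (lin_sum lG); apply: eq_bigr => j _.
by rewrite (linZ lF) (linZ lG) h.
Qed.

Lemma eq_linear_tensmx m n p q (V : lmodType C) (F G : 'M[C]_(m * n, p * q) -> V) :
  linear F -> linear G -> (forall A B, F (A *t B) = G (A *t B)) -> F =1 G.
Proof.
move=> lF lG h; apply: eq_linear_delta => // a b.
case: (mxtens_indexP a) => i j; case: (mxtens_indexP b) => k l.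
by rewrite -tensmx_delta h.
Qed.

Lemma eq_scalar_tensmx m n p q (F G : 'M[C]_(m * n, p * q) -> C) :
  scalar F -> scalar G -> (forall A B, F (A *t B) = G (A *t B)) -> F =1 G.
Proof. exact: (@eq_linear_tensmx _ _ _ _ C^o). Qed.

Lemma mxtrace_delta_mul m n (i : 'I_m) (j : 'I_n) (A : 'M[C]_(n, m)) :
  \tr (delta_mx i j *m A) = A j i.
Proof.
rewrite -[in LHS](mul_delta_mx (0 : 'I_1)) -mulmxA mxtrace_mulC delta_mulmx_delta.
by rewrite mxtraceZ /mxtrace big_ord1 mxE mulr1.
Qed.

Lemma eq_mx_tr n (A B : 'M[C]_n) :
  (forall X, \tr (X *m A) = \tr (X *m B)) -> A = B.
Proof.
by move=> h; apply/matrixP => i j; have := h (delta_mx j i); rewrite !mxtrace_delta_mul.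
Qed.

Lemma reindex_linear p q (f : 'I_p -> 'I_q) : linear (Defs.reindex f : 'M[C]_q -> 'M[C]_p).
Proof. by move=> a A B; apply/matrixP => i j; rewrite !mxE. Qed.

HB.instance Definition _ p q (f : 'I_p -> 'I_q) :=
  GRing.isLinear.Build C _ _ _ (Defs.reindex f) (reindex_linear f).

Lemma reindexM p q (f : 'I_p -> 'I_q) (A B : 'M[C]_q) : bijective f ->
  Defs.reindex f (A *m B) = Defs.reindex f A *m Defs.reindex f B.
Proof.
move=> bij_f; apply/matrixP => i j; rewrite !mxE (reindex f) /=.
  by apply: eq_bigr => k _; rewrite !mxE.
by case: bij_f => g fK gK; exists g => k _; rewrite ?fK ?gK.
Qed.

Lemma reindex1 p q (f : 'I_p -> 'I_q) :
  injective f -> Defs.reindex f (1%:M : 'M[C]_q) = 1%:M.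
Proof. by move=> inj_f; apply/matrixP => i j; rewrite !mxE (inj_eq inj_f). Qed.

Lemma mxtrace_reindex p q (f : 'I_p -> 'I_q) (A : 'M[C]_q) :
  bijective f -> \tr (Defs.reindex f A) = \tr A.
Proof.
move=> [g fK gK]; rewrite /mxtrace [RHS](reindex f) /=.
  by apply: eq_bigr => i _; rewrite mxE.
by exists g => i _; rewrite ?fK ?gK.
Qed.

Lemma castmx_reindex p q (e e' : p = q) (A : 'M[C]_p) :
  castmx (e, e') A = Defs.reindex (cast_ord (esym e)) A.
Proof. by apply/matrixP => i j; rewrite castmxE mxE (eq_irrelevance e' e). Qed.

Lemma castmx_linear p q (e e' : p = q) : linear (fun A : 'M[C]_p => castmx (e, e') A).
Proof. by move=> a A B; rewrite !castmx_reindex linearP. Qed.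

HB.instance Definition _ p q (e e' : p = q) :=
  GRing.isLinear.Build C _ _ _ (@castmx C p p q q (e, e')) (castmx_linear e e').

Lemma mxtens_indexA m n p (i : 'I_m) (j : 'I_n) (k : 'I_p)
    (e : (m * (n * p) = m * n * p)%N) :
  cast_ord e (ix (i, ix (j, k))) = ix (ix (i, j), k).
Proof. by apply: val_inj => /=; rewrite mulnDl addnA mulnA. Qed.

Lemma tensmxA m n p (A : 'M[C]_m) (B : 'M[C]_n) (D : 'M[C]_p)
    (e e' : (m * (n * p) = m * n * p)%N) :
  castmx (e, e') (A *t (B *t D)) = (A *t B) *t D.
Proof.
apply: mxtensP => ij k ij' k'.
case: (mxtens_indexP ij) => i j; case: (mxtens_indexP ij') => i' j'.
rewrite castmxE !tensmxE -(mxtens_indexA _ _ _ e) -(mxtens_indexA _ _ _ e') !cast_ordK.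
by rewrite !tensmxE mulrA.
Qed.

Lemma tensmxAV m n p (A : 'M[C]_m) (B : 'M[C]_n) (D : 'M[C]_p)
    (e e' : (m * n * p = m * (n * p))%N) :
  castmx (e, e') ((A *t B) *t D) = A *t (B *t D).
Proof. by rewrite -(tensmxA A B D (esym e) (esym e')) castmx_comp castmx_id. Qed.

Definition swap_idx m n (a : 'I_(m * n)) : 'I_(n * m) :=
  ix ((mxtens_unindex a).2, (mxtens_unindex a).1).

Lemma swap_idxK m n : cancel (@swap_idx m n) (@swap_idx n m).
Proof. by move=> a; case: (mxtens_indexP a) => i j; rewrite /swap_idx !mxtens_indexK. Qed.

Lemma swap_idx_bij m n : bijective (@swap_idx m n).
Proof. by exists (@swap_idx n m); exact: swap_idxK. Qed.

Definition swapmx m n : lmap R (m * n) (n * m) := Defs.reindex (@swap_idx n m).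

Lemma swapmx_linear m n : linear (@swapmx m n).
Proof. exact: reindex_linear. Qed.

Lemma swapmxK m n : cancel (@swapmx m n) (@swapmx n m).
Proof. by move=> A; apply/matrixP => i j; rewrite !mxE !swap_idxK. Qed.

Lemma swapmx_tens m n (A : 'M[C]_m) (B : 'M[C]_n) : swapmx (A *t B) = B *t A.
Proof.
by apply: mxtensP => i j k l; rewrite mxE /swap_idx !mxtens_indexK !tensmxE mulrC.
Qed.

Lemma mxtrace_swapmx_mul m n (A B : 'M[C]_(m * n)) :
  \tr (swapmx A *m swapmx B) = \tr (A *m B).
Proof.
by rewrite -(reindexM _ _ (@swap_idx_bij n m)) mxtrace_reindex //; exact: swap_idx_bij.
Qed.

Definition blk n k (X : 'M[C]_(n * k)) (x y : 'I_k) : 'M[C]_n :=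
  \matrix_(p, q) X (ix (p, x)) (ix (q, y)).

Lemma blk_linear n k (x y : 'I_k) : linear (fun X : 'M[C]_(n * k) => blk X x y).
Proof. by move=> a A B; apply/matrixP => p q; rewrite !mxE. Qed.

Lemma blk_tens n k (A : 'M[C]_n) (B : 'M[C]_k) x y : blk (A *t B) x y = B x y *: A.
Proof. by apply/matrixP => p q; rewrite !mxE !mxtens_indexK mulrC. Qed.

Definition ptr n k (w : 'M[C]_(n * k)) : 'M[C]_n := \sum_x blk w x x.

Lemma ptr_linear n k : linear (@ptr n k).
Proof.
move=> a A B; rewrite /ptr scaler_sumr -big_split; apply: eq_bigr => x _.
exact: blk_linear.
Qed.

HB.instance Definition _ n k := GRing.isLinear.Build C _ _ _ (@ptr n k) (@ptr_linear n k).

Lemma ptr_tens n k (A : 'M[C]_n) (B : 'M[C]_k) : ptr (A *t B) = \tr B *: A.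
Proof. by rewrite scaler_suml; apply: eq_bigr => x _; rewrite blk_tens. Qed.

Lemma psd_ptr n k (w : 'M[C]_(n * k)) : psd w -> psd (ptr w).
Proof.
move=> hw; apply: psd_sum => x _.
exact: (psd_reindex (fun p => ix (p, x)) hw).
Qed.

Lemma mxtrace_tens1_mul n k (A : 'M[C]_n) (w : 'M[C]_(n * k)) :
  \tr ((A *t 1%:M) *m w) = \tr (A *m ptr w).
Proof.
move: w; apply: eq_scalar_tensmx => [a u v|a u v|X Y].
- by rewrite mulmxPr mxtraceD mxtraceZ.
- by rewrite linearP mulmxPr mxtraceD mxtraceZ.
by rewrite tensmx_mul mul1mx mxtrace_tens ptr_tens -scalemxAr mxtraceZ mulrC.
Qed.

Lemma mxtrace_ptr n k (w : 'M[C]_(n * k)) : \tr (ptr w) = \tr w.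
Proof. by rewrite -[ptr w]mul1mx -mxtrace_tens1_mul tensmx11 mul1mx. Qed.

Lemma retr_ptr1 n m (w : 'M[C]_(n * m)) : ptr w = 1%:M -> retr w = n%:R.
Proof. by move=> w1; rewrite /retr -mxtrace_ptr w1 -/(retr _) retr1. Qed.

End TensorProducts.

(** * Linear maps and channels *)

Section Channels.
Variable R : realType.
Local Notation C := R[i].
Local Notation ix := mxtens_index.

Lemma idmap_linear n : linear (@idmap R n).
Proof. by []. Qed.

Lemma tmap_linear n1 m1 n2 m2 (f : lmap R n1 m1) (g : lmap R n2 m2) :
  linear (tmap f g).
Proof.
move=> a X Y; rewrite /tmap scaler_sumr -big_split; apply: eq_bigr => i _ /=.
rewrite scaler_sumr -big_split; apply: eq_bigr => j _ /=.
by rewrite !mxE scalerDl scalerA.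
Qed.

HB.instance Definition _ n1 m1 n2 m2 (f : lmap R n1 m1) (g : lmap R n2 m2) :=
  GRing.isLinear.Build C _ _ _ (tmap f g) (tmap_linear f g).

Lemma tmap_tens n1 m1 n2 m2 (f : lmap R n1 m1) (g : lmap R n2 m2) A B :
  linear f -> linear g -> tmap f g (A *t B) = f A *t g B.
Proof.
move=> lf lg; move: A; apply: eq_linear_delta => [a u v|a u v|i j].
- by rewrite tensmxPl tmap_linear.
- by rewrite lf tensmxPl.
move: B; apply: eq_linear_delta => [a u v|a u v|k l].
- by rewrite tensmxPr tmap_linear.
- by rewrite lg tensmxPr.
rewrite tensmx_delta /tmap (@big_only1 _ _ _ _ (ix (i, k))) // => [|a hn _].
  rewrite (@big_only1 _ _ _ _ (ix (j, l))) // => [|b hn _].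
    by rewrite mxE !eqxx scale1r !mxtens_indexK.
  by rewrite mxE (negbTE hn) andbF scale0r.
by rewrite big1 // => b _; rewrite mxE (negbTE hn) scale0r.
Qed.

Lemma tmap_combl n1 m1 n2 m2 a b (f f' : lmap R n1 m1) (g : lmap R n2 m2) X :
  tmap (fun Y => a *: f Y + b *: f' Y) g X = a *: tmap f g X + b *: tmap f' g X.
Proof.
rewrite /tmap !scaler_sumr -big_split; apply: eq_bigr => i _ /=.
rewrite !scaler_sumr -big_split; apply: eq_bigr => j _ /=.
by rewrite tensmxPl tensmxZl scalerDr !scalerA [a * _]mulrC [b * _]mulrC.
Qed.

Lemma tmapDl n1 m1 n2 m2 (f f' : lmap R n1 m1) (g : lmap R n2 m2) X :
  tmap (f \+ f') g X = tmap f g X + tmap f' g X.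
Proof.
rewrite /tmap -big_split; apply: eq_bigr => i _; rewrite -big_split.
by apply: eq_bigr => j _; rewrite tensmxDl scalerDr.
Qed.

Lemma tmapBl n1 m1 n2 m2 (f f' : lmap R n1 m1) (g : lmap R n2 m2) X :
  tmap (f \- f') g X = tmap f g X - tmap f' g X.
Proof.
rewrite /tmap -sumrB; apply: eq_bigr => i _; rewrite -sumrB; apply: eq_bigr => j _.
by rewrite tensmxBl scalerBr.
Qed.

Lemma tmapBr n1 m1 n2 m2 (f : lmap R n1 m1) (g g' : lmap R n2 m2) X :
  tmap f (g \- g') X = tmap f g X - tmap f g' X.
Proof.
rewrite /tmap -sumrB; apply: eq_bigr => i _; rewrite -sumrB; apply: eq_bigr => j _.
by rewrite tensmxBr scalerBr.
Qed.

Lemma tmap_comp n1 m1 p1 n2 m2 p2 (f : lmap R m1 p1) (f' : lmap R n1 m1)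
    (g : lmap R m2 p2) (g' : lmap R n2 m2) X :
  linear f -> linear f' -> linear g -> linear g' ->
  tmap (f \o f') (g \o g') X = tmap f g (tmap f' g' X).
Proof.
move=> lf lf' lg lg'; move: X; apply: eq_linear_tensmx => [||A B].
- exact: tmap_linear.
- by move=> a u v; rewrite !tmap_linear.
by rewrite !tmap_tens // => a u v /=; rewrite (lf', lg') (lf, lg).
Qed.

Lemma tmap_id_comp n m p k (f : lmap R m p) (g : lmap R n m) X :
  linear f -> linear g ->
  tmap (f \o g) (@idmap R k) X = tmap f (@idmap R k) (tmap g (@idmap R k) X).
Proof. by move=> lf lg; rewrite -tmap_comp. Qed.

Lemma tmap_commute n1 m1 n2 m2 (f : lmap R n1 m1) (g : lmap R n2 m2) X :
  linear f -> linear g ->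
  tmap f (@idmap R m2) (tmap (@idmap R n1) g X) =
  tmap (@idmap R m1) g (tmap f (@idmap R n2) X).
Proof. by move=> lf lg; rewrite -!tmap_comp. Qed.

Lemma tmap_mulmxr n m k l (f : lmap R n m) (F : 'M[C]_(k, l)) (G : 'M[C]_(l, k))
    (X : 'M[C]_(n * l)) : linear f ->
  tmap f (@idmap R k) ((1%:M *t F) *m X *m (1%:M *t G)) =
  (1%:M *t F) *m tmap f (@idmap R l) X *m (1%:M *t G).
Proof.
move=> lf; move: X; apply: eq_linear_tensmx => [a u v|a u v|A B].
- by rewrite mulmxPr mulmxPl tmap_linear.
- by rewrite tmap_linear mulmxPr mulmxPl.
by rewrite !tensmx_mul !tmap_tens // !tensmx_mul !mul1mx !mulmx1.
Qed.

Lemma tmap_mulmxl n m k l (g : lmap R n m) (F : 'M[C]_(k, l)) (G : 'M[C]_(l, k))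
    (X : 'M[C]_(l * n)) : linear g ->
  tmap (@idmap R k) g ((F *t 1%:M) *m X *m (G *t 1%:M)) =
  (F *t 1%:M) *m tmap (@idmap R l) g X *m (G *t 1%:M).
Proof.
move=> lg; move: X; apply: eq_linear_tensmx => [a u v|a u v|A B].
- by rewrite mulmxPr mulmxPl tmap_linear.
- by rewrite tmap_linear mulmxPr mulmxPl.
by rewrite !tensmx_mul !tmap_tens // !tensmx_mul !mul1mx !mulmx1.
Qed.

Lemma tmap_idE n m k (f : lmap R n m) (X : 'M[C]_(n * k)) x y : linear f ->
  blk (tmap f (@idmap R k) X) x y = f (blk X x y).
Proof.
move=> lf; move: X; apply: eq_linear_tensmx => [a u v|a u v|A B].
- by rewrite tmap_linear blk_linear.
- by rewrite blk_linear lf.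
by rewrite tmap_tens // !blk_tens (linZ lf).
Qed.

Lemma tmap_swapmx n1 m1 n2 m2 (f : lmap R n1 m1) (g : lmap R n2 m2) X :
  linear f -> linear g -> tmap g f (swapmx X) = swapmx (tmap f g X).
Proof.
move=> lf lg; move: X; apply: eq_linear_tensmx => [a u v|a u v|A B].
- by rewrite swapmx_linear tmap_linear.
- by rewrite tmap_linear swapmx_linear.
by rewrite swapmx_tens !tmap_tens // swapmx_tens.
Qed.

Lemma tmap_tmapA n m j k (f : lmap R n m) : linear f ->
  tmap (tmap f (@idmap R j)) (@idmap R k) =
  castmx (mulnA m j k, mulnA m j k) \o tmap f (@idmap R (j * k))
    \o castmx (esym (mulnA n j k), esym (mulnA n j k)).
Proof.
move=> lf; apply/funext; apply: eq_linear_tensmx => [a u v|a u v|A B] /=.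
- exact: tmap_linear.
- by rewrite castmx_linear tmap_linear castmx_linear.
rewrite tmap_tens //; last exact: tmap_linear.
move: A; apply: eq_linear_tensmx => [a u v|a u v|A A'].
- by rewrite tmap_linear tensmxPl.
- by rewrite tensmxPl castmx_linear tmap_linear castmx_linear.
by rewrite tensmxAV !tmap_tens // tensmxA.
Qed.

(** ** Kraus decompositions *)

Definition kraus n m (S : finType) (K : S -> 'M[C]_(m, n)) : lmap R n m :=
  fun X => \sum_s (K s *m X *m (K s)^t*).

Definition conjm n m (K : 'M[C]_(m, n)) : lmap R n m := fun X => K *m X *m K^t*.

Definition dual_kraus n m (S : finType) (K : S -> 'M[C]_(m, n)) : lmap R m n :=
  kraus (fun s => (K s)^t*).

Lemma kraus_linear n m (S : finType) (K : S -> 'M[C]_(m, n)) : linear (kraus K).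
Proof.
move=> a u v; rewrite /kraus scaler_sumr -big_split; apply: eq_bigr => s _ /=.
by rewrite mulmxPr mulmxPl.
Qed.

Lemma psd_kraus n m (S : finType) (K : S -> 'M[C]_(m, n)) X :
  psd X -> psd (kraus K X).
Proof. by move=> hX; apply: psd_sum => s _; exact: psd_conj. Qed.

Lemma tmap_kraus n m k (S : finType) (K : S -> 'M[C]_(m, n)) :
  tmap (kraus K) (@idmap R k) =1 kraus (fun s => K s *t 1%:M).
Proof.
apply: eq_linear_tensmx => [||A B]; [exact: tmap_linear|exact: kraus_linear|].
rewrite tmap_tens; [|exact: kraus_linear|exact: idmap_linear].
rewrite /kraus tensmx_suml; apply: eq_bigr => s _.
by rewrite adjmx_tens adjmx1 !tensmx_mul mul1mx mulmx1.
Qed.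

Lemma tmap_dual_kraus n m k (S : finType) (K : S -> 'M[C]_(m, n)) :
  tmap (dual_kraus K) (@idmap R k) =1 dual_kraus (fun s => K s *t 1%:M).
Proof.
move=> X; rewrite /dual_kraus tmap_kraus; apply: eq_bigr => s _.
by rewrite [(K s *t _)^t*]adjmx_tens adjmx1.
Qed.

Lemma CP_kraus n m (S : finType) (K : S -> 'M[C]_(m, n)) : CP (kraus K).
Proof. by move=> k X hX; rewrite tmap_kraus; exact: psd_kraus. Qed.

Lemma conjm_kraus n m (K : 'M[C]_(m, n)) : conjm K = kraus (fun _ : 'I_1 => K).
Proof. by apply/funext => X; rewrite /kraus big_ord1. Qed.

Lemma CP_conjm n m (K : 'M[C]_(m, n)) : CP (conjm K).
Proof. by rewrite conjm_kraus; exact: CP_kraus. Qed.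

Lemma conjm_linear n m (K : 'M[C]_(m, n)) : linear (conjm K).
Proof. by rewrite conjm_kraus; exact: kraus_linear. Qed.

Lemma tmap_conjm n m k (K : 'M[C]_(m, n)) :
  tmap (conjm K) (@idmap R k) = conjm (K *t 1%:M).
Proof. by rewrite !conjm_kraus; apply/funext; exact: tmap_kraus. Qed.

Lemma conjmM n m p (K : 'M[C]_(m, n)) (L : 'M[C]_(p, m)) X :
  conjm L (conjm K X) = conjm (L *m K) X.
Proof. by rewrite /conjm adjmxM !mulmxA. Qed.

Lemma tmap_conjmr n m k l (f : lmap R n m) (F : 'M[C]_(k, l)) (X : 'M[C]_(n * l)) :
  linear f ->
  tmap f (@idmap R k) (conjm (1%:M *t F) X) = conjm (1%:M *t F) (tmap f (@idmap R l) X).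
Proof. by move=> lf; rewrite /conjm !adjmx_tens !adjmx1 tmap_mulmxr. Qed.

Lemma mxtrace_conjm n m (K : 'M[C]_(m, n)) X (P : 'M[C]_m) :
  \tr (conjm K X *m P) = \tr (X *m (K^t* *m P *m K)).
Proof. by rewrite /conjm -!mulmxA mxtrace_mulC !mulmxA. Qed.

Lemma mxtrace_kraus n m (S : finType) (K : S -> 'M[C]_(m, n)) X (P : 'M[C]_m) :
  \tr (kraus K X *m P) = \tr (X *m dual_kraus K P).
Proof.
rewrite /dual_kraus /kraus mulmx_suml mulmx_sumr !raddf_sum; apply: eq_bigr => s _ /=.
by rewrite adjmxK -!mulmxA mxtrace_mulC -!mulmxA.
Qed.

Lemma TP_krausP n m (S : finType) (K : S -> 'M[C]_(m, n)) :
  TP (kraus K) <-> dual_kraus K 1%:M = 1%:M.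
Proof.
split=> [tK|K1 X]; last by rewrite -[kraus K X]mulmx1 mxtrace_kraus K1 mulmx1.
by apply: eq_mx_tr => X; rewrite -mxtrace_kraus !mulmx1 tK.
Qed.

Lemma channel_kraus n m (S : finType) (K : S -> 'M[C]_(m, n)) :
  dual_kraus K 1%:M = 1%:M -> channel (kraus K).
Proof.
by move=> K1; split; [exact: kraus_linear|split; [exact: CP_kraus|exact/TP_krausP]].
Qed.

(* The unnormalised maximally entangled state [|I>><<I|]. *)
Definition Omega n : 'M[C]_(n * n) :=
  \matrix_(a, b) (((mxtens_unindex a).1 == (mxtens_unindex a).2)
                  && ((mxtens_unindex b).1 == (mxtens_unindex b).2))%:R.

Lemma OmegaE n i j k l : Omega n (ix (i, j)) (ix (k, l)) = ((i == j) && (k == l))%:R.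
Proof. by rewrite mxE !mxtens_indexK. Qed.

Lemma psd_Omega n : psd (Omega n).
Proof.
pose v : 'cV[C]_(n * n) := \col_a ((mxtens_unindex a).1 == (mxtens_unindex a).2)%:R.
have -> : Omega n = v *m v^t*.
  by apply/matrixP => a b; rewrite mxE [RHS]mxE big_ord1 !mxE rmorph_nat -natrM mulnb.
exact: psd_gram.
Qed.

Lemma Omega_sum n : Omega n = \sum_i \sum_j (delta_mx i j *t delta_mx i j).
Proof.
rewrite [LHS]matrix_sum_delta big_mxtens; apply: eq_bigr => i _.
rewrite (@big_only1 _ _ _ _ i) // => [|k /negbTE ki _]; last first.
  by rewrite big1 // => l _; case: (mxtens_indexP l) => j j'; rewrite OmegaE eq_sym ki scale0r.
rewrite big_mxtens; apply: eq_bigr => j _.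
rewrite (@big_only1 _ _ _ _ j) // => [|l /negbTE lj _].
  by rewrite OmegaE !eqxx scale1r tensmx_delta.
by rewrite OmegaE [j == l]eq_sym lj andbF scale0r.
Qed.

Lemma blk_Omega n (x y : 'I_n) : blk (Omega n) x y = delta_mx x y.
Proof. by apply/matrixP => p q; rewrite mxE OmegaE mxE. Qed.

Lemma ptr_Omega n : ptr (Omega n) = 1%:M.
Proof. by rewrite /ptr -sum_delta1; apply: eq_bigr => x _; rewrite blk_Omega. Qed.

Lemma mxtrace_tens_Omega n (A B : 'M[C]_n) : \tr ((A *t B) *m Omega n) = \tr (A *m B^T).
Proof.
rewrite Omega_sum exchange_big mulmx_sumr raddf_sum; apply: eq_bigr => i _ /=.
rewrite mulmx_sumr raddf_sum mxE; apply: eq_bigr => j _ /=.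
rewrite tensmx_mul mxtrace_tens ![\tr (_ *m delta_mx _ _)]mxtrace_mulC.
by rewrite !mxtrace_delta_mul mxE.
Qed.

Lemma CP_krausP n m (f : lmap R n m) : linear f -> CP f ->
  exists K : 'I_(m * n) -> 'M[C]_(m, n), f = kraus K.
Proof.
move=> lf /(_ _ _ (@psd_Omega n))/psd_gramP[B BE].
exists (fun s => \matrix_(i, x) B (ix (i, x)) s).
apply/funext; apply: eq_linear_delta => [//||x y]; first exact: kraus_linear.
rewrite -[in LHS]blk_Omega -tmap_idE // BE.
apply/matrixP => i j; rewrite !mxE summxE; apply: eq_bigr => s _.
by rewrite mulmx_delta_mulE !adjmxE !mxE.
Qed.

Lemma CP_adj n m (f : lmap R n m) X : linear f -> CP f -> f (X^t*) = (f X)^t*.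
Proof.
move=> lf /(CP_krausP lf)[K ->]; rewrite /kraus raddf_sum; apply: eq_bigr => s _ /=.
by rewrite !adjmxM adjmxK mulmxA.
Qed.

Lemma channel_krausP n m (f : lmap R n m) : channel f ->
  exists2 K : 'I_(m * n) -> 'M[C]_(m, n), f = kraus K & dual_kraus K 1%:M = 1%:M.
Proof. by case=> lf [/(CP_krausP lf)[K ->] tK]; exists K => //; exact/TP_krausP. Qed.

Lemma psd_channel n m (f : lmap R n m) X : channel f -> psd X -> psd (f X).
Proof. by move=> /channel_krausP[K -> _]; exact: psd_kraus. Qed.

Lemma channel_comp n m p (f : lmap R m p) (g : lmap R n m) :
  channel f -> channel g -> channel (f \o g).
Proof.
case=> lf [cf tf] [lg [cg tg]]; split; first by move=> a u v /=; rewrite lg lf.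
split=> [k X hX|X] /=; last by rewrite tf tg.
by rewrite tmap_id_comp //; exact/cf/cg.
Qed.

Lemma channel_conjm n m (K : 'M[C]_(m, n)) : K^t* *m K = 1%:M -> channel (conjm K).
Proof.
move=> K1; rewrite conjm_kraus; apply: channel_kraus.
by rewrite /dual_kraus /kraus big_ord1 adjmxK mulmx1.
Qed.

Lemma channel_convex n m (f g : lmap R n m) (t : R) : 0 <= t <= 1 ->
  channel f -> channel g -> channel (fun X => t%:C *: f X + (1 - t)%:C *: g X).
Proof.
move=> /andP[t0 t1] [lf [cf tf]] [lg [cg tg]]; split=> [a u v|].
  by rewrite lf lg !scalerDr !scalerA ![_%:C * a]mulrC addrACA.
split=> [k X hX|X].
  rewrite tmap_combl; apply: psdD; apply: psdZ; rewrite ?subr_ge0 //.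
    exact: cf.
  exact: cg.
by rewrite mxtraceD !mxtraceZ tf tg -mulrDl -rmorphD /= addrC subrK mul1r.
Qed.

Lemma channel_direct_sum n n1 n2 m (J1 : 'M[C]_(n, n1)) (J2 : 'M[C]_(n, n2))
    (f1 : lmap R n1 m) (f2 : lmap R n2 m) :
  J1 *m J1^t* + J2 *m J2^t* = 1%:M -> channel f1 -> channel f2 ->
  channel ((f1 \o conjm (J1^t*)) \+ (f2 \o conjm (J2^t*))).
Proof.
move=> J12 [l1 [c1 t1]] [l2 [c2 t2]]; split=> [a u v|] /=.
  by rewrite !conjm_linear l1 l2 scalerDr addrACA.
split=> [k X hX|X] /=.
  have psd_corner p (f : lmap R p m) J : linear f -> CP f ->
      psd (tmap (f \o conjm J) (@idmap R k) X).
    by move=> lf cf; rewrite (tmap_id_comp _ lf (conjm_linear J)); exact/cf/CP_conjm.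
  rewrite tmapDl; exact: psdD (psd_corner _ _ _ l1 c1) (psd_corner _ _ _ l2 c2).
have tr_corner p (J : 'M[C]_(n, p)) : \tr (conjm (J^t*) X) = \tr (J *m J^t* *m X).
  by rewrite /conjm adjmxK mxtrace_mulC mulmxA.
by rewrite mxtraceD t1 t2 !tr_corner -mxtraceD -mulmxDl J12 mul1mx.
Qed.

Lemma channel_reindex p q (f : 'I_p -> 'I_q) : bijective f ->
  channel (Defs.reindex f : lmap R q p).
Proof.
move=> bij_f; split; first exact: reindex_linear.
split=> [k X hX|X]; last exact: mxtrace_reindex.
have -> : tmap (Defs.reindex f : lmap R q p) (@idmap R k) X =
    Defs.reindex (fun a => ix (f (mxtens_unindex a).1, (mxtens_unindex a).2)) X.
  apply: mxtensP => i x j y; rewrite mxE !mxtens_indexK.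
  have /matrixP/(_ i j) := tmap_idE X x y (@reindex_linear R _ _ f).
  by rewrite !mxE.
exact: psd_reindex.
Qed.

Lemma tmap_idl n m k (f : lmap R n m) : linear f ->
  tmap (@idmap R k) f = @swapmx R m k \o tmap f (@idmap R k) \o @swapmx R k n.
Proof. by move=> lf; apply/funext => X /=; rewrite tmap_swapmx // swapmxK. Qed.

Lemma psd_tmap_idl n m k (g : lmap R n m) (X : 'M[C]_(k * n)) :
  linear g -> CP g -> psd X -> psd (tmap (@idmap R k) g X).
Proof.
move=> lg cg hX; rewrite tmap_idl //=.
exact/psd_reindex/cg/psd_reindex.
Qed.

Lemma channel_castmx n m (e e' : n = m) : channel (castmx (e, e') : lmap R n m).
Proof.
have -> : (castmx (e, e') : lmap R n m) = Defs.reindex (cast_ord (esym e)).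
  by apply/funext => X; rewrite castmx_reindex.
by apply: channel_reindex; exists (cast_ord e) => i; rewrite ?cast_ordK ?cast_ordKV.
Qed.

Lemma channel_swapmx n m : channel (@swapmx R n m).
Proof. by apply: channel_reindex; exact: swap_idx_bij. Qed.

Lemma channel_tensid n m k (f : lmap R n m) :
  channel f -> channel (tmap f (@idmap R k)).
Proof.
move=> /channel_krausP[K -> K1].
have -> : tmap (kraus K) (@idmap R k) = kraus (fun s => K s *t 1%:M).
  by apply/funext; exact: tmap_kraus.
apply: channel_kraus; rewrite -tmap_dual_kraus -[in LHS]tensmx11.
by rewrite tmap_tens ?K1 ?tensmx11 //; exact: kraus_linear.
Qed.

Lemma channel_idtens n m k (f : lmap R n m) :
  channel f -> channel (tmap (@idmap R k) f).
Proof.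
move=> cf; rewrite tmap_idl; last exact: cf.1.
apply: channel_comp; last exact: channel_swapmx.
by apply: channel_comp; [exact: channel_swapmx|exact: channel_tensid].
Qed.

End Channels.

(** * The diamond norm of a difference of channels *)

Section DiamondNorm.
Variable R : realType.
Local Notation C := R[i].

Definition hp_traceless n m (D : lmap R n m) : Prop :=
  [/\ linear D, forall X, \tr (D X) = 0 & forall X, D (X^t*) = (D X)^t*].

Lemma hp_traceless_sub n m (f g : lmap R n m) :
  channel f -> channel g -> hp_traceless (f \- g).
Proof.
move=> [lf [cf tf]] [lg [cg tg]]; split=> [a u v|X|X] /=.
- by rewrite lf lg scalerBr opprD addrACA.
- by rewrite raddfB /= tf tg subrr.
- by rewrite adjmxB (CP_adj _ lf cf) (CP_adj _ lg cg).
Qed.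

Lemma hp_traceless_tensid n m k (D : lmap R n m) :
  hp_traceless D -> hp_traceless (tmap D (@idmap R k)).
Proof.
move=> [lD trD hD]; split=> [|X|X]; first exact: tmap_linear.
  move: X; apply: eq_scalar_tensmx => [a u v|a u v|A B] /=.
  - by rewrite tmap_linear mxtraceD mxtraceZ.
  - by rewrite mulr0 addr0.
  by rewrite tmap_tens // mxtrace_tens trD mul0r.
apply: (can_inj (@adjmxK _ _ _)); rewrite adjmxK; move: X.
apply: eq_linear_tensmx => [a u v|a u v|A B].
- by rewrite adjmxD adjmxZ tmap_linear adjmxD adjmxZ conjCK.
- by rewrite tmap_linear.
by rewrite adjmx_tens !tmap_tens // adjmx_tens hD adjmxK /idmap adjmxK.
Qed.

Lemma hp_traceless_retr n m (D : lmap R n m) X : hp_traceless D -> retr (D X) = 0.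
Proof. by case=> _ trD _; rewrite /retr trD. Qed.

Definition effect n (P : 'M[C]_n) : Prop := psd P /\ psd (1%:M - P).

Lemma effectC n (P : 'M[C]_n) : effect P -> effect (1%:M - P).
Proof. by move=> [hP hQ]; split; [exact: hQ|rewrite opprB addrC subrK]. Qed.

Lemma density_effect n (P : 'M[C]_n) : density P -> effect P.
Proof. by move=> [hP P1]; split=> //; rewrite -P1; exact: psd_le_trace. Qed.

Lemma effect_tens1 n k (P : 'M[C]_k) :
  effect P -> effect ((1%:M : 'M[C]_n) *t P).
Proof.
move=> [hP hQ]; split; first exact: psd_tens (@psd1 R n) hP.
by rewrite -tensmx11 -tensmxBr; exact: psd_tens (@psd1 R n) hQ.
Qed.

Lemma effect_trmx n (P : 'M[C]_n) : effect P -> effect P^T.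
Proof.
move=> [hP hQ]; split; first exact: psd_trmx.
by rewrite -trmx1 -linearB; exact: psd_trmx.
Qed.

Lemma effect_reindex p q (f : 'I_p -> 'I_q) (P : 'M[C]_q) :
  injective f -> effect P -> effect (Defs.reindex f P).
Proof.
move=> inj_f [hP hQ]; split; first exact: psd_reindex.
by rewrite -(reindex1 R inj_f) -(linB (@reindex_linear R _ _ f)); exact: psd_reindex.
Qed.

Lemma effect_dual_kraus n m (S : finType) (K : S -> 'M[C]_(m, n)) P :
  dual_kraus K 1%:M = 1%:M -> effect P -> effect (dual_kraus K P).
Proof.
move=> K1 [hP hQ]; split; first exact: psd_kraus.
by rewrite -K1 -(linB (kraus_linear _)); exact: psd_kraus.
Qed.

Lemma effect_conj_unitary n (U P : 'M[C]_n) :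
  unitary U -> effect P -> effect (U *m P *m U^t*).
Proof.
move=> uU [hP hQ]; split; first exact: psd_conj.
have -> : 1%:M - U *m P *m U^t* = U *m (1%:M - P) *m U^t*.
  by rewrite mulmxBr mulmxBl mulmx1 uU.
exact: psd_conj.
Qed.

(* Helstrom: for Hermiticity-preserving traceless [D], the least such [c] is half the
   largest trace norm of the image of a state. *)
Definition test_bounded n m (D : lmap R n m) (c : R) : Prop :=
  forall w P, psd w -> effect P -> retr (D w *m P) <= c * retr w.

Definition cb_test_bounded n m (D : lmap R n m) (c : R) : Prop :=
  forall k, test_bounded (tmap D (@idmap R k)) c.

Lemma test_bounded_pre n0 n m (a : lmap R n0 n) (D : lmap R n m) c :
  channel a -> test_bounded D c -> test_bounded (D \o a) c.
Proof.
move=> ca tD w P hw eP; have [_ [_ tpa]] := ca.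
by rewrite {2}/retr -tpa; apply: tD => //; exact: psd_channel.
Qed.

Lemma test_bounded_post n m m' (b : lmap R m m') (D : lmap R n m) c :
  channel b -> test_bounded D c -> test_bounded (b \o D) c.
Proof.
move=> /channel_krausP[K -> K1] tD w P hw eP.
by rewrite {1}/retr /= mxtrace_kraus; apply: tD => //; exact: effect_dual_kraus.
Qed.

Lemma cb_test_bounded_pre n0 n m (a : lmap R n0 n) (D : lmap R n m) c :
  linear D -> channel a -> cb_test_bounded D c -> cb_test_bounded (D \o a) c.
Proof.
move=> lD ca tD k w P hw eP; rewrite tmap_id_comp //; last exact: ca.1.
exact: (test_bounded_pre (channel_tensid k ca) (tD k)).
Qed.

Lemma cb_test_bounded_post n m m' (b : lmap R m m') (D : lmap R n m) c :
  linear D -> channel b -> cb_test_bounded D c -> cb_test_bounded (b \o D) c.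
Proof.
move=> lD cb tD k w P hw eP; rewrite tmap_id_comp //; last exact: cb.1.
exact: (test_bounded_post (channel_tensid k cb) (tD k)).
Qed.

Lemma cb_test_bounded_tensid n m j (D : lmap R n m) c :
  linear D -> cb_test_bounded D c -> cb_test_bounded (tmap D (@idmap R j)) c.
Proof.
move=> lD tD k; rewrite tmap_tmapA //; apply: test_bounded_pre; first exact: channel_castmx.
by apply: test_bounded_post; first exact: channel_castmx.
Qed.

Lemma cb_test_bounded_idtens n m j (D : lmap R n m) c :
  linear D -> cb_test_bounded D c -> cb_test_bounded (tmap (@idmap R j) D) c.
Proof.
move=> lD tD; rewrite tmap_idl //.
apply: cb_test_bounded_pre; last first.
- apply: cb_test_bounded_post; last exact: cb_test_bounded_tensid.
    exact: tmap_linear.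
  exact: channel_swapmx.
- exact: channel_swapmx.
by move=> a u v /=; rewrite tmap_linear swapmx_linear.
Qed.

Lemma cb_test_bounded_subC n m (f g : lmap R n m) c : channel f -> channel g ->
  cb_test_bounded (f \- g) c -> cb_test_bounded (g \- f) c.
Proof.
move=> cf cg tD k w P hw eP; have := tD k w _ hw (effectC eP).
have tr0 := hp_traceless_retr w (hp_traceless_tensid k (hp_traceless_sub cf cg)).
rewrite mulmxBr [_ *m 1%:M]mulmx1 retrB tr0 sub0r !tmapBl.
by rewrite -retrN -mulNmx opprB.
Qed.

(** ** Trace norm and effects *)

Lemma retr_unitary_le n (V w : 'M[C]_n) : unitary V -> psd w ->
  retr (V *m w) <= retr w.
Proof.
move=> uV hw; have := psd_retr_ge0 (psd_conj (1%:M - V) hw).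
rewrite adjmxB adjmx1 !mulmxBl !mulmxBr mul1mx !mulmx1 !retrB.
rewrite [retr (V *m w *m V^t*)]retr_mulC mulmxA unitaryC // mul1mx.
have -> : retr (w *m V^t*) = retr (V *m w) by rewrite -retr_adj adjmxM adjmxK (psd_herm hw).
lra.
Qed.

Lemma tnorm_psd_le n (w : 'M[C]_n) : psd w -> (tnorm w <= (retr w)%:E)%E.
Proof.
move=> hw; apply: ge_ereal_sup => _ [U [uU ->]]; rewrite lee_fin.
have [z z1 zE] := phase_exists (\tr (U *m w)).
by rewrite -zE -mxtraceZ scalemxAl; apply: retr_unitary_le => //; exact: unitaryZ.
Qed.

Lemma retr_le_tnorm n (U Z : 'M[C]_n) : unitary U ->
  ((retr (U *m Z))%:E <= tnorm Z)%E.
Proof.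
move=> uU; apply: (@le_trans _ _ (Re `|\tr (U *m Z)|)%:E).
  by rewrite lee_fin Re_le_norm.
by apply: ereal_sup_ubound; exists U.
Qed.

(* An eigenvalue [p] of [P] becomes the eigenvalue [e^(i t)] of [U] with
   [cos t = 2 p - 1]. *)
Lemma effect_unitary n (P : 'M[C]_n) : effect P ->
  exists2 U, unitary U & P = 4^-1%:C *: (U + U^t*) + 2^-1%:C *: 1%:M.
Proof.
move=> [/psd_fcalcP[V [p [uV p_ge0 PE]]] hQ].
have p_le1 i : p i <= 1.
  have := psd_diag_ge0 i (psd_conj V hQ).
  rewrite PE mulmxBr mulmxBl mulmx1 uV !mulmxA uV mul1mx -mulmxA uV mulmx1.
  by rewrite !mxE eqxx mulr1n -rmorphB /= lecR subr_ge0.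
pose u i : C := Complex (2 * p i - 1) (2 * Num.sqrt (p i * (1 - p i))).
have u_phase i : u i * Num.conj (u i) = 1.
  have := @sqr_sqrtr _ (p i * (1 - p i)); rewrite mulr_ge0 ?subr_ge0 // => /(_ isT).
  rewrite /u; move: (Num.sqrt _) => s sE; apply/eqP; rewrite eq_complex /=.
  apply/andP; split; apply/eqP; last ring.
  by transitivity ((2 * p i - 1) ^+ 2 + 4 * s ^+ 2); [ring|rewrite sE; ring].
exists (fcalc V u).
  rewrite /unitary adjmx_fcalc (fcalcM _ _ uV) -(fcalc_const _ uV).
  exact: eq_fcalc.
rewrite PE adjmx_fcalc -(fcalc_const _ uV) -fcalcD -!fcalcZ -fcalcD.
apply: eq_fcalc => i; rewrite [u i + _]addcJ.
by rewrite mulr1 -(rmorph_nat (real_complex R)) -!rmorphM /= -rmorphD /=; congr _%:C; field.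
Qed.

Lemma le_small_error (x y M : R) :
  (forall d, 0 < d -> exists2 e, 0 < e <= d & x <= y + e * M) -> x <= y.
Proof.
move=> h; apply/ler_addgt0Pr => d d0.
have M_gt0 : 0 < `|M| + 1 by rewrite ltr_wpDl.
have [e /andP[e0 ed] xy] := h _ (divr_gt0 d0 M_gt0).
apply: le_trans xy _; rewrite lerD2l; apply: le_trans (ler_wpM2l (ltW e0) (ler_norm M)) _.
apply: le_trans (ler_wpM2r (normr_ge0 M) ed) _.
by rewrite mulrAC ler_pdivrMr // ler_wpM2l ?(ltW d0) // lerDl.
Qed.

Lemma tnorm_test_bounded n m (D : lmap R n m) c : hp_traceless D ->
  (forall X, (tnorm X <= 1)%E -> (tnorm (D X) <= (2 * c)%:E)%E) -> test_bounded D c.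
Proof.
move=> tlD hD w P hw /effect_unitary[U uU ->].
have [lD _ _] := tlD; rewrite -(scale_normalize hw) (linZ lD) -scalemxAl retrZ.
rewrite scale_normalize // [c * _]mulrC; apply: ler_wpM2l; first exact: psd_retr_ge0.
have /hD hZ : (tnorm (normalize w) <= 1)%E.
  apply: le_trans (tnorm_psd_le (psd_normalize hw)) _; rewrite lee_fin.
  exact: retr_normalize_le1.
have U_le V : unitary V -> retr (D (normalize w) *m V) <= 2 * c.
  by move=> uV; rewrite retr_mulC -lee_fin; apply: le_trans hZ; exact: retr_le_tnorm.
have := U_le _ uU; have := U_le _ (unitary_adj uU).
rewrite mulmxDr -!scalemxAr mulmx1 retrD !retrZ mulmxDr retrD.
by rewrite (hp_traceless_retr _ tlD) mulr0 addr0; lra.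
Qed.

(** ** Dilation to effects *)

Definition controlled n k (V : 'I_k -> 'M[C]_n) : 'M[C]_(n * k) :=
  \sum_a (V a *t delta_mx a a).

Lemma controlled_conj n k (V : 'I_k -> 'M[C]_n) A B :
  controlled V *m (A *t B) *m (controlled V)^t* =
  \sum_a \sum_b B a b *: ((V a *m A *m (V b)^t*) *t delta_mx a b).
Proof.
rewrite /controlled !mulmx_suml; apply: eq_bigr => a _.
rewrite raddf_sum mulmx_sumr; apply: eq_bigr => b _ /=.
by rewrite adjmx_tens adjmx_delta !tensmx_mul delta_mulmx_delta tensmxZr.
Qed.

Lemma controlled_unitary n k (V : 'I_k -> 'M[C]_n) :
  (forall a, unitary (V a)) -> unitary (controlled V).
Proof.
move=> uV; have := controlled_conj V 1%:M 1%:M.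
rewrite tensmx11 mulmx1 /unitary => ->.
transitivity (\sum_a ((1%:M : 'M[C]_n) *t delta_mx a a : 'M[C]_(n * k))).
  apply: eq_bigr => a _; rewrite (@big_only1 _ _ _ _ a) // => [|b /negbTE ba _].
    by rewrite mxE eqxx scale1r mulmx1 uV.
  by rewrite mxE eq_sym ba scale0r.
by rewrite -tensmx_sumr sum_delta1 tensmx11.
Qed.

Definition plus_state : 'M[C]_2 := 2^-1%:C *: const_mx 1.

Lemma density_plus_state : density plus_state.
Proof.
split.
  apply: psdZ; first by rewrite invr_ge0.
  have -> : const_mx 1 = const_mx 1 *m (const_mx 1 : 'cV[C]_2)^t* :> 'M[C]_2.
    by apply/matrixP => i j; rewrite [RHS]mxE big_ord1 adjmxE !mxE rmorph1 mulr1.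
  exact: psd_gram.
rewrite mxtraceZ /mxtrace !big_ord_recl big_ord0 !mxE addr0.
by rewrite -(rmorph1 (real_complex R)) -rmorphD -rmorphM /=; congr _%:C; field.
Qed.

Lemma plus_stateE i j : plus_state i j = 2^-1%:C.
Proof. by rewrite !mxE mulr1. Qed.

Lemma mxtrace_controlled n m k (D : lmap R n m) (V : 'I_k -> 'M[C]_n)
    (W : 'I_k -> 'M[C]_m) A B S T : linear D ->
  \tr (tmap D (@idmap R k) (controlled V *m (A *t S) *m (controlled V)^t*)
       *m (controlled W *m (B *t T) *m (controlled W)^t*)) =
  \sum_a \sum_b S a b * T b a *
    \tr (D (V a *m A *m (V b)^t*) *m (W b *m B *m (W a)^t*)).
Proof.
move=> lD; have lT := tmap_linear D (@idmap R k).
rewrite !controlled_conj (lin_sum lT) mulmx_suml raddf_sum.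
apply: eq_bigr => a _; rewrite (lin_sum lT) mulmx_suml raddf_sum.
apply: eq_bigr => b _ /=; rewrite (linZ lT) tmap_tens // mulmx_sumr raddf_sum.
rewrite (@big_only1 _ _ _ _ b) // => [|d /negbTE db _] /=; last first.
  rewrite mulmx_sumr raddf_sum big1 // => e _ /=.
  by rewrite -scalemxAl -scalemxAr !mxtraceZ tensmx_mul mul_delta_mx_cond eq_sym db
    mulr0n tensmx0 mxtrace0 !mulr0.
rewrite mulmx_sumr raddf_sum (@big_only1 _ _ _ _ a) // => [|d /negbTE da _] /=.
  rewrite -scalemxAl -scalemxAr !mxtraceZ tensmx_mul mul_delta_mx mxtrace_tens.
  by rewrite (density_delta _ a).2 mulr1 mulrA.
rewrite -scalemxAl -scalemxAr !mxtraceZ tensmx_mul mul_delta_mx mxtrace_tens.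
by rewrite -[delta_mx a d]mulmx1 mxtrace_delta_mul mxE da !mulr0.
Qed.

End DiamondNorm.

Section PolarDecomposition.
Variable R : realType.
Local Notation C := R[i].

(* The off-diagonal blocks of the controlled conjugations of [Q] and [1] by
   [(V, 1)] and [(W^t*, 1)] are [V *m Q] and [W]. *)
Lemma test_bounded_polar n m (D : lmap R n m) c (V Q : 'M[C]_n) (W : 'M[C]_m) :
  hp_traceless D -> test_bounded (tmap D (@idmap R 2)) c ->
  unitary V -> psd Q -> unitary W -> retr (D (V *m Q) *m W) <= 2 * c * retr Q.
Proof.
move=> tlD tD uV hQ uW; have [lD _ hD] := tlD.
pose V2 (a : 'I_2) := if a == 0 then V else 1%:M.
pose W2 (a : 'I_2) := if a == 0 then W^t* else 1%:M.
have uV2 : unitary (controlled V2).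
  by apply: controlled_unitary => a; rewrite /V2; case: eqP; rewrite // /unitary adjmx1 mulmx1.
have uW2 : unitary (controlled W2).
  apply: controlled_unitary => a; rewrite /W2; case: eqP => _; first exact: unitary_adj.
  by rewrite /unitary adjmx1 mulmx1.
have hw := psd_conj (controlled V2) (psd_tens hQ (density_plus_state R).1).
have eP := effect_conj_unitary uW2 (effect_tens1 m (density_effect (density_plus_state R))).
have trw : retr (controlled V2 *m (Q *t plus_state R) *m (controlled V2)^t*) = retr Q.
  rewrite retr_mulC mulmxA (unitaryC uV2) mul1mx /retr mxtrace_tens.
  by rewrite (density_plus_state R).2 mulr1.
pose val a b := retr (D (V2 a *m Q *m (V2 b)^t*) *m (W2 b *m 1%:M *m (W2 a)^t*)).
have := tD _ _ hw eP; rewrite trw.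
have -> : retr (tmap D (@idmap R 2) (controlled V2 *m (Q *t plus_state R) *m (controlled V2)^t*)
      *m (controlled W2 *m (1%:M *t plus_state R) *m (controlled W2)^t*)) =
    4^-1 * \sum_a \sum_b val a b.
  rewrite /retr mxtrace_controlled // raddf_sum mulr_sumr; apply: eq_bigr => a _ /=.
  rewrite raddf_sum mulr_sumr; apply: eq_bigr => b _ /=.
  by rewrite !plus_stateE -rmorphM ReZ /=; congr (_ * _); field.
have val00 : val 0 0 = 0.
  by rewrite /val /W2 /= mulmx1 adjmxK (unitaryC uW) mulmx1 hp_traceless_retr.
have val11 : val 1 1 = 0.
  by rewrite /val /W2 /= adjmx1 !mulmx1 hp_traceless_retr.
have val01 : val 0 1 = retr (D (V *m Q) *m W).
  by rewrite /val /V2 /W2 /= adjmx1 adjmxK mulmx1 !mul1mx.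
have val10 : val 1 0 = retr (D (V *m Q) *m W).
  rewrite /val /V2 /W2 /= adjmx1 !mulmx1 mul1mx -[LHS]retr_adj adjmxM -hD adjmxM.
  by rewrite !adjmxK (psd_herm hQ) retr_mulC.
have sum22 (F : 'I_2 -> 'I_2 -> R) :
    \sum_a \sum_b F a b = F 0 0 + F 0 1 + (F 1 0 + F 1 1).
  have one : lift ord0 ord0 = 1 :> 'I_2 by exact: val_inj.
  by rewrite !big_ord_recl !big_ord0 !addr0 one.
by clearbody val; rewrite sum22 val00 val01 val10 val11; lra.
Qed.

Lemma polar_decomposition n (X : 'M[C]_n) : X \in unitmx ->
  exists V Q : 'M[C]_n, [/\ unitary V, psd Q & X = V *m Q].
Proof.
move=> uX; have [Q hQ XQ] := psd_sqrt (psd_conjV X (@psd1 R n)).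
rewrite mulmx1 in XQ.
have uQ : Q \in unitmx.
  have : X^t* *m X \in unitmx by rewrite unitmx_mul uX andbT /adjmx unitmx_tr map_unitmx.
  by rewrite XQ unitmx_mul andbb.
exists (X *m invmx Q), Q; split=> //; last by rewrite mulmxKV.
apply: mulmx1C; rewrite adjmxM -mulmxA [X^t* *m _]mulmxA XQ mulmxK //.
by rewrite -[X in _ *m X](psd_herm hQ) -adjmxM mulmxV // adjmx1.
Qed.

Lemma unitmx_perturbation n (X : 'M[C]_n) (d : R) : 0 < d ->
  exists2 e : R, 0 < e <= d & X + e%:C%:M \in unitmx.
Proof.
move=> d0; pose e j : R := d / j.+1%:R.
have e_bounds j : 0 < e j <= d.
  by rewrite divr_gt0 //= ler_pdivrMr // ler_peMr ?ler1n // ltW.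
have inj_e : injective e.
  move=> i j /(mulfI (lt0r_neq0 d0)) /invr_inj /eqP.
  by rewrite eqr_nat => /eqP[].
pose p := char_poly X; pose s := [seq - (e j)%:C | j <- iota 0 (size p)].
have uniq_s : uniq s.
  by rewrite map_inj_uniq ?iota_uniq // => i j /oppr_inj /complexI; exact: inj_e.
have /allPn[_ /mapP[j _ ->] not_root] : ~~ all (root p) s.
  apply/negP => /(max_poly_roots (monic_neq0 (char_poly_monic X))) /(_ uniq_s).
  by rewrite size_map size_iota ltnn.
exists (e j) => //; move: not_root; rewrite -eigenvalue_root_char /eigenvalue negbK.
by rewrite /eigenspace kermx_eq0 row_free_unit !rmorphN opprK.
Qed.

Lemma tnorm_le_test_bounded n m (D : lmap R n m) (c : R) (X : 'M[C]_n) :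
  0 <= c -> hp_traceless D -> test_bounded (tmap D (@idmap R 2)) c ->
  (tnorm X <= 1)%E -> (tnorm (D X) <= (2 * c)%:E)%E.
Proof.
move=> c0 tlD tD tX; apply: ge_ereal_sup => _ [U [uU ->]]; rewrite lee_fin.
have [lD _ _] := tlD; have [z z1 zE] := phase_exists (\tr (U *m D X)).
rewrite -zE -mxtraceZ scalemxAl mxtrace_mulC -/(retr _).
have := unitaryZ z1 uU; move: (z *: U) => W uW.
apply: (@le_small_error _ _ _ (2 * c * n%:R - retr (D 1%:M *m W))) => d d0.
have [e ed /polar_decomposition[V [Q [uV hQ XE]]]] := unitmx_perturbation X d0.
have e0 : 0 <= e by case/andP: ed => /ltW.
exists e => //; have trQ : retr Q <= 1 + e * n%:R.
  have -> : Q = V^t* *m X + e%:C *: V^t*.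
    by rewrite -[Q]mul1mx -(unitaryC uV) -mulmxA -XE mulmxDr mul_mx_scalar.
  rewrite retrD retrZ; apply: lerD.
    by rewrite -lee_fin; apply: le_trans tX; apply: retr_le_tnorm; exact: unitary_adj.
  rewrite ler_wpM2l // -[V^t*]mulmx1 -retr1; apply: retr_unitary_le (@psd1 R n).
  exact: unitary_adj.
have := test_bounded_polar tlD tD uV hQ uW; rewrite -XE.
rewrite -[e%:C%:M]scalemx1 (linD lD) (linZ lD) mulmxDl -scalemxAl retrD retrZ.
have : 2 * c * retr Q <= 2 * c * (1 + e * n%:R) by rewrite ler_wpM2l // mulr_ge0.
rewrite mulrBr mulrDr mulr1; lra.
Qed.

Lemma dnorm_leP n m (D : lmap R n m) (c : R) : 0 <= c -> hp_traceless D ->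
  (dnorm D <= (2 * c)%:E)%E <-> cb_test_bounded D c.
Proof.
move=> c0 tlD; split=> [D_le k|tD].
  apply: tnorm_test_bounded (hp_traceless_tensid k tlD) _ => X tX.
  by apply: le_trans D_le; apply: ereal_sup_ubound; exists k, X.
apply: ge_ereal_sup => _ [k [X [tX ->]]].
apply: tnorm_le_test_bounded tX => //; first exact: hp_traceless_tensid.
by apply: cb_test_bounded_tensid => //; case: tlD.
Qed.

End PolarDecomposition.

(** * An approximate minimax theorem *)

Section Minimax.
Variable R : realType.
Local Notation C := R[i].

Definition convexp (V : lmodType C) (X : V -> Prop) := forall (t : R) x y,
  0 <= t <= 1 -> X x -> X y -> X (t%:C *: x + (1 - t)%:C *: y).

Lemma convex_subr (V : lmodType C) (t : R) (x y z : V) :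
  x - (t%:C *: y + (1 - t)%:C *: z) = t%:C *: (x - y) + (1 - t)%:C *: (x - z).
Proof.
by rewrite !scalerBr addrACA -scalerDl -rmorphD /= [t + _]addrC subrK scale1r opprD.
Qed.

Section Pairing.
Variables (V W : lmodType C) (B : V -> W -> R) (q : V -> R) (q' : W -> R).
Hypothesis pair_convl : forall (t : R) x x' y,
  B (t%:C *: x + (1 - t)%:C *: x') y = t * B x y + (1 - t) * B x' y.
Hypothesis pair_convr : forall (t : R) x y y',
  B x (t%:C *: y + (1 - t)%:C *: y') = t * B x y + (1 - t) * B x y'.
Hypothesis pair_subl : forall x x' y, B (x - x') y = B x y - B x' y.
Hypothesis q_ge0 : forall x, 0 <= q x.
Hypothesis q_conv : forall (t : R) x x',
  q (t%:C *: x + (1 - t)%:C *: x') = t * q x + (1 - t) * q x' - t * (1 - t) * q (x - x').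
Hypothesis pair_amgm : forall (r : R) x y, 2 * r * B x y <= q x + r ^+ 2 * q' y.

Variables (X : V -> Prop) (Y : W -> Prop) (b : R).
Hypotheses (X_convex : convexp X) (Y_convex : convexp Y).
Hypotheses (X_bounded : forall x, X x -> q x <= b) (Y_bounded : forall y, Y y -> q' y <= b).
Variables (x1 : V) (y1 : W).
Hypotheses (Xx1 : X x1) (Yy1 : Y y1).

Lemma pair_le_bound x y : X x -> Y y -> B x y <= b.
Proof.
by move=> /X_bounded qx /Y_bounded qy; have := pair_amgm 1 x y; lra.
Qed.

Lemma pair_ge_bound x y : X x -> Y y -> - b <= B x y.
Proof.
by move=> /X_bounded qx /Y_bounded qy; have := pair_amgm (-1) x y; lra.
Qed.

Section Regularized.
Variable d : R.
Hypothesis d_gt0 : 0 < d.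

(* Strong concavity in [x] makes almost maximisers for nearby [y] close to each
   other: it replaces compactness of [X]. *)
Definition regpair x y := B x y - d / 2 * q x.

Definition regvalue : R :=
  inf (fun r => exists2 y, Y y & forall x, X x -> regpair x y <= r).

Lemma regpair_le x y : regpair x y <= B x y.
Proof. by rewrite gerBl mulr_ge0 // divr_ge0 // ltW. Qed.

Lemma regpair_gap x x' y m : X x -> X x' -> (forall x, X x -> regpair x y <= m) ->
  d / 4 * q (x - x') <= (m - regpair x y) + (m - regpair x' y).
Proof.
move=> Xx Xx' max_m; have half : 0 <= (2^-1 : R) <= 1 by apply/andP; split; lra.
have := max_m _ (X_convex half Xx Xx'); rewrite /regpair pair_convl q_conv.
have -> : 1 - 2^-1 = 2^-1 :> R by lra.
lra.
Qed.

Let regvalue_inf :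
  has_inf (fun r => exists2 y, Y y & forall x, X x -> regpair x y <= r).
Proof.
split.
  by exists b, y1 => // x Xx; exact: le_trans (regpair_le _ _) (pair_le_bound Xx Yy1).
exists (regpair x1 y1 - 2 * b) => r [y Yy /(_ _ Xx1)]; apply: le_trans.
have := pair_le_bound Xx1 Yy1; have := pair_ge_bound Xx1 Yy; rewrite /regpair; lra.
Qed.

Lemma almost_minimizer e : 0 < e ->
  exists2 y, Y y & forall x, X x -> regpair x y <= regvalue + e.
Proof.
move=> e0; have [r [y Yy max_r] rv] := inf_adherent e0 regvalue_inf.
by exists y => // x Xx; exact: le_trans (max_r _ Xx) (ltW rv).
Qed.

Lemma almost_maximizer e y : 0 < e -> Y y ->
  exists2 x, X x & regvalue - e < regpair x y.
Proof.
move=> e0 Yy; apply: contrapT => no_x.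
have : regvalue <= regvalue - e.
  apply: ge_inf; first by case: regvalue_inf.
  exists y => // x Xx; rewrite leNgt; apply/negP => h; apply: no_x; by exists x.
lra.
Qed.

Lemma regvalue_le c : (forall x, X x -> exists2 y, Y y & B x y <= c) -> regvalue <= c.
Proof.
move=> response; apply: (@le_small_error _ _ _ (b / 2)) => r r0.
exists r; first by rewrite r0 lexx.
apply: (@le_small_error _ _ _ (2 + 4 * (2 + b) / (d * r))) => t0 t0_gt0.
pose t := Num.min 1 t0.
have t_gt0 : 0 < t by rewrite lt_min ltr01.
have t_le1 : t <= 1 by rewrite ge_min lexx.
exists t; first by rewrite t_gt0 ge_min lexx orbT.
have t2_gt0 : 0 < t ^+ 2 by rewrite exprn_gt0.
have [y0 Yy0 max_y0] := almost_minimizer t2_gt0.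
have [x0 Xx0 x0_max] := almost_maximizer t2_gt0 Yy0.
have [y Yy By] := response _ Xx0.
have t01 : 0 <= t <= 1 by rewrite ltW.
have [x Xx x_max] := almost_maximizer t2_gt0 (Y_convex t01 Yy Yy0).
have reg_mix : regpair x (t%:C *: y + (1 - t)%:C *: y0) =
    t * regpair x y + (1 - t) * regpair x y0 by rewrite /regpair pair_convr; ring.
rewrite reg_mix in x_max; have x_le := max_y0 _ Xx.
have value_le : regvalue <= regpair x y + 2 * t.
  by rewrite -(ler_pM2l t_gt0); nra.
have gap : q (x - x0) <= t * (8 * (2 + b) / d).
  have diff_le : t * (regpair x y - regpair x y0) <= t * (2 * b).
    rewrite ler_pM2l // /regpair.
    by have := pair_le_bound Xx Yy; have := pair_ge_bound Xx Yy0; lra.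
  have t2_le : t ^+ 2 <= t by rewrite expr2 ler_piMl // ltW.
  have := regpair_gap Xx Xx0 max_y0; rewrite mulrA ler_pdivlMr //; lra.
have amgm : 2 * r * (B x y - B x0 y) <= t * (8 * (2 + b) / d) + r ^+ 2 * b.
  rewrite -pair_subl; apply: le_trans (pair_amgm r _ _) _; apply: lerD => //.
  by rewrite ler_wpM2l ?Y_bounded // sqr_ge0.
have -> : c + r * (b / 2) + t * (2 + 4 * (2 + b) / (d * r)) =
    c + 2 * t + (t * (8 * (2 + b) / d) + r ^+ 2 * b) / (2 * r).
  by field; rewrite !gt_eqF.
have : B x y - B x0 y <= (t * (8 * (2 + b) / d) + r ^+ 2 * b) / (2 * r).
  by rewrite ler_pdivlMr ?mulr_gt0 // mulrC.
by have := regpair_le x y; lra.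
Qed.

End Regularized.

Lemma minimax_pairing c e : 0 < e ->
  (forall x, X x -> exists2 y, Y y & B x y <= c) ->
  exists2 y, Y y & forall x, X x -> B x y <= c + e.
Proof.
move=> e0 response; have b0 : 0 <= b by apply: le_trans (q_ge0 x1) (X_bounded Xx1).
have d0 : 0 < e / (b + 1) by rewrite divr_gt0 // ltr_wpDl.
have e2 : 0 < e / 2 by rewrite divr_gt0.
have [y Yy max_y] := almost_minimizer d0 e2; exists y => // x Xx.
have -> : B x y = regpair (e / (b + 1)) x y + e / (b + 1) / 2 * q x by rewrite /regpair subrK.
have -> : c + e = c + e / 2 + e / 2 by rewrite -addrA -splitr.
apply: lerD; first by apply: le_trans (max_y _ Xx) _; rewrite lerD2r regvalue_le.
rewrite mulrAC ler_pM2r ?invr_gt0 // mulrAC ler_pdivrMr ?ltr_wpDl // ler_pM2l //.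
by have := X_bounded Xx; lra.
Qed.

End Pairing.

Section Matrices.
Variable n : nat.
Implicit Types x y : 'M[C]_n.

Definition hsnorm2 x : R := retr (x *m x^t*).

Lemma hsnorm2_ge0 x : 0 <= hsnorm2 x.
Proof. exact/psd_retr_ge0/psd_gram. Qed.

Lemma hsnorm2_comb (s t : R) x y :
  hsnorm2 (s%:C *: x + t%:C *: y) =
  s ^+ 2 * hsnorm2 x + t ^+ 2 * hsnorm2 y + 2 * s * t * retr (x *m y^t*).
Proof.
rewrite /hsnorm2 adjmxD !adjmxZ !conjC_real mulmxDl !mulmxDr -!scalemxAl -!scalemxAr.
have sym : retr (y *m x^t*) = retr (x *m y^t*) by rewrite -retr_adj adjmxM adjmxK.
move: (x *m x^t*) (x *m y^t*) (y *m x^t*) (y *m y^t*) sym => xx xy yx yy sym.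
rewrite [LHS]retrD [X in X + _ = _]retrD [X in _ + X = _]retrD.
by rewrite 8!retrZ sym; ring.
Qed.

Lemma subr_comb x y : x - y = 1%:C *: x + (-1)%:C *: y.
Proof. by rewrite rmorphN rmorph1 scaleN1r scale1r. Qed.

Lemma hsnorm2_conv (t : R) x y :
  hsnorm2 (t%:C *: x + (1 - t)%:C *: y) =
  t * hsnorm2 x + (1 - t) * hsnorm2 y - t * (1 - t) * hsnorm2 (x - y).
Proof. by rewrite subr_comb [LHS]hsnorm2_comb [hsnorm2 (1%:C *: _ + _)]hsnorm2_comb; ring. Qed.

Lemma hsnorm2_sub_le x y : hsnorm2 (x - y) <= 2 * hsnorm2 x + 2 * hsnorm2 y.
Proof.
have := hsnorm2_ge0 (1%:C *: x + 1%:C *: y); rewrite hsnorm2_comb subr_comb => add_ge0.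
by rewrite [leLHS]hsnorm2_comb; lra.
Qed.

Lemma retr_mul_amgm (r : R) x y :
  2 * r * retr (x *m y) <= hsnorm2 x + r ^+ 2 * hsnorm2 y.
Proof.
have := hsnorm2_ge0 (1%:C *: x + (- r)%:C *: y^t*); rewrite hsnorm2_comb adjmxK.
have -> : hsnorm2 (y^t*) = hsnorm2 y by rewrite /hsnorm2 adjmxK retr_mulC.
lra.
Qed.

Lemma hsnorm2_psd_le x : psd x -> hsnorm2 x <= retr x ^+ 2.
Proof.
move=> hx; have := psd_trM_ge0 hx (psd_le_trace hx).
rewrite mulmxBr mul_mx_scalar retrB psd_trE // retrZ subr_ge0 -expr2.
by rewrite /hsnorm2 (psd_herm hx).
Qed.

Definition hs_bounded (X : 'M[C]_n -> Prop) : Prop :=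
  exists b, forall x, X x -> hsnorm2 x <= b.

Lemma minimax_matrix (X Y : 'M[C]_n -> Prop) (c e : R) :
  convexp X -> convexp Y -> hs_bounded X -> hs_bounded Y ->
  (exists x, X x) -> (exists y, Y y) -> 0 < e ->
  (forall x, X x -> exists2 y, Y y & retr (x *m y) <= c) ->
  exists2 y, Y y & forall x, X x -> retr (x *m y) <= c + e.
Proof.
move=> X_convex Y_convex [b hX] [b' hY] [x1 Xx1] [y1 Yy1].
apply: (@minimax_pairing _ _ (fun x y => retr (x *m y)) hsnorm2 hsnorm2 _ _ _
  hsnorm2_ge0 hsnorm2_conv retr_mul_amgm X Y (Num.max b b')
  X_convex Y_convex _ _ x1 y1 Xx1 Yy1).
- by move=> t x x' y; rewrite mulmxDl -!scalemxAl retrD !retrZ.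
- by move=> t x y y'; rewrite mulmxDr -!scalemxAr retrD !retrZ.
- by move=> x x' y; rewrite mulmxBl retrB.
- by move=> x /hX; rewrite le_max => ->.
- by move=> y /hY; rewrite le_max orbC => ->.
Qed.

End Matrices.
End Minimax.

(** * Choi operators and test operators *)

Section ChoiOperators.
Variable R : realType.
Local Notation C := R[i].
Local Notation ix := mxtens_index.

Definition rpairing n m (X : 'M[C]_(n * m)) (f : lmap R n m) : R :=
  retr (tmap f (@idmap R m) X *m Omega R m).

Lemma adjmap_linear n m (f : lmap R n m) : linear (adjmap f).
Proof.
move=> a A B; rewrite /adjmap scaler_sumr -big_split; apply: eq_bigr => i _ /=.
rewrite scaler_sumr -big_split; apply: eq_bigr => j _ /=.
by rewrite mulmxPr mxtraceD mxtraceZ scalerDl scalerA.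
Qed.

Lemma adjmapE n m (f : lmap R n m) Y p q :
  adjmap f Y p q = \tr ((f (delta_mx p q))^t* *m Y).
Proof.
rewrite [adjmap f Y](_ : _ = \matrix_(i, j) \tr ((f (delta_mx i j))^t* *m Y)) ?mxE //.
rewrite [RHS]matrix_sum_delta; apply: eq_bigr => i _; apply: eq_bigr => j _.
by rewrite mxE.
Qed.

Lemma blk_choi n m (f : lmap R n m) x y : linear f -> blk (choi f) x y = f (delta_mx x y).
Proof.
move=> lf; have -> : choi f = tmap f (@idmap R n) (Omega R n).
  rewrite Omega_sum (lin_sum (tmap_linear _ _)); apply: eq_bigr => i _.
  rewrite (lin_sum (tmap_linear _ _)); apply: eq_bigr => j _.
  by rewrite tmap_tens.
by rewrite tmap_idE // blk_Omega.
Qed.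

Lemma choi_adjmapE n m (f : lmap R n m) p q i j :
  choi (adjmap f) (ix (p, i)) (ix (q, j)) = Num.conj (f (delta_mx p q) i j).
Proof.
have /matrixP/(_ p q) := blk_choi i j (adjmap_linear f); rewrite mxE => ->.
by rewrite adjmapE mxtrace_mulC mxtrace_delta_mul adjmxE.
Qed.

Lemma pairingE n m (f : lmap R n m) (X : 'M[C]_(n * m)) : linear f ->
  (forall X, f (X^t*) = (f X)^t*) ->
  pairing X f = \tr (tmap f (@idmap R m) X *m Omega R m).
Proof.
move=> lf hf; rewrite /pairing; move: X.
apply: (@eq_linear_delta R _ _ C^o (fun X => \tr (X *m choi (adjmap f)))
  (fun X => \tr (tmap f (@idmap R m) X *m Omega R m))) => [a u v|a u v|a b].
- by rewrite mulmxPl mxtraceD mxtraceZ.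
- by rewrite tmap_linear mulmxPl mxtraceD mxtraceZ.
case: (mxtens_indexP a) => p i; case: (mxtens_indexP b) => q j.
rewrite mxtrace_delta_mul choi_adjmapE -tensmx_delta tmap_tens // mxtrace_tens_Omega.
by rewrite trmx_delta mxtrace_mulC mxtrace_delta_mul -[delta_mx q p]adjmx_delta hf adjmxE conjCK.
Qed.

Lemma Re_pairing n m (f : lmap R n m) (X : 'M[C]_(n * m)) :
  channel f -> Re (pairing X f) = rpairing X f.
Proof. by move=> [lf [cf _]]; rewrite pairingE // => Y; exact: CP_adj. Qed.

Lemma rpairingB n m (X : 'M[C]_(n * m)) (f g : lmap R n m) :
  rpairing X (f \- g) = rpairing X f - rpairing X g.
Proof. by rewrite /rpairing tmapBl mulmxBl retrB. Qed.

Lemma rpairingZ n m (f : lmap R n m) (t : R) X :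
  rpairing (t%:C *: X) f = t * rpairing X f.
Proof. by rewrite /rpairing (linZ (tmap_linear _ _)) -scalemxAl retrZ. Qed.

(* The map [f] with [<X, f> = Tr (X w)]. *)
Definition choi_map n m (w : 'M[C]_(n * m)) : lmap R n m :=
  fun A => \matrix_(i, j) \tr (A *m blk w j i).

Lemma choi_map_linear n m (w : 'M[C]_(n * m)) : linear (choi_map w).
Proof. by move=> a A B; apply/matrixP => i j; rewrite !mxE mulmxPl mxtraceD mxtraceZ. Qed.

Lemma choi_map_linearl n m (A : 'M[C]_n) : linear (fun w : 'M[C]_(n * m) => choi_map w A).
Proof.
move=> a w w'; apply/matrixP => i j.
by rewrite !mxE blk_linear mulmxPr mxtraceD mxtraceZ.
Qed.

Lemma choi_map_tens n m (P : 'M[C]_n) (Q : 'M[C]_m) A :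
  choi_map (P *t Q) A = \tr (A *m P) *: Q^T.
Proof.
by apply/matrixP => i j; rewrite !mxE blk_tens -scalemxAr mxtraceZ mulrC.
Qed.

Lemma choi_map_delta n m (w : 'M[C]_(n * m)) p q i j :
  choi_map w (delta_mx p q) i j = w (ix (q, j)) (ix (p, i)).
Proof. by rewrite mxE mxtrace_delta_mul mxE. Qed.

Lemma mxtrace_choi_map n m (w X : 'M[C]_(n * m)) :
  \tr (tmap (choi_map w) (@idmap R m) X *m Omega R m) = \tr (X *m w).
Proof.
move: X; apply: eq_scalar_tensmx => [a u v|a u v|A B].
- by rewrite tmap_linear mulmxPl mxtraceD mxtraceZ.
- by rewrite mulmxPl mxtraceD mxtraceZ.
rewrite tmap_tens //; last exact: choi_map_linear.
rewrite mxtrace_tens_Omega; move: w; apply: eq_scalar_tensmx => [a u v|a u v|P Q].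
- by rewrite choi_map_linearl mulmxPl mxtraceD mxtraceZ.
- by rewrite mulmxPr mxtraceD mxtraceZ.
rewrite choi_map_tens -scalemxAl mxtraceZ -trmx_mul mxtrace_tr.
by rewrite tensmx_mul mxtrace_tens.
Qed.

Lemma rpairing_choi_map n m (w X : 'M[C]_(n * m)) :
  rpairing X (choi_map w) = retr (X *m w).
Proof. by rewrite /rpairing /retr mxtrace_choi_map. Qed.

Lemma CP_choi_map n m (w : 'M[C]_(n * m)) : psd w -> CP (choi_map w).
Proof.
move=> /psd_gramP[B wE].
suff -> : choi_map w = kraus (fun s => \matrix_(i, p) Num.conj (B (ix (p, i)) s)).
  exact: CP_kraus.
apply/funext; apply: eq_linear_delta => [||p q]; [exact: choi_map_linear|exact: kraus_linear|].
apply/matrixP => i j; rewrite choi_map_delta wE mxE summxE; apply: eq_bigr => s _.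
by rewrite mulmx_delta_mulE !adjmxE !mxE conjCK mulrC.
Qed.

Lemma channel_choi_map n m (w : 'M[C]_(n * m)) :
  psd w -> ptr w = 1%:M -> channel (choi_map w).
Proof.
move=> hw w1; split; first exact: choi_map_linear.
split=> [|A]; first exact: CP_choi_map.
rewrite -[RHS]/(\tr A) -[in RHS](mulmx1 A) -w1 /ptr mulmx_sumr raddf_sum.
by apply: eq_bigr => i _; rewrite mxE.
Qed.

Lemma channel_choi_mapP n m (f : lmap R n m) : channel f ->
  exists w : 'M[C]_(n * m), [/\ psd w, ptr w = 1%:M & f = choi_map w].
Proof.
move=> cf; have [lf [_ tf]] := cf; have [K fE _] := channel_krausP cf.
pose w := dual_kraus (fun s => K s *t (1%:M : 'M[C]_m)) (Omega R m).
have wE X : \tr (tmap f (@idmap R m) X *m Omega R m) = \tr (X *m w).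
  by rewrite {1}fE tmap_kraus mxtrace_kraus.
exists w; split; first exact: psd_kraus (@psd_Omega R m).
  apply: eq_mx_tr => A; rewrite -mxtrace_tens1_mul -wE tmap_tens //.
  by rewrite mxtrace_tens_Omega /idmap trmx1 !mulmx1 tf.
apply/funext => A; apply: eq_mx_tr => B.
have := wE (A *t B^T); rewrite -(mxtrace_choi_map w) !tmap_tens //; last exact: choi_map_linear.
by rewrite !mxtrace_tens_Omega trmxK mxtrace_mulC => ->; rewrite mxtrace_mulC.
Qed.

Lemma choi_adjmap_choi_map n m (w : 'M[C]_(n * m)) : choi (adjmap (choi_map w)) = w^t*.
Proof.
by apply: mxtensP => p i q j; rewrite choi_adjmapE choi_map_delta adjmxE.
Qed.

Lemma choi_adjmap_channel n m (f : lmap R n m) : channel f ->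
  psd (choi (adjmap f)) /\ ptr (choi (adjmap f)) = 1%:M.
Proof.
by move=> /channel_choi_mapP[w [hw w1 ->]]; rewrite choi_adjmap_choi_map psd_herm.
Qed.

Lemma choi_adjmap_comb n m (s t : R) (f g : lmap R n m) :
  choi (adjmap (fun X => s%:C *: f X + t%:C *: g X)) =
  s%:C *: choi (adjmap f) + t%:C *: choi (adjmap g).
Proof.
apply: mxtensP => p i q j; rewrite [RHS]mxE [X in _ = X + _]mxE [X in _ = _ + X]mxE.
rewrite [LHS]choi_adjmapE [X in _ = _ * X + _]choi_adjmapE [X in _ = _ + _ * X]choi_adjmapE.
move: (f _) (g _) => x y.
rewrite !mxE [Num.conj (_ + _)]rmorphD /= ![Num.conj (_ * _)]rmorphM /=.
by rewrite [Num.conj s%:C]conjC_real [Num.conj t%:C]conjC_real.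
Qed.

Lemma channel_exists n m : (0 < m)%N -> exists f : lmap R n m, channel f.
Proof.
move=> m0; have [hE E1] := density_delta R (Ordinal m0).
exists (choi_map (1%:M *t delta_mx (Ordinal m0) (Ordinal m0))); apply: channel_choi_map.
  exact: psd_tens (@psd1 R n) hE.
by rewrite ptr_tens E1 scale1r.
Qed.

(** ** Test operators *)

Definition link n m k (w : 'M[C]_(n * k)) (P : 'M[C]_(m * k)) : 'M[C]_(n * m) :=
  tmap (@idmap R n) (choi_map (swapmx P)) w.

Lemma mxtrace_link n m k (f : lmap R n m) (w : 'M[C]_(n * k)) (P : 'M[C]_(m * k)) :
  linear f ->
  \tr (tmap f (@idmap R m) (link w P) *m Omega R m) = \tr (tmap f (@idmap R k) w *m P).
Proof.
move=> lf; rewrite /link tmap_commute //; last exact: choi_map_linear.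
move: (tmap f _ w); apply: eq_scalar_tensmx => [a u v|a u v|A Z].
- by rewrite tmap_linear mulmxPl mxtraceD mxtraceZ.
- by rewrite mulmxPl mxtraceD mxtraceZ.
rewrite tmap_tens //; last exact: choi_map_linear.
rewrite mxtrace_tens_Omega -mxtrace_tr trmx_mul trmxK -mxtrace_tens_Omega.
have -> : choi_map (swapmx P) Z *t A = tmap (choi_map (swapmx P)) (@idmap R m) (Z *t A).
  by rewrite tmap_tens //; exact: choi_map_linear.
by rewrite mxtrace_choi_map -[Z *t A]swapmx_tens mxtrace_swapmx_mul.
Qed.

Lemma psd_link n m k (w : 'M[C]_(n * k)) (P : 'M[C]_(m * k)) :
  psd w -> psd P -> psd (link w P).
Proof.
move=> hw hP; apply: psd_tmap_idl hw; first exact: choi_map_linear.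
exact/CP_choi_map/psd_reindex.
Qed.

Lemma linkB n m k (w : 'M[C]_(n * k)) (P Q : 'M[C]_(m * k)) :
  link w (P - Q) = link w P - link w Q.
Proof.
rewrite /link -tmapBr; congr (tmap _ _ w); apply/funext => Z /=.
by rewrite (linB (@swapmx_linear R _ _)) (linB (choi_map_linearl Z)).
Qed.

Lemma link1 n m k (w : 'M[C]_(n * k)) : link w (1%:M : 'M[C]_(m * k)) = ptr w *t 1%:M.
Proof.
move: w; apply: eq_linear_tensmx => [||A B]; first exact: tmap_linear.
  by move=> a u v; rewrite linearP tensmxPl.
rewrite /link tmap_tens //; last exact: choi_map_linear.
by rewrite -tensmx11 swapmx_tens choi_map_tens trmx1 mulmx1 tensmxZr ptr_tens tensmxZl.
Qed.

Lemma tmap_choi_map_Omega n m (Q : 'M[C]_(n * m)) :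
  tmap (@idmap R n) (choi_map Q^T) (Omega R n) = Q.
Proof.
rewrite Omega_sum (lin_sum (tmap_linear _ _)).
apply: mxtensP => p i q j; rewrite summxE (@big_only1 _ _ _ _ p) // => [|x /negbTE xp _].
  rewrite (lin_sum (tmap_linear _ _)) summxE (@big_only1 _ _ _ _ q) // => [|y /negbTE yq _].
    rewrite tmap_tens //; last exact: choi_map_linear.
    by rewrite tensmxE choi_map_delta !mxE !eqxx mul1r.
  rewrite tmap_tens //; last exact: choi_map_linear.
  by rewrite tensmxE !mxE [q == y]eq_sym yq andbF mul0r.
rewrite (lin_sum (tmap_linear _ _)) summxE big1 // => y _.
rewrite tmap_tens //; last exact: choi_map_linear.
by rewrite tensmxE !mxE [p == x]eq_sym xp mul0r.
Qed.

(* [X = (B (x) 1) P (B (x) 1)^t*] with an effect [P] is the link product of the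
   pure state [(B (x) 1) |I>>] with [P]. *)
Lemma rpairing_dominated_unit n m (D : lmap R n m) (X : 'M[C]_(n * m)) (s : 'M[C]_n) c :
  linear D -> cb_test_bounded D c -> psd X -> psd s -> s \in unitmx ->
  psd (s *t 1%:M - X) -> rpairing X D <= c * retr s.
Proof.
move=> lD tD hX /psd_gramP[B ->]; rewrite unitmx_mul => /andP[uB _] hsX.
pose B1 : 'M[C]_(n * m) := B *t 1%:M; pose B1i : 'M[C]_(n * m) := invmx B *t 1%:M.
have B1K : B1 *m B1i = 1%:M by rewrite tensmx_mul mulmxV // mulmx1 tensmx11.
have B1Kt : B1i^t* *m B1^t* = 1%:M by rewrite -adjmxM B1K adjmx1.
have sE : (B *m B^t*) *t 1%:M = B1 *m B1^t* by rewrite adjmx_tens tensmx_mul adjmx1 mulmx1.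
pose P := B1i *m X *m B1i^t*.
have effP : effect P.
  split; first exact: psd_conj.
  have -> : 1%:M - P = B1i *m (B1 *m B1^t* - X) *m B1i^t*.
    by rewrite mulmxBr mulmxBl mulmxA (mulmx1C B1K) mul1mx (mulmx1C B1Kt).
  by rewrite -sE; exact: psd_conj.
have B1tE : B1^t* = B^t* *t 1%:M by rewrite adjmx_tens adjmx1.
have linkE : link ((B *t 1%:M) *m Omega R n *m (B *t 1%:M)^t*) (swapmx P^T) = X.
  rewrite /link swapmxK adjmx_tens adjmx1 tmap_mulmxl; last exact: choi_map_linear.
  rewrite tmap_choi_map_Omega -B1tE -/B1 /P.
  by rewrite !mulmxA B1K mul1mx -mulmxA B1Kt mulmx1.
have := tD n _ _ (psd_conj (B *t 1%:M) (@psd_Omega R n))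
  (effect_reindex (can_inj (@swap_idxK _ _)) (effect_trmx effP)).
rewrite /rpairing -[in X in _ -> X]linkE {1}/retr -mxtrace_link //.
suff -> : retr ((B *t 1%:M) *m Omega R n *m (B *t 1%:M)^t*) = retr (B *m B^t*) by [].
rewrite [LHS]retr_mulC mulmxA adjmx_tens adjmx1 tensmx_mul mulmx1 /retr mxtrace_tens_Omega.
by rewrite trmx1 mulmx1 mxtrace_mulC.
Qed.

Lemma rpairing_dominated n m (D : lmap R n m) (X : 'M[C]_(n * m)) (s : 'M[C]_n) c :
  linear D -> cb_test_bounded D c -> psd X -> psd s ->
  psd (s *t 1%:M - X) -> rpairing X D <= c * retr s.
Proof.
move=> lD tD hX hs hsX; apply: (@le_small_error _ _ _ (c * n%:R)) => e e0.
exists e; first by rewrite e0 lexx.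
have he m' : psd (e%:C *: 1%:M : 'M[C]_m') by apply: psdZ (@psd1 R m'); exact: ltW.
have -> : c * retr s + e * (c * n%:R) = c * retr (s + e%:C *: 1%:M).
  by rewrite retrD retrZ retr1 mulrDr mulrCA.
apply: (rpairing_dominated_unit lD tD hX (psdD hs (he n))).
  by rewrite scalemx1; exact: psdD_scalar_unit.
by rewrite tensmxDl tensmxZl tensmx11 addrAC; exact: psdD hsX (he _).
Qed.

Definition testop n m (T : 'M[C]_(n * m)) : Prop :=
  psd T /\ exists2 s : 'M[C]_n, density s & psd (s *t 1%:M - T).

Lemma testop_link n m k (w : 'M[C]_(n * k)) (P : 'M[C]_(m * k)) :
  density w -> effect P -> testop (link w P).
Proof.
move=> [hw w1] [hP hQ]; split; first exact: psd_link.
exists (ptr w); first by split; [exact: psd_ptr|rewrite mxtrace_ptr].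
by rewrite -link1 -linkB; exact: psd_link.
Qed.

Lemma cb_test_bounded_testop n m (D : lmap R n m) c : linear D ->
  (forall T, testop T -> rpairing T D <= c) -> cb_test_bounded D c.
Proof.
move=> lD hT k w P hw eP; have [->|w_neq0] := eqVneq w 0.
  by rewrite (lin0 (tmap_linear _ _)) mul0mx !raddf0 mulr0.
rewrite -(scale_normalize hw) (linZ (tmap_linear _ _)) -scalemxAl retrZ.
rewrite scale_normalize // mulrC ler_wpM2r ?psd_retr_ge0 //.
rewrite {1}/retr -mxtrace_link //; apply: hT.
exact: testop_link (density_normalize hw w_neq0) eP.
Qed.

Lemma testop_convex n m : convexp (@testop n m).
Proof.
move=> t x y t01 [hx [s hs hsx]] [hy [s' hs' hsy]]; have /andP[t0 t1] := t01.
have t1' : 0 <= 1 - t by rewrite subr_ge0.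
split; first exact: psdD (psdZ t0 hx) (psdZ t1' hy).
exists (t%:C *: s + (1 - t)%:C *: s'); first exact: density_convex.
rewrite tensmxPl tensmxZl opprD addrACA -!scalerBr.
exact: psdD (psdZ t0 hsx) (psdZ t1' hsy).
Qed.

Lemma testop_bounded n m : hs_bounded (@testop n m).
Proof.
exists (m%:R ^+ 2) => T [hT [s [_ s1] hsT]]; apply: le_trans (hsnorm2_psd_le hT) _.
rewrite lerXn2r ?nnegrE ?psd_retr_ge0 //; have := psd_retr_ge0 hsT.
by rewrite retrB {1}/retr mxtrace_tens s1 mul1r -/(retr _) retr1 subr_ge0.
Qed.

Lemma testop0 n m : (0 < n)%N -> testop (0 : 'M[C]_(n * m)).
Proof.
move=> n0; split; first exact: psd0.
exists (delta_mx (Ordinal n0) (Ordinal n0)); first exact: density_delta.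
by rewrite subr0; apply: psd_tens (@psd1 R m); exact: psd_delta.
Qed.

Lemma minimax_channels n m (f : lmap R n m) (Y : lmap R n m -> Prop) (c e : R) :
  (0 < n)%N -> channel f -> (forall g, Y g -> channel g) ->
  (forall t g h, 0 <= t <= 1 -> Y g -> Y h -> Y (fun X => t%:C *: g X + (1 - t)%:C *: h X)) ->
  (exists g, Y g) -> 0 < e ->
  (forall T, testop T -> exists2 g, Y g & rpairing T (f \- g) <= c) ->
  exists2 g, Y g & cb_test_bounded (f \- g) (c + e).
Proof.
move=> n_gt0 cf channelY convexY [g0 Yg0] e_gt0 response.
pose gap g := choi (adjmap f) - choi (adjmap g).
have gapE T g : Y g -> retr (T *m gap g) = rpairing T (f \- g).
  move=> /channelY cg; rewrite mulmxBr retrB rpairingB -!Re_pairing //.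
pose gaps y := exists2 g, Y g & y = gap g.
have gaps_convex : convexp gaps.
  move=> t _ _ t01 [g Yg ->] [h Yh ->].
  exists (fun X => t%:C *: g X + (1 - t)%:C *: h X); first exact: convexY.
  by rewrite /gap -convex_subr; congr (_ - _); exact/esym/choi_adjmap_comb.
have choi_le (g : lmap R n m) : channel g -> hsnorm2 (choi (adjmap g)) <= n%:R ^+ 2.
  move=> cg; have [hg g1] := choi_adjmap_channel cg.
  apply: le_trans (hsnorm2_psd_le hg) _.
  by rewrite (retr_ptr1 g1).
have gaps_bounded : hs_bounded gaps.
  exists (2 * n%:R ^+ 2 + 2 * n%:R ^+ 2) => _ [g Yg ->].
  apply: le_trans (hsnorm2_sub_le _ _) _.
  by apply: lerD; rewrite ler_pM2l //; apply: choi_le => //; exact: channelY.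
have gap_response T : testop T -> exists2 y, gaps y & retr (T *m y) <= c.
  by move=> /response[g Yg Tg]; exists (gap g); [exists g|rewrite gapE].
have [_ [g Yg ->] g_le] := minimax_matrix (@testop_convex n m) gaps_convex
  (@testop_bounded n m) gaps_bounded (ex_intro _ _ (testop0 m n_gt0))
  (ex_intro _ _ (ex_intro2 _ _ g0 Yg0 erefl)) e_gt0 gap_response.
exists g => //; apply: cb_test_bounded_testop => [|T hT]; last by rewrite -gapE // g_le.
by have [] := hp_traceless_sub cf (channelY _ Yg).
Qed.

(** ** Semidefinite duality for the dual diamond norm *)

Lemma channel_response n m (X w : 'M[C]_(n * m)) (p : R) :
  (0 < n)%N -> (0 < m)%N -> psd X -> (forall f, channel f -> rpairing X f <= p) ->
  density w ->
  exists2 s : 'M[C]_n, density s & retr (w *m X) <= p * retr (w *m (s *t 1%:M)).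
Proof.
move=> n0 m0 hX hp [hw w1]; pose N := ptr w.
have hN : psd N by exact: psd_ptr.
have [s hs hsN] := psd_max_state n0 hN; exists s => //.
pose M := retr (N *m s); have -> : retr (w *m (s *t 1%:M)) = M.
  by rewrite retr_mulC {1}/retr mxtrace_tens1_mul mxtrace_mulC.
have M_gt0 : 0 < M.
  have n_gt0 : 0 < n%:R :> R by rewrite ltr0n.
  rewrite -(pmulr_lgt0 _ n_gt0); apply: lt_le_trans ltr01 _.
  have := psd_retr_ge0 hsN; rewrite retrB -scalemx1 retrZ retr1 {2}/retr mxtrace_ptr w1.
  by rewrite subr_ge0.
pose E : 'M[C]_m := delta_mx (Ordinal m0) (Ordinal m0).
have [hE trE] : density E by exact: density_delta.
pose rest := 1%:M - M^-1%:C *: N.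
have hrest : psd rest.
  have -> : rest = M^-1%:C *: (M%:C%:M - N).
    by rewrite scalerBr scale_scalar_mx -rmorphM /= mulVf ?gt_eqF.
  by apply: psdZ hsN; rewrite invr_ge0 ltW.
have hw' : psd (M^-1%:C *: w + rest *t E).
  by apply: psdD; [apply: psdZ; rewrite // invr_ge0 ltW|exact: psd_tens].
have w'1 : ptr (M^-1%:C *: w + rest *t E) = 1%:M.
  by rewrite linearP /= ptr_tens trE scale1r addrC subrK.
have := hp _ (channel_choi_map hw' w'1); rewrite rpairing_choi_map mulmxDr -scalemxAr.
rewrite retrD retrZ [retr (w *m X)]retr_mulC -ler_pdivrMr // mulrC.
by apply: le_trans; rewrite lerDl; exact: psd_trM_ge0 hX (psd_tens hrest hE).
Qed.

Lemma rpairing_channel_ge0 n m (X : 'M[C]_(n * m)) (f : lmap R n m) :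
  psd X -> channel f -> 0 <= rpairing X f.
Proof.
by move=> hX /channel_choi_mapP[w [hw _ ->]]; rewrite rpairing_choi_map; exact: psd_trM_ge0.
Qed.

Lemma channel_bound_ge0 n m (X : 'M[C]_(n * m)) (p : R) :
  (0 < m)%N -> psd X -> (forall f, channel f -> rpairing X f <= p) -> 0 <= p.
Proof.
move=> m0 hX hp; have [f cf] := channel_exists n m0.
exact: le_trans (rpairing_channel_ge0 hX cf) (hp _ cf).
Qed.

Lemma density_hs_bounded n : hs_bounded (@density R n).
Proof.
exists 1 => x [hx x1]; apply: le_trans (hsnorm2_psd_le hx) _.
by rewrite /retr x1 expr1n.
Qed.

Definition excess n m (X : 'M[C]_(n * m)) (p : R) (y : 'M[C]_(n * m)) : Prop :=
  exists2 s : 'M[C]_n, density s & y = X - p%:C *: (s *t 1%:M).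

Lemma excess_convex n m (X : 'M[C]_(n * m)) p : convexp (excess X p).
Proof.
move=> t _ _ t01 [s hs ->] [s' hs' ->]; exists (t%:C *: s + (1 - t)%:C *: s').
  exact: density_convex.
rewrite tensmxPl tensmxZl -convex_subr; move: (s *t _) (s' *t _) => u u'.
by rewrite scalerDr !scalerA ![p%:C * _]mulrC.
Qed.

Lemma excess_hs_bounded n m (X : 'M[C]_(n * m)) p :
  0 <= p -> psd X -> hs_bounded (excess X p).
Proof.
move=> p_ge0 hX; exists (2 * retr X ^+ 2 + 2 * (p * m%:R) ^+ 2) => _ [s [hs s1] ->].
apply: le_trans (hsnorm2_sub_le _ _) _; apply: lerD; rewrite ler_pM2l //.
  exact: hsnorm2_psd_le.
apply: le_trans (hsnorm2_psd_le (psdZ p_ge0 (psd_tens hs (@psd1 R m)))) _.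
by rewrite retrZ {1}/retr mxtrace_tens s1 mul1r -/(retr _) retr1.
Qed.

Lemma dual_norm_dominated n m (X : 'M[C]_(n * m)) (p e : R) :
  (0 < n)%N -> (0 < m)%N -> 0 < e -> psd X ->
  (forall f, channel f -> rpairing X f <= p) ->
  exists2 s : 'M[C]_n, density s & psd ((p%:C *: s + e%:C *: 1%:M) *t 1%:M - X).
Proof.
move=> n0 m0 e0 hX hp; have p_ge0 := channel_bound_ge0 m0 hX hp.
have nm0 : (0 < n * m)%N by rewrite muln_gt0 n0.
have hw0 := density_delta R (Ordinal nm0).
have response w : density w -> exists2 y, excess X p y & retr (w *m y) <= 0.
  move=> hw; have [s hs hsw] := channel_response n0 m0 hX hp hw.
  exists (X - p%:C *: (s *t 1%:M)); first by exists s.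
  by rewrite mulmxBr -scalemxAr retrB retrZ subr_le0.
have excess_exists : exists y, excess X p y by have [y] := response _ hw0; exists y.
have dens_convex : convexp (@density R (n * m)) by move=> t x y; exact: density_convex.
have [_ [s hs ->] s_max] := minimax_matrix dens_convex (@excess_convex _ _ X p)
  (@density_hs_bounded _) (excess_hs_bounded p_ge0 hX) (ex_intro _ _ hw0) excess_exists
  e0 response.
exists s => //; apply: psd_densityP => [|w hw].
  rewrite adjmxB (psd_herm hX) adjmx_tens adjmx1 adjmxD !adjmxZ !conjC_real adjmx1.
  by rewrite (psd_herm hs.1).
have -> : (p%:C *: s + e%:C *: 1%:M) *t 1%:M - X =
    e%:C *: 1%:M - (X - p%:C *: (s *t 1%:M)).
  by rewrite tensmxDl !tensmxZl tensmx11 opprB addrA [_ + e%:C *: _]addrC.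
rewrite mulmxBr -scalemxAr mulmx1 retrB retrZ {1}/retr hw.2 mulr1 subr_ge0.
by have := s_max _ hw; rewrite add0r.
Qed.

(* The duality between the diamond norm and its dual, up to the factor 1/2 that
   relates [c] to the diamond norm of [D]. *)
Lemma rpairing_le_dual_norm n m (D : lmap R n m) (X : 'M[C]_(n * m)) (c p : R) :
  (0 < n)%N -> (0 < m)%N -> linear D -> cb_test_bounded D c -> psd X ->
  (forall f, channel f -> rpairing X f <= p) -> rpairing X D <= c * p.
Proof.
move=> n0 m0 lD tD hX hp; apply: (@le_small_error _ _ _ (c * n%:R)) => e e0.
exists e; first by rewrite e0 lexx.
have [s [hs s1] hsX] := dual_norm_dominated n0 m0 e0 hX hp.
have p_ge0 := channel_bound_ge0 m0 hX hp.
have hpe : psd (p%:C *: s + e%:C *: 1%:M).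
  by apply: psdD; apply: psdZ => //; [exact: ltW|exact: psd1].
apply: le_trans (rpairing_dominated lD tD hX hpe hsX) _.
by rewrite retrD !retrZ retr1 {1}/retr s1 mulr1 mulrDr mulrCA.
Qed.

End ChoiOperators.

(** * Superchannels *)

Section PrePostProcessing.
Variable R : realType.
Variables (a0 a1 b0 b1 u : nat).

Definition preprocess r0 (pre : lmap R r0 (u * a0)) (Phi : lmap R (a0 * b0) (a1 * b1)) :
    lmap R (r0 * b0) (u * (a1 * b1)) :=
  tmap (@idmap R u) Phi
    \o (castmx (esym (mulnA u a0 b0), esym (mulnA u a0 b0)) \o tmap pre (@idmap R b0)).

Definition postprocess r1 (post : lmap R (u * a1) r1) :
    lmap R (u * (a1 * b1)) (r1 * b1) :=
  tmap post (@idmap R b1) \o castmx (mulnA u a1 b1, mulnA u a1 b1).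

Lemma preprocess_linear r0 (pre : lmap R r0 (u * a0)) Phi : linear (preprocess pre Phi).
Proof. by move=> a X Y; rewrite /preprocess /= tmap_linear castmx_linear tmap_linear. Qed.

Lemma postprocess_linear r1 (post : lmap R (u * a1) r1) : linear (postprocess post).
Proof. by move=> a X Y; rewrite /postprocess /= castmx_linear tmap_linear. Qed.

Let channel_input r0 (pre : lmap R r0 (u * a0)) : channel pre ->
  channel ((castmx (esym (mulnA u a0 b0), esym (mulnA u a0 b0)) : lmap R _ _)
    \o tmap pre (@idmap R b0)).
Proof. by move=> cpre; apply: channel_comp; [exact: channel_castmx|exact: channel_tensid]. Qed.

Lemma channel_preprocess r0 (pre : lmap R r0 (u * a0)) Phi :
  channel pre -> channel Phi -> channel (preprocess pre Phi).
Proof.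
by move=> /channel_input cin cPhi; exact: (channel_comp (channel_idtens u cPhi) cin).
Qed.

Lemma channel_postprocess r1 (post : lmap R (u * a1) r1) :
  channel post -> channel (postprocess post).
Proof.
move=> cpost; apply: channel_comp; first exact: channel_tensid.
exact: channel_castmx.
Qed.

Lemma cb_test_bounded_preprocess r0 (pre : lmap R r0 (u * a0)) D c :
  channel pre -> linear D -> cb_test_bounded D c -> cb_test_bounded (preprocess pre D) c.
Proof.
move=> /channel_input cin lD tD.
apply: cb_test_bounded_pre cin _; first exact: tmap_linear.
exact: cb_test_bounded_idtens.
Qed.

Lemma preprocessB r0 (pre : lmap R r0 (u * a0)) Phi Psi :
  preprocess pre (Phi \- Psi) = preprocess pre Phi \- preprocess pre Psi.
Proof. by apply/funext => X; rewrite /preprocess /= tmapBr. Qed.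

Lemma preprocess_tens r0 (pre : lmap R r0 (u * a0)) Phi A B : linear pre ->
  preprocess pre Phi (A *t B) = tmap (@idmap R u) Phi
    (castmx (esym (mulnA u a0 b0), esym (mulnA u a0 b0)) (pre A *t B)).
Proof. by move=> lpre; rewrite /preprocess /= tmap_tens. Qed.

Lemma postprocess_tens r1 (post : lmap R (u * a1) r1) P F G : linear post ->
  postprocess post (P *t (F *t G)) = post (P *t F) *t G.
Proof. by move=> lpost; rewrite /postprocess /= tensmxA tmap_tens. Qed.

End PrePostProcessing.

Ltac linear_by_rules := move=> ? ? ? /=; rewrite ?(mulmxPl, mulmxPr, tensmxPl, tensmxPr,
  castmx_linear, tmap_linear, preprocess_linear, postprocess_linear).

Section Superchannels.
Variable R : realType.
Local Notation C := R[i].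

Lemma supch_applyE a0 a1 a0' a1' b0 b1 u (pre : lmap R a0' (u * a0))
    (post : lmap R (u * a1) a1') (Phi : lmap R (a0 * b0) (a1 * b1)) :
  supch_apply pre post Phi = postprocess post \o preprocess pre Phi.
Proof. by []. Qed.

Section Application.
Variables (a0 a1 a0' a1' b0 b1 u : nat).
Variables (pre : lmap R a0' (u * a0)) (post : lmap R (u * a1) a1').
Implicit Types Phi Psi D : lmap R (a0 * b0) (a1 * b1).

Lemma supch_linear Phi : linear (supch_apply pre post Phi).
Proof.
by move=> a X Y; rewrite supch_applyE /= preprocess_linear postprocess_linear.
Qed.

Lemma supchB Phi Psi :
  supch_apply pre post (Phi \- Psi) = supch_apply pre post Phi \- supch_apply pre post Psi.
Proof.
apply/funext => X; rewrite !supch_applyE preprocessB /=.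
exact: (linB (@postprocess_linear R _ _ _ _ post)).
Qed.

Lemma channel_supch Phi :
  channel pre -> channel post -> channel Phi -> channel (supch_apply pre post Phi).
Proof.
move=> cpre cpost cPhi; rewrite supch_applyE.
by apply: channel_comp; [exact: channel_postprocess|exact: channel_preprocess].
Qed.

Lemma cb_test_bounded_supch D c : channel pre -> channel post -> linear D ->
  cb_test_bounded D c -> cb_test_bounded (supch_apply pre post D) c.
Proof.
move=> cpre cpost lD tD; rewrite supch_applyE.
apply: cb_test_bounded_post; first exact: preprocess_linear.
  exact: channel_postprocess.
exact: cb_test_bounded_preprocess.
Qed.

End Application.

(** ** Composition of superchannels *)

Definition compose_pre a0 a0' r0 u u' (pre' : lmap R r0 (u' * a0'))
    (pre : lmap R a0' (u * a0)) : lmap R r0 (u' * u * a0) :=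
  castmx (mulnA u' u a0, mulnA u' u a0) \o tmap (@idmap R u') pre \o pre'.

Definition extend_post a1 a1' u u' (post : lmap R (u * a1) a1') :
    lmap R (u' * u * a1) (u' * a1') :=
  tmap (@idmap R u') post \o castmx (esym (mulnA u' u a1), esym (mulnA u' u a1)).

Lemma channel_compose_pre a0 a0' r0 u u' (pre' : lmap R r0 (u' * a0'))
    (pre : lmap R a0' (u * a0)) :
  channel pre' -> channel pre -> channel (compose_pre pre' pre).
Proof.
move=> cpre' cpre; apply: channel_comp cpre'.
by apply: channel_comp; [exact: channel_castmx|exact: channel_idtens].
Qed.

Lemma channel_extend_post a1 a1' u u' (post : lmap R (u * a1) a1') :
  channel post -> channel (@extend_post a1 a1' u u' post).
Proof.
by move=> cpost; apply: channel_comp; [exact: channel_idtens|exact: channel_castmx].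
Qed.

Lemma preprocess_supch a0 a1 a0' a1' r0 b0 b1 u u'
    (pre : lmap R a0' (u * a0)) (post : lmap R (u * a1) a1')
    (pre' : lmap R r0 (u' * a0')) (Phi : lmap R (a0 * b0) (a1 * b1)) :
  linear pre -> linear post -> linear pre' -> linear Phi ->
  preprocess pre' (supch_apply pre post Phi) =
  castmx (esym (mulnA u' a1' b1), esym (mulnA u' a1' b1))
    \o postprocess (extend_post post) \o preprocess (compose_pre pre' pre) Phi.
Proof.
move=> lpre lpost lpre' lPhi; apply/funext.
have lpp : linear (compose_pre pre' pre).
  by move=> a x y; rewrite /compose_pre /= lpre' tmap_linear castmx_linear.
have lext : linear (@extend_post a1 a1' u u' post) by rewrite /extend_post; linear_by_rules.
apply: eq_linear_tensmx => [||A B /=]; [exact: preprocess_linear|by linear_by_rules|].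
rewrite !preprocess_tens // {1}/compose_pre /=; move: (pre' A) => Z {A}.
move: Z; apply: eq_linear_tensmx => [||P Q]; [by linear_by_rules..|].
rewrite tensmxAV [tmap _ pre _]tmap_tens // [LHS]tmap_tens //; last exact: supch_linear.
rewrite supch_applyE /= preprocess_tens // /idmap; move: (pre Q) => Z {Q}.
move: Z; apply: eq_linear_tensmx => [||S T]; [by linear_by_rules..|].
rewrite !tensmxAV tensmxA tensmxAV !tmap_tens // /idmap; move: (Phi _) => Z.
move: Z; apply: eq_linear_tensmx => [||F G]; [by linear_by_rules..|].
by rewrite !postprocess_tens // /extend_post /= !tensmxAV tmap_tens // tensmxAV.
Qed.

Lemma postprocess_comp a1 a1' r1 b1 u u' (post' : lmap R (u' * a1') r1)
    (mid : lmap R (u * a1) (u' * a1')) :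
  linear post' -> linear mid ->
  postprocess (b1 := b1) post' \o castmx (esym (mulnA u' a1' b1), esym (mulnA u' a1' b1))
    \o postprocess mid = postprocess (post' \o mid).
Proof.
move=> lpost' lmid; apply/funext => X; rewrite /postprocess /=.
by rewrite castmx_comp castmx_id tmap_id_comp.
Qed.

Lemma supch_comp a0 a1 a0' a1' r0 r1 b0 b1 u u'
    (pre : lmap R a0' (u * a0)) (post : lmap R (u * a1) a1')
    (pre' : lmap R r0 (u' * a0')) (post' : lmap R (u' * a1') r1)
    (Phi : lmap R (a0 * b0) (a1 * b1)) :
  linear pre -> linear post -> linear pre' -> linear post' -> linear Phi ->
  supch_apply pre' post' (supch_apply pre post Phi) =
  supch_apply (compose_pre pre' pre) (post' \o extend_post post) Phi.
Proof.
move=> lpre lpost lpre' lpost' lPhi; rewrite supch_applyE preprocess_supch //.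
rewrite supch_applyE -(postprocess_comp _ lpost') // /extend_post.
by linear_by_rules.
Qed.

Lemma superch_outputs_comp a0 a1 a0' a1' r0 r1 b0 b1 u'
    (pre' : lmap R r0 (u' * a0')) (post' : lmap R (u' * a1') r1)
    (Phi : lmap R (a0 * b0) (a1 * b1)) (Psi : lmap R (a0' * b0) (a1' * b1)) :
  (0 < u')%N -> channel pre' -> channel post' -> linear Phi ->
  superch_outputs Phi Psi -> superch_outputs Phi (supch_apply pre' post' Psi).
Proof.
move=> u'0 cpre' cpost' lPhi [u [pre [post [u0 cpre cpost ->]]]].
exists (u' * u)%N, (compose_pre pre' pre), (post' \o extend_post post); split.
- by rewrite muln_gt0 u'0.
- exact: channel_compose_pre.
- by apply: channel_comp => //; exact: channel_extend_post.
exact: supch_comp cpre.1 cpost.1 cpre'.1 cpost'.1 lPhi.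
Qed.

Lemma channel_superch_outputs a0 a1 a0' a1' b0 b1 (Phi : lmap R (a0 * b0) (a1 * b1))
    (Psi : lmap R (a0' * b0) (a1' * b1)) :
  channel Phi -> superch_outputs Phi Psi -> channel Psi.
Proof. by move=> cPhi [u [pre [post [_ cpre cpost ->]]]]; exact: channel_supch. Qed.

Lemma superch_outputs_nonempty a0 a1 a0' a1' b0 b1 (Phi : lmap R (a0 * b0) (a1 * b1)) :
  (0 < a0)%N -> (0 < a1')%N ->
  exists Psi : lmap R (a0' * b0) (a1' * b1), superch_outputs Phi Psi.
Proof.
move=> a0_gt0 a1'_gt0; have a0_gt0' : (0 < 1 * a0)%N by rewrite mul1n.
have [pre cpre] := channel_exists R a0' a0_gt0'.
have [post cpost] := channel_exists R (1 * a1) a1'_gt0.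
by exists (supch_apply pre post Phi), 1%N, pre, post.
Qed.

Lemma superch_outputs_refl a0 a1 b0 b1 (Phi : lmap R (a0 * b0) (a1 * b1)) :
  linear Phi -> superch_outputs Phi Phi.
Proof.
move=> lPhi.
pose pre : lmap R a0 (1 * a0) := castmx (esym (mul1n _), esym (mul1n _)).
pose post : lmap R (1 * a1) a1 := castmx (mul1n _, mul1n _).
have preE X : pre X = 1%:M *t X by rewrite tens_scalar1mx.
have postE X : post (1%:M *t X) = X by rewrite tens_scalar1mx /post castmx_comp castmx_id.
have cpre : channel pre by exact: channel_castmx.
have cpost : channel post by exact: channel_castmx.
exists 1%N, pre, post; split=> //; apply/funext.
apply: eq_linear_tensmx => [//||A B]; first exact: supch_linear.
rewrite supch_applyE /= preprocess_tens; last exact: cpre.1.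
rewrite preE tensmxAV tmap_tens // /idmap; move: (Phi _) => Z.
move: Z; apply: eq_linear_tensmx => [//||F G]; first by linear_by_rules.
by rewrite postprocess_tens ?postE //; exact: cpost.1.
Qed.

(** ** Convexity *)

Lemma supch_slide a0 a1 a0' a1' b0 b1 u u' (g : lmap R u u') (pre : lmap R a0' (u * a0))
    (post : lmap R (u' * a1) a1') (Phi : lmap R (a0 * b0) (a1 * b1)) :
  linear g -> linear pre -> linear post -> linear Phi ->
  supch_apply (tmap g (@idmap R a0) \o pre) post Phi =
  supch_apply pre (post \o tmap g (@idmap R a1)) Phi.
Proof.
move=> lg lpre lpost lPhi; apply/funext.
have lpre' : linear (tmap g (@idmap R a0) \o pre).
  by move=> a x y /=; rewrite lpre tmap_linear.
have lpost' : linear (post \o tmap g (@idmap R a1)).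
  by move=> a x y /=; rewrite tmap_linear lpost.
apply: eq_linear_tensmx => [||A B]; [exact: supch_linear..|].
rewrite !supch_applyE /= !preprocess_tens //=; move: (pre A) => Z {A}.
move: Z; apply: eq_linear_tensmx => [||P Q]; [by linear_by_rules..|].
rewrite [tmap g _ _]tmap_tens // !tensmxAV !tmap_tens // /idmap; move: (Phi _) => Z.
move: Z; apply: eq_linear_tensmx => [||F G]; [by linear_by_rules..|].
by rewrite !postprocess_tens //= tmap_tens.
Qed.

Lemma supch_comb_pre a0 a1 a0' a1' b0 b1 u (pre pre' : lmap R a0' (u * a0))
    (post : lmap R (u * a1) a1') (Phi : lmap R (a0 * b0) (a1 * b1)) a b X :
  supch_apply (fun Y => a *: pre Y + b *: pre' Y) post Phi X =
  a *: supch_apply pre post Phi X + b *: supch_apply pre' post Phi X.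
Proof.
rewrite !supch_applyE /= /preprocess /= tmap_combl.
rewrite castmx_linear tmap_linear postprocess_linear; congr (_ + _).
by rewrite (linZ (castmx_linear _ _)) (linZ (tmap_linear _ _)) (linZ (postprocess_linear _)).
Qed.

Lemma complementary_embeddings m n :
  exists (J1 : 'M[C]_(m + n, m)) (J2 : 'M[C]_(m + n, n)),
    [/\ J1^t* *m J1 = 1%:M, J2^t* *m J2 = 1%:M, J1^t* *m J2 = 0, J2^t* *m J1 = 0 &
        J1 *m J1^t* + J2 *m J2^t* = 1%:M].
Proof.
exists (col_mx 1%:M 0), (col_mx 0 1%:M).
have adjmx_col p (A : 'M[C]_(m, p)) (B : 'M[C]_(n, p)) :
    (col_mx A B)^t* = row_mx (A^t*) (B^t*).
  by rewrite /adjmx map_col_mx tr_col_mx.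
rewrite !adjmx_col !mul_row_col !mul_col_row !adjmx1 !adjmx0.
rewrite !(mulmx1, mul1mx, mulmx0, mul0mx, addr0, add0r); split=> //.
by rewrite add_block_mx !addr0 add0r -scalar_mx_block.
Qed.

Lemma superch_outputs_convex a0 a1 a0' a1' b0 b1 (Phi : lmap R (a0 * b0) (a1 * b1))
    (Psi1 Psi2 : lmap R (a0' * b0) (a1' * b1)) (t : R) :
  linear Phi -> 0 <= t <= 1 -> superch_outputs Phi Psi1 -> superch_outputs Phi Psi2 ->
  superch_outputs Phi (fun X => t%:C *: Psi1 X + (1 - t)%:C *: Psi2 X).
Proof.
move=> lPhi t01 [u1 [pre1 [post1 [u1_gt0 cpre1 cpost1 ->]]]]
  [u2 [pre2 [post2 [_ cpre2 cpost2 ->]]]].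
have [J1 [J2 [J11 J22 J12 J21 JJ]]] := complementary_embeddings u1 u2.
pose embed u (J : 'M[C]_(u1 + u2, u)) a : lmap R (u * a) ((u1 + u2) * a) :=
  tmap (conjm J) (@idmap R a).
have channel_embed u (J : 'M[C]_(u1 + u2, u)) a : J^t* *m J = 1%:M -> channel (embed u J a).
  by move=> JK; exact/channel_tensid/channel_conjm.
pose pre X := t%:C *: (embed u1 J1 a0 \o pre1) X + (1 - t)%:C *: (embed u2 J2 a0 \o pre2) X.
have cpre : channel pre.
  by apply: channel_convex => //; apply: channel_comp => //; exact: channel_embed.
pose restrict u (J : 'M[C]_(u1 + u2, u)) : lmap R ((u1 + u2) * a1) (u * a1) :=
  conjm ((J *t 1%:M)^t*).
pose post := (post1 \o restrict u1 J1) \+ (post2 \o restrict u2 J2).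
have cpost : channel post.
  apply: channel_direct_sum cpost1 cpost2.
  by rewrite !adjmx_tens !tensmx_mul adjmx1 mulmx1 -tensmxDl JJ tensmx11.
have restrict_embed u u' (J : 'M[C]_(u1 + u2, u)) (J' : 'M[C]_(u1 + u2, u')) X :
    restrict u J (embed u' J' a1 X) = conjm ((J^t* *m J') *t 1%:M) X.
  by rewrite /restrict /embed tmap_conjm conjmM adjmx_tens adjmx1 tensmx_mul mulmx1.
have conjm0 n m X : conjm (0 : 'M[C]_(m, n)) X = 0 by rewrite /conjm !mul0mx.
have conjm1 n X : conjm (1%:M : 'M[C]_n) X = X by rewrite /conjm adjmx1 mul1mx mulmx1.
have post_embed1 : post \o embed u1 J1 a1 = post1.
  apply/funext => X; rewrite /post /= !restrict_embed J11 J21 tensmx11 conjm1 tens0mx conjm0.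
  by rewrite (lin0 cpost2.1) addr0.
have post_embed2 : post \o embed u2 J2 a1 = post2.
  apply/funext => X; rewrite /post /= !restrict_embed J22 J12 tensmx11 conjm1 tens0mx conjm0.
  by rewrite (lin0 cpost1.1) add0r.
exists (u1 + u2)%N, pre, post; split=> //; first by rewrite addn_gt0 u1_gt0.
apply/funext => X; rewrite supch_comb_pre.
rewrite !(supch_slide (conjm_linear _) _ cpost.1 lPhi) ?post_embed1 ?post_embed2 //.
  exact: cpre2.1.
exact: cpre1.1.
Qed.

End Superchannels.

(** * Guessing games *)

Ltac scalar_by_rules := linear_by_rules; rewrite mxtraceD mxtraceZ.

Section JointTests.
Variable R : realType.
Local Notation C := R[i].
Local Notation ix := mxtens_index.

Lemma reorder_idx_bij u a1 b1 r1 : bijective (@reorder_idx u a1 b1 r1).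
Proof.
pose g (q : 'I_(u * a1 * r1 * (b1 * b1))) : 'I_(u * (a1 * b1) * (r1 * b1)) :=
  let x := mxtens_unindex q in let y := mxtens_unindex x.1 in
  let ua := mxtens_unindex y.1 in let bb := mxtens_unindex x.2 in
  ix (ix (ua.1, ix (ua.2, bb.1)), ix (y.2, bb.2)).
exists g => p.
  case: (mxtens_indexP p) => x y; case: (mxtens_indexP x) => i z.
  case: (mxtens_indexP z) => j k; case: (mxtens_indexP y) => l m.
  by rewrite /g /reorder_idx !mxtens_indexK.
case: (mxtens_indexP p) => x y; case: (mxtens_indexP x) => z l.
case: (mxtens_indexP z) => i j; case: (mxtens_indexP y) => k m.
by rewrite /g /reorder_idx !mxtens_indexK.
Qed.

(* The test [N (x) M], where [N] acts on [U A1 R1] and [M] on both copies of [B1]. *)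
Definition joint_test u a1 b1 r1 (N : 'M[C]_(u * a1 * r1)) (M : 'M[C]_(b1 * b1)) :
    'M[C]_(u * (a1 * b1) * (r1 * b1)) :=
  Defs.reindex (@reorder_idx u a1 b1 r1) (N *t M).

Lemma joint_test_tens u a1 b1 r1 (P : 'M[C]_u) (F : 'M[C]_a1) (G : 'M[C]_b1)
    (E : 'M[C]_r1) (D : 'M[C]_b1) :
  joint_test ((P *t F) *t E) (G *t D) = (P *t (F *t G)) *t (E *t D).
Proof.
apply: mxtensP => x y x' y'; rewrite mxE /reorder_idx.
case: (mxtens_indexP x) => i z; case: (mxtens_indexP z) => j k.
case: (mxtens_indexP y) => l m; case: (mxtens_indexP x') => i' z'.
case: (mxtens_indexP z') => j' k'; case: (mxtens_indexP y') => l' m'.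
by rewrite !mxtens_indexK /= !tensmxE; ring.
Qed.

Lemma joint_testM u a1 b1 r1 (N N' : 'M[C]_(u * a1 * r1)) (M M' : 'M[C]_(b1 * b1)) :
  joint_test N M *m joint_test N' M' = joint_test (N *m N') (M *m M').
Proof. by rewrite /joint_test -(reindexM _ _ (reorder_idx_bij _ _ _ _)) tensmx_mul. Qed.

Lemma joint_test_suml u a1 b1 r1 (I : Type) (s : seq I) (P : pred I)
    (N : I -> 'M[C]_(u * a1 * r1)) (M : 'M[C]_(b1 * b1)) :
  joint_test (\sum_(i <- s | P i) N i) M = \sum_(i <- s | P i) joint_test (N i) M.
Proof. by rewrite /joint_test tensmx_suml (lin_sum (reindex_linear _)). Qed.

Lemma joint_testZ u a1 b1 r1 a b (N : 'M[C]_(u * a1 * r1)) (M : 'M[C]_(b1 * b1)) :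
  joint_test (a *: N) (b *: M) = (a * b) *: joint_test N M.
Proof.
by rewrite /joint_test tensmxZl tensmxZr scalerA (linZ (reindex_linear _)).
Qed.

Lemma mxtrace_joint_test u a1 b1 r1 (W : 'M[C]_(u * a1)) (G D : 'M[C]_b1) (E : 'M[C]_r1)
    (N : 'M[C]_(u * a1 * r1)) (M : 'M[C]_(b1 * b1)) :
  \tr ((castmx (esym (mulnA u a1 b1), esym (mulnA u a1 b1)) (W *t G) *t (E *t D))
       *m joint_test N M) =
  \tr ((W *t E) *m N) * \tr ((G *t D) *m M).
Proof.
move: W; apply: eq_scalar_tensmx => [||P F].
- by scalar_by_rules.
- by scalar_by_rules; rewrite mulrDl mulrA.
rewrite tensmxAV -joint_test_tens joint_testM.
by rewrite mxtrace_reindex ?mxtrace_tens //; exact: reorder_idx_bij.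
Qed.

Lemma measurement_joint_test u a1 b1 r1 (I J : finType) (N : I -> 'M[C]_(u * a1 * r1))
    (M : J -> 'M[C]_(b1 * b1)) : measurement N -> measurement M ->
  measurement (fun ij : I * J => joint_test (N ij.1) (M ij.2)).
Proof.
move=> [hN N1] [hM M1]; split=> [ij|].
  by apply: psd_reindex; exact: psd_tens.
rewrite -(lin_sum (reindex_linear _)) -(pair_bigA _ (fun i j => N i *t M j)) /=.
under eq_bigr do rewrite -tensmx_sumr M1.
rewrite -tensmx_suml N1 tensmx11; apply: reindex1.
exact: bij_inj (reorder_idx_bij _ _ _ _).
Qed.

Lemma joint_test_conj u a1 b1 r1 (U : 'M[C]_r1) (V : 'M[C]_b1)
    (N : 'M[C]_(u * a1 * r1)) (M : 'M[C]_(b1 * b1)) :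
  (1%:M *t (U *t V))^t* *m joint_test N M *m (1%:M *t (U *t V)) =
  joint_test ((1%:M *t U)^t* *m N *m (1%:M *t U)) ((1%:M *t V)^t* *m M *m (1%:M *t V)).
Proof.
have jointE (U' : 'M[C]_r1) (V' : 'M[C]_b1) :
    1%:M *t (U' *t V') = joint_test ((1%:M : 'M[C]_(u * a1)) *t U') (1%:M *t V').
  by rewrite -!tensmx11 joint_test_tens !tensmx11.
by rewrite !adjmx_tens !adjmx1 !jointE !joint_testM.
Qed.

Lemma mxtrace_postprocess_joint_test u u' a1 a1' b1 r1
    (mid : lmap R (u * a1) (u' * a1')) (N : 'M[C]_(u' * a1' * r1))
    (N' : 'M[C]_(u * a1 * r1)) (M : 'M[C]_(b1 * b1)) Y :
  linear mid ->
  (forall X, \tr (tmap mid (@idmap R r1) X *m N) = \tr (X *m N')) ->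
  \tr (tmap (castmx (esym (mulnA u' a1' b1), esym (mulnA u' a1' b1)) \o postprocess mid)
         (@idmap R (r1 * b1)) Y *m joint_test N M) =
  \tr (Y *m joint_test N' M).
Proof.
move=> lmid dualN; set post := _ \o _.
have lpost : linear post by rewrite /post; linear_by_rules.
move: Y; apply: eq_scalar_tensmx => [||Y Z]; [by scalar_by_rules..|].
rewrite tmap_tens // /idmap; move: Y; apply: eq_scalar_tensmx => [||P Q].
- by move=> a X Y; rewrite lpost tensmxPl mulmxPl mxtraceD mxtraceZ.
- by scalar_by_rules.
move: Q; apply: eq_scalar_tensmx => [||F G].
- by move=> a X Y; rewrite tensmxPr lpost tensmxPl mulmxPl mxtraceD mxtraceZ.
- by scalar_by_rules.
move: Z; apply: eq_scalar_tensmx => [||E D]; [by scalar_by_rules..|].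
rewrite /post /= postprocess_tens // mxtrace_joint_test.
rewrite -[in RHS](tensmxAV P F G (esym (mulnA u a1 b1)) (esym (mulnA u a1 b1))).
by rewrite mxtrace_joint_test -dualN tmap_tens.
Qed.

Lemma mxtrace_postprocess_Omega u a1 b1 r1 (post : lmap R (u * a1) r1)
    (J : 'M[C]_(u * a1 * r1)) Y :
  linear post ->
  (forall X, \tr (tmap post (@idmap R r1) X *m Omega R r1) = \tr (X *m J)) ->
  \tr (tmap (postprocess post) (@idmap R (r1 * b1)) Y *m Omega R (r1 * b1)) =
  \tr (Y *m joint_test J (Omega R b1)).
Proof.
move=> lpost dualJ; have lpp := @postprocess_linear R _ b1 _ _ post.
move: Y; apply: eq_scalar_tensmx => [||Y Z]; [by scalar_by_rules..|].
rewrite tmap_tens // /idmap; move: Y; apply: eq_scalar_tensmx => [||P Q].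
- by scalar_by_rules.
- by scalar_by_rules.
move: Q; apply: eq_scalar_tensmx => [||F G]; [by scalar_by_rules..|].
move: Z; apply: eq_scalar_tensmx => [||E D]; [by scalar_by_rules..|].
rewrite postprocess_tens // mxtrace_tens_Omega trmx_tens tensmx_mul mxtrace_tens.
rewrite -(tensmxAV P F G (esym (mulnA u a1 b1)) (esym (mulnA u a1 b1))).
by rewrite mxtrace_joint_test -dualJ tmap_tens // !mxtrace_tens_Omega.
Qed.

Definition guess_value u a1 b1 s0 r1 (I J : finType) (lam : I * J -> R)
    (rho : I * J -> 'M[C]_(s0 * (r1 * b1))) (M : J -> 'M[C]_(b1 * b1))
    (g : lmap R s0 (u * (a1 * b1))) (N : I -> 'M[C]_(u * a1 * r1)) : R :=
  \sum_ij lam ij * retr (tmap g (@idmap R (r1 * b1)) (rho ij) *m joint_test (N ij.1) (M ij.2)).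

Lemma guess_valueB u a1 b1 s0 r1 (I J : finType) (lam : I * J -> R)
    (rho : I * J -> 'M[C]_(s0 * (r1 * b1))) (M : J -> 'M[C]_(b1 * b1))
    (f g : lmap R s0 (u * (a1 * b1))) (N : I -> 'M[C]_(u * a1 * r1)) :
  guess_value lam rho M (f \- g) N = guess_value lam rho M f N - guess_value lam rho M g N.
Proof.
rewrite /guess_value -sumrB; apply: eq_bigr => ij _.
by rewrite tmapBl mulmxBl retrB mulrBr.
Qed.

Lemma Re_sumZ (I : finType) (lam : I -> R) (E : I -> C) :
  Re (\sum_i (lam i)%:C * E i) = \sum_i lam i * Re (E i).
Proof. by rewrite raddf_sum; apply: eq_bigr => i _; exact: ReZ. Qed.

Lemma PM_guess_value a0 a1 b0 b1 r0 r1 k l (Phi : lmap R (a0 * b0) (a1 * b1))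
    (M : 'I_l -> 'M[C]_(b1 * b1)) (lam : 'I_k * 'I_l -> R)
    (rho : 'I_k * 'I_l -> 'M[C]_((r0 * b0) * (r1 * b1))) :
  PM Phi M lam rho = ereal_sup [set t | exists u (pre : lmap R r0 (u * a0))
    (N : 'I_k -> 'M[C]_(u * a1 * r1)),
    [/\ (0 < u)%N, channel pre, measurement N &
        t = (guess_value lam rho M (preprocess pre Phi) N)%:E]].
Proof.
congr ereal_sup; apply/eq_set => t; apply: eq_exists => u; apply: eq_exists => pre.
apply: eq_exists => N; apply/propext; split=> -[u0 cpre hN ->]; split=> //.
  by congr _%:E; exact: Re_sumZ.
by congr _%:E; apply/esym; exact: Re_sumZ.
Qed.

Lemma measurement_dual_kraus (I : finType) n m (S : finType) (K : S -> 'M[C]_(m, n))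
    (N : I -> 'M[C]_m) :
  dual_kraus K 1%:M = 1%:M -> measurement N -> measurement (dual_kraus K \o N).
Proof.
move=> K1 [hN N1]; split=> [i|] /=; first exact: psd_kraus.
by rewrite -(lin_sum (kraus_linear _)) N1.
Qed.

Lemma guess_value_supch a0 a1 a0' a1' b0 b1 r0 r1 u u0 (I : finType)
    (pre : lmap R a0' (u0 * a0)) (post : lmap R (u0 * a1) a1')
    (Phi : lmap R (a0 * b0) (a1 * b1)) (alpha : lmap R r0 (u * a0'))
    (N : I -> 'M[C]_(u * a1' * r1)) :
  channel pre -> channel post -> linear Phi -> channel alpha -> measurement N ->
  exists2 N' : I -> 'M[C]_(u * u0 * a1 * r1), measurement N' &
  forall (J : finType) lam rho (M : J -> 'M[C]_(b1 * b1)),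
    guess_value lam rho M (preprocess alpha (supch_apply pre post Phi)) N =
    guess_value lam rho M (preprocess (compose_pre alpha pre) Phi) N'.
Proof.
move=> cpre cpost lPhi calpha hN.
have cmid := channel_tensid r1 (@channel_extend_post R a1 a1' u0 u post cpost).
have [L LE L1] := channel_krausP cmid.
exists (dual_kraus L \o N); first exact: measurement_dual_kraus.
move=> J lam rho M; apply: eq_bigr => ij _; congr (_ * _); rewrite /retr.
rewrite (preprocess_supch cpre.1 cpost.1 calpha.1 lPhi).
rewrite tmap_id_comp; last exact: preprocess_linear.
  congr Re; apply: mxtrace_postprocess_joint_test => [|X] /=.
    by rewrite /extend_post; linear_by_rules.
  by rewrite LE mxtrace_kraus.
by linear_by_rules.
Qed.

End JointTests.

(** * State discrimination *)

Section Discrimination.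
Variable R : realType.
Local Notation C := R[i].

Lemma ensemble_card_gt0 (I : finType) n (lam : I -> R) (rho : I -> 'M[C]_n) :
  ensemble lam rho -> (0 < #|I|)%N.
Proof.
move=> [_ lam1 _]; rewrite lt0n; apply/negP => /eqP/card0_eq I0.
by move: lam1; rewrite big_pred0 // => /eqP; rewrite eq_sym oner_eq0.
Qed.

Lemma psucc_withE (I : finType) n (lam : I -> R) (rho M : I -> 'M[C]_n) :
  psucc_with lam rho M = \sum_i lam i * retr (rho i *m M i).
Proof. exact: Re_sumZ. Qed.

Definition flag (I : finType) (i : I) : 'M[C]_#|I| :=
  delta_mx (enum_rank i) (enum_rank i).

Lemma density_flag (I : finType) (i : I) : density (flag i).
Proof. exact: density_delta. Qed.

Lemma measurement_flag (I : finType) : measurement (@flag I).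
Proof.
split=> [i|]; first exact: (density_flag i).1.
by rewrite -(sum_delta1 R #|I|) (reindex (@enum_rank I)) //; exact: onW_bij (enum_rank_bij I).
Qed.

Definition cq_state (I : finType) n (lam : I -> R) (rho : I -> 'M[C]_n) :
    'M[C]_(n * #|I|) :=
  \sum_i (lam i)%:C *: (rho i *t flag i).

Lemma psd_cq_state (I : finType) n (lam : I -> R) (rho : I -> 'M[C]_n) :
  ensemble lam rho -> psd (cq_state lam rho).
Proof.
move=> [lam_ge0 _ hrho]; apply: psd_sum => i _; apply: psdZ => //.
exact: psd_tens (hrho i).1 (density_flag i).1.
Qed.

Lemma rpairing_cq_state (I : finType) n (lam : I -> R) (rho : I -> 'M[C]_n)
    (f : lmap R n #|I|) : linear f ->
  rpairing (cq_state lam rho) f = \sum_i lam i * retr (f (rho i) *m flag i).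
Proof.
move=> lf; rewrite /rpairing /cq_state (lin_sum (tmap_linear _ _)) mulmx_suml raddf_sum.
apply: eq_bigr => i _; rewrite (linZ (tmap_linear _ _)) -scalemxAl /= retrZ; congr (_ * _).
by rewrite tmap_tens // /retr mxtrace_tens_Omega trmx_delta.
Qed.

Definition measure_map (I : finType) n (F : I -> 'M[C]_n) : lmap R n #|I| :=
  choi_map (\sum_i (F i *t flag i)).

Lemma channel_measure_map (I : finType) n (F : I -> 'M[C]_n) :
  measurement F -> channel (measure_map F).
Proof.
move=> [hF F1]; apply: channel_choi_map.
  by apply: psd_sum => i _; exact: psd_tens (hF i) (density_flag i).1.
rewrite linear_sum -F1; apply: eq_bigr => i _; rewrite /= ptr_tens.
by rewrite (density_flag i).2 scale1r.
Qed.

Lemma mxtrace_measure_map_flag (I : finType) n (F : I -> 'M[C]_n) X i :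
  \tr (measure_map F X *m flag i) = \tr (X *m F i).
Proof.
rewrite /measure_map (lin_sum (choi_map_linearl X)) mulmx_suml raddf_sum (bigD1 i) //=.
rewrite big1 => [|j ji]; rewrite choi_map_tens trmx_delta -scalemxAl mxtraceZ.
  by rewrite mxtrace_delta_mul mxE !eqxx mulr1 addr0.
by rewrite mxtrace_delta_mul mxE (inj_eq enum_rank_inj) (negbTE ji) mulr0.
Qed.

Lemma weighted_test_le_psucc (I : finType) n m (D : lmap R n m) (c p : R)
    (lam : I -> R) (rho : I -> 'M[C]_n) (F : I -> 'M[C]_m) :
  (0 < n)%N -> linear D -> cb_test_bounded D c -> ensemble lam rho -> measurement F ->
  (forall M, measurement M -> psucc_with lam rho M <= p) ->
  \sum_i lam i * retr (D (rho i) *m F i) <= c * p.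
Proof.
move=> n_gt0 lD tD hE hF hp; have cF := channel_measure_map hF.
have -> : \sum_i lam i * retr (D (rho i) *m F i) =
    rpairing (cq_state lam rho) (measure_map F \o D).
  rewrite rpairing_cq_state => [|a X Y /=]; last by rewrite lD cF.1.
  by apply: eq_bigr => i _; rewrite [in RHS]/retr mxtrace_measure_map_flag.
apply: rpairing_le_dual_norm (psd_cq_state hE) _ => //.
- exact: ensemble_card_gt0 hE.
- by move=> a X Y /=; rewrite lD cF.1.
- exact: cb_test_bounded_post.
move=> f cf; have [K fE K1] := channel_krausP cf.
rewrite rpairing_cq_state; last exact: cf.1.
apply: le_trans (hp _ (measurement_dual_kraus K1 (measurement_flag I))).
rewrite psucc_withE; apply: ler_sum => i _; rewrite fE {1}/retr mxtrace_kraus.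
exact: lexx.
Qed.

Lemma guess_value_le_psucc u a1 b1 n r1 (I J : finType) (lam : I * J -> R)
    (rho : I * J -> 'M[C]_(n * (r1 * b1))) (g : lmap R n (u * (a1 * b1)))
    (N : I -> 'M[C]_(u * a1 * r1)) (M : J -> 'M[C]_(b1 * b1)) (c p : R) :
  (0 < n * (r1 * b1))%N -> linear g -> cb_test_bounded g c ->
  ensemble lam rho -> measurement N -> measurement M ->
  (forall F, measurement F -> psucc_with lam rho F <= p) ->
  guess_value lam rho M g N <= c * p.
Proof.
move=> n_gt0 lg tg hE hN hM; apply: weighted_test_le_psucc => //.
- exact: tmap_linear.
- exact: cb_test_bounded_tensid.
exact: measurement_joint_test.
Qed.

End Discrimination.

(** * Twirled games *)

Section UnitaryDesigns.
Variable R : realType.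
Local Notation C := R[i].

Definition unitary_design n k (U : 'I_k -> 'M[C]_n) : Prop :=
  [/\ (0 < k)%N, forall i, unitary (U i) &
    forall X, \sum_i U i *m X *m (U i)^t* = (k%:R / n%:R * \tr X)%:M].

Lemma sum_signs n (i j : 'I_n) :
  \sum_(s : {ffun 'I_n -> bool}) ((-1) ^+ s i * (-1) ^+ s j : C) =
  (2 ^ n * (i == j))%:R.
Proof.
have [<-|ij] := eqVneq i j.
  rewrite muln1; under eq_bigr do rewrite -signr_addb addbb expr0.
  by rewrite sumr_const card_ffun card_bool card_ord.
rewrite muln0 mulr0n; set S := \sum_s _.
pose flip (s : {ffun 'I_n -> bool}) := [ffun x => s x (+) (x == i)].
have flipK : involutive flip by move=> s; apply/ffunP => x; rewrite !ffunE addbK.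
have : S = - S.
  rewrite {1}/S (reindex_inj (inv_inj flipK)) -sumrN; apply: eq_bigr => s _.
  by rewrite !ffunE eqxx eq_sym (negbTE ij) addbT addbF signrN mulNr.
by move=> /eqP; rewrite -subr_eq0 opprK -mulr2n mulrn_eq0 /= => /eqP.
Qed.

Definition signed_shift n (s : 'I_n.+1 -> bool) (a : 'I_n.+1) : 'M[C]_n.+1 :=
  \matrix_(p, q) ((-1) ^+ s p * (q == p + a)%:R).

Lemma signed_shift_conjE n s a (X : 'M[C]_n.+1) p q :
  (signed_shift s a *m X *m (signed_shift s a)^t*) p q =
  (-1) ^+ s p * (-1) ^+ s q * X (p + a) (q + a).
Proof.
rewrite mxE (@big_only1 _ _ _ _ (q + a)) // => [|z /negbTE zq _]; last first.
  by rewrite adjmxE [signed_shift _ _ _ _]mxE zq mulr0 rmorph0 mulr0.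
rewrite mxE (@big_only1 _ _ _ _ (p + a)) // => [|z /negbTE zp _]; last first.
  by rewrite mxE zp mulr0 mul0r.
by rewrite adjmxE !mxE !eqxx !mulr1 rmorph_sign mulrAC.
Qed.

Lemma signed_shift_unitary n (s : 'I_n.+1 -> bool) a : unitary (signed_shift s a).
Proof.
apply/matrixP => p q; have := signed_shift_conjE s a 1%:M p q; rewrite mulmx1 => ->.
rewrite !mxE (inj_eq (addIr _)); have [->|_] := eqVneq p q; last by rewrite mulr0.
by rewrite mulr1 -signr_addb addbb.
Qed.

Lemma sum_signed_shift n (X : 'M[C]_n.+1) :
  \sum_(s : {ffun 'I_n.+1 -> bool}) \sum_a
    signed_shift s a *m X *m (signed_shift s a)^t* = ((2 ^ n.+1)%:R * \tr X)%:M.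
Proof.
apply/matrixP => p q; rewrite summxE mxE; under eq_bigr do rewrite summxE.
rewrite exchange_big /=.
under eq_bigr do under eq_bigr do rewrite signed_shift_conjE.
under eq_bigr do rewrite -mulr_suml sum_signs.
rewrite -mulr_sumr; have [<-|_] := eqVneq p q; last by rewrite muln0 mul0r.
by rewrite muln1 mulr1n /mxtrace [in RHS](reindex_inj (addrI p)).
Qed.

Lemma unitary_design_exists n : (0 < n)%N ->
  exists k (U : 'I_k -> 'M[C]_n), unitary_design U.
Proof.
case: n => // n _; pose T : finType := ({ffun 'I_n.+1 -> bool} * 'I_n.+1)%type.
pose V (t : T) : 'M[C]_n.+1 := signed_shift t.1 t.2.
have cardT : #|T| = (2 ^ n.+1 * n.+1)%N.
  by rewrite card_prod card_ffun card_bool card_ord.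
exists #|T|, (fun i => V (enum_val i)); split=> [|i|X].
- by rewrite cardT muln_gt0 expn_gt0.
- exact: signed_shift_unitary.
rewrite -(big_enum_val (fun t => V t *m X *m (V t)^t*)) /= (eq_bigl predT) //.
rewrite -(pair_bigA _ (fun (s : {ffun 'I_n.+1 -> bool}) a =>
  signed_shift s a *m X *m (signed_shift s a)^t*)) sum_signed_shift.
by rewrite cardT natrM mulfK ?pnatr_eq0.
Qed.

Lemma unitary_design_conj n m k (U : 'I_k -> 'M[C]_m) (J : 'M[C]_(n * m)) :
  unitary_design U ->
  \sum_i conjm (1%:M *t U i) J = (k%:R / m%:R) *: (ptr J *t 1%:M).
Proof.
move=> [_ _ twirlU]; move: J; apply: eq_linear_tensmx => [a X Y|a X Y|A B].
- rewrite scaler_sumr -big_split; apply: eq_bigr => i _; exact: conjm_linear.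
- by rewrite linearP tensmxPl scalerDr !scalerA mulrC.
rewrite (eq_bigr (fun i => A *t (U i *m B *m (U i)^t*))) => [|i _].
  by rewrite -tensmx_sumr twirlU ptr_tens tensmxZl -scalemx1 tensmxZr scalerA.
by rewrite /conjm adjmx_tens adjmx1 !tensmx_mul mul1mx mulmx1.
Qed.

Definition twirl n m k (U : 'I_k -> 'M[C]_m) (J : 'M[C]_(n * m)) (i : 'I_k) :
    'M[C]_(n * m) :=
  (m%:R / k%:R)%:C *: conjm (1%:M *t U i) J.

Lemma measurement_twirl n m k (U : 'I_k -> 'M[C]_m) (J : 'M[C]_(n * m)) :
  (0 < m)%N -> unitary_design U -> psd J -> ptr J = 1%:M -> measurement (twirl U J).
Proof.
move=> m_gt0 dU hJ J1; have [k_gt0 _ _] := dU; split=> [i|].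
  by apply: psdZ; [exact: divr_ge0|exact: psd_conj].
rewrite -scaler_sumr unitary_design_conj // J1 tensmx11 scalerA.
rewrite rmorphM fmorphV /= !(rmorph_nat (real_complex R)) mulrA divfK ?pnatr_eq0 -?lt0n //.
by rewrite mulfV ?scale1r // pnatr_eq0 -lt0n.
Qed.

Lemma ptr_conj_unitary n m (U : 'M[C]_m) (N : 'M[C]_(n * m)) : unitary U ->
  ptr ((1%:M *t U)^t* *m N *m (1%:M *t U)) = ptr N.
Proof.
move=> uU; move: N; apply: eq_linear_tensmx => [a X Y|a X Y|A B].
- by rewrite mulmxPr mulmxPl linearP.
- by rewrite linearP.
rewrite adjmx_tens adjmx1 !tensmx_mul mul1mx mulmx1 !ptr_tens.
by rewrite mxtrace_mulC mulmxA uU mul1mx.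
Qed.

Lemma conj_twirl n m k (U : 'I_k -> 'M[C]_m) (J : 'M[C]_(n * m)) i : unitary (U i) ->
  (1%:M *t U i)^t* *m twirl U J i *m (1%:M *t U i) = (m%:R / k%:R)%:C *: J.
Proof.
move=> /unitaryC uU; rewrite /twirl -scalemxAr -scalemxAl; congr (_ *: _).
have UU : ((1%:M : 'M[C]_n) *t U i)^t* *m (1%:M *t U i) = 1%:M.
  by rewrite adjmx_tens tensmx_mul adjmx1 mul1mx uU tensmx11.
by rewrite /conjm !mulmxA UU mul1mx -mulmxA UU mulmx1.
Qed.

End UnitaryDesigns.

Section TwirledGame.
Variable R : realType.
Local Notation C := R[i].
Variables (b1 s0 r1 k l : nat).
Variables (U : 'I_k -> 'M[C]_r1) (V : 'I_l -> 'M[C]_b1).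
Variable rho : 'M[C]_(s0 * (r1 * b1)).
Hypotheses (dU : unitary_design U) (dV : unitary_design V).
Hypotheses (r1_gt0 : (0 < r1)%N) (b1_gt0 : (0 < b1)%N).

Let k_gt0 : (0 < k)%N. Proof. by case: dU. Qed.
Let l_gt0 : (0 < l)%N. Proof. by case: dV. Qed.
Let unitaryU i : unitary (U i). Proof. by case: dU. Qed.
Let unitaryV j : unitary (V j). Proof. by case: dV. Qed.

Definition game_prior (ij : 'I_k * 'I_l) : R := (k%:R * l%:R)^-1.

Definition game_state (ij : 'I_k * 'I_l) : 'M[C]_(s0 * (r1 * b1)) :=
  conjm (1%:M *t (U ij.1 *t V ij.2)) rho.

Definition game_measurement : 'I_l -> 'M[C]_(b1 * b1) := twirl V (Omega R b1).

Definition game_scale : R := b1%:R * r1%:R / (k%:R * l%:R).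

Lemma game_scale_gt0 : 0 < game_scale.
Proof. by rewrite divr_gt0 // mulr_gt0 // ltr0n. Qed.

Lemma measurement_game : measurement game_measurement.
Proof. by apply: measurement_twirl => //; [exact: psd_Omega|exact: ptr_Omega]. Qed.

Let game_unitaryK ij :
  ((1%:M : 'M[C]_s0) *t (U ij.1 *t V ij.2))^t* *m (1%:M *t (U ij.1 *t V ij.2)) = 1%:M.
Proof.
by rewrite !adjmx_tens !tensmx_mul adjmx1 mul1mx !unitaryC // !tensmx11.
Qed.

Lemma ensemble_game : density rho -> ensemble game_prior game_state.
Proof.
have kl_neq0 : k%:R * l%:R != 0 :> R by rewrite mulf_neq0 // pnatr_eq0 -lt0n.
move=> [hrho tr_rho]; split=> [ij||ij]; first by rewrite invr_ge0 mulr_ge0.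
  by rewrite sumr_const card_prod !card_ord -[_ *+ _]mulr_natr natrM mulVf.
split; first exact: psd_conj.
by rewrite mxtrace_mulC mulmxA game_unitaryK mul1mx.
Qed.

Lemma guess_value_game a1 u (g : lmap R s0 (u * (a1 * b1)))
    (post : lmap R (u * a1) r1) (N : 'I_k -> 'M[C]_(u * a1 * r1)) J :
  linear g -> linear post ->
  (forall X, \tr (tmap post (@idmap R r1) X *m Omega R r1) = \tr (X *m J)) ->
  \sum_i (1%:M *t U i)^t* *m N i *m (1%:M *t U i) = r1%:R%:C *: J ->
  guess_value game_prior game_state game_measurement g N =
  game_scale * rpairing rho (postprocess post \o g).
Proof.
move=> lg lpost postJ sumN; rewrite /rpairing tmap_id_comp //; last exact: postprocess_linear.
rewrite {1}/retr (mxtrace_postprocess_Omega _ lpost postJ) -/(retr _).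
set T := tmap g _ rho; pose NU i := (1%:M *t U i)^t* *m N i *m (1%:M *t U i).
have termE ij : retr (tmap g (@idmap R (r1 * b1)) (game_state ij)
      *m joint_test (N ij.1) (game_measurement ij.2)) =
    b1%:R / l%:R * retr (T *m joint_test (NU ij.1) (Omega R b1)).
  rewrite {1}/retr tmap_conjmr // mxtrace_conjm joint_test_conj conj_twirl //.
  rewrite -/T -/(NU _) -/(retr _).
  by rewrite -[NU _]scale1r joint_testZ mul1r scale1r -scalemxAr retrZ.
rewrite /guess_value; under eq_bigr do rewrite termE.
rewrite -mulr_sumr -(pair_bigA _ (fun i (j : 'I_l) =>
  b1%:R / l%:R * retr (T *m joint_test (NU i) (Omega R b1)))) /=.
under eq_bigr do rewrite sumr_const card_ord -[_ *+ l]mulr_natl.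
rewrite -!mulr_sumr -raddf_sum -mulmx_sumr -joint_test_suml sumN.
rewrite /= -[Omega R b1]scale1r joint_testZ mulr1 scale1r -scalemxAr retrZ /game_scale.
by field; rewrite !pnatr_eq0 -!lt0n l_gt0 k_gt0.
Qed.

Lemma game_upper a1 u (g : lmap R s0 (u * (a1 * b1))) (N : 'I_k -> 'M[C]_(u * a1 * r1)) :
  linear g -> measurement N ->
  exists2 post : lmap R (u * a1) r1, channel post &
  guess_value game_prior game_state game_measurement g N =
  game_scale * rpairing rho (postprocess post \o g).
Proof.
move=> lg [hN N1]; pose NU := \sum_i (1%:M *t U i)^t* *m N i *m (1%:M *t U i).
have r1_neq0 : r1%:R != 0 :> R by rewrite pnatr_eq0 -lt0n.
pose J := (r1%:R^-1)%:C *: NU.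
have hJ : psd J.
  by apply: psdZ; [rewrite invr_ge0|apply: psd_sum => i _; exact: psd_conjV].
have J1 : ptr J = 1%:M.
  rewrite linearZ linear_sum /=; under eq_bigr do rewrite ptr_conj_unitary //.
  rewrite -linear_sum N1 -tensmx11 /= ptr_tens mxtrace1 scalerA.
  by rewrite -(rmorph_nat (real_complex R)) -rmorphM mulVf ?scale1r.
exists (choi_map J); first exact: channel_choi_map.
apply: (guess_value_game lg (choi_map_linear _) (mxtrace_choi_map J)).
by rewrite scalerA -rmorphM /= mulfV // scale1r.
Qed.

Lemma game_lower a1 u (g : lmap R s0 (u * (a1 * b1))) (post : lmap R (u * a1) r1) :
  linear g -> channel post ->
  exists2 N : 'I_k -> 'M[C]_(u * a1 * r1), measurement N &
  guess_value game_prior game_state game_measurement g N =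
  game_scale * rpairing rho (postprocess post \o g).
Proof.
move=> lg /channel_choi_mapP[J [hJ J1 ->]]; exists (twirl U J).
  exact: measurement_twirl.
apply: (guess_value_game lg (choi_map_linear _) (mxtrace_choi_map J)).
under eq_bigr do rewrite conj_twirl //.
rewrite sumr_const card_ord -scaler_nat scalerA -(rmorph_nat (real_complex R)) -rmorphM /=.
by rewrite mulrC divfK // pnatr_eq0 -lt0n.
Qed.

Lemma game_psucc_le (s : 'M[C]_s0) (t : R) M : density s ->
  psd (t%:C *: (s *t 1%:M) - rho) -> measurement M ->
  psucc_with game_prior game_state M <= game_scale * t.
Proof.
move=> [_ s1] hs [hM M1]; rewrite psucc_withE -mulr_sumr.
have fixed ij : conjm (1%:M *t (U ij.1 *t V ij.2)) (s *t 1%:M) = s *t 1%:M.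
  rewrite /conjm !adjmx_tens !tensmx_mul adjmx1 mul1mx !mulmx1 tensmx_mul.
  by rewrite unitaryU unitaryV tensmx11.
have termM ij : retr (game_state ij *m M ij) <= t * retr ((s *t 1%:M) *m M ij).
  have := psd_trM_ge0 (psd_conj (1%:M *t (U ij.1 *t V ij.2)) hs) (hM ij).
  rewrite -/(conjm _ _) (linB (conjm_linear _)) (linZ (conjm_linear _)) fixed.
  by rewrite mulmxBl -scalemxAl retrB retrZ subr_ge0.
apply: le_trans (_ : (k%:R * l%:R)^-1 * \sum_ij t * retr ((s *t 1%:M) *m M ij) <= _).
  by rewrite ler_wpM2l ?invr_ge0 ?mulr_ge0 //; exact: ler_sum (fun ij _ => termM ij).
rewrite -mulr_sumr -raddf_sum -mulmx_sumr M1 mulmx1 /= {1}/retr mxtrace_tens s1 mul1r.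
rewrite -/(retr _) retr1 natrM /game_scale le_eqVlt; apply/orP; left; apply/eqP; ring.
Qed.

End TwirledGame.

(** * The equivalence *)

Section Suprema.
Variable R : realType.

Lemma ereal_sup_EFin (T : Type) (P : T -> Prop) (F : T -> R) b :
  (exists x, P x) -> (forall x, P x -> F x <= b) ->
  exists2 p : R, ereal_sup [set t | exists x, P x /\ t = (F x)%:E] = p%:E &
    forall x, P x -> F x <= p.
Proof.
move=> [x0 Px0] F_le; set S : set (\bar R) := mkset _.
have F_sup x : P x -> ((F x)%:E <= ereal_sup S)%E.
  by move=> Px; apply: ereal_sup_ubound; exists x.
have sup_le : (ereal_sup S <= b%:E)%E.
  by apply: ge_ereal_sup => _ [x [Px ->]]; rewrite lee_fin F_le.
by case: (ereal_sup S) F_sup sup_le => [p||] F_sup // _; [exists p|have := F_sup _ Px0].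
Qed.

Lemma ereal_sup_approx (S : set (\bar R)) (x y d : R) : 0 < d ->
  (x%:E <= ereal_sup S + y%:E)%E -> exists2 z, S z & ((x - y - d)%:E < z)%E.
Proof.
move=> d_gt0 x_le; apply: ereal_sup_gt; case: (ereal_sup S) x_le => [s||] //=.
- by rewrite -EFinD lee_fin lte_fin => ?; lra.
- by rewrite ltry.
Qed.

Lemma le_ereal_sup_small_error (S : set (\bar R)) (x y M : R) :
  (forall d, 0 < d -> exists2 z : R, S z%:E & x <= z + (y + d * M)) ->
  (x%:E <= ereal_sup S + y%:E)%E.
Proof.
move=> approx; have S_le z : S z%:E -> (z%:E <= ereal_sup S)%E by exact: ereal_sup_ubound.
case: (ereal_sup S) S_le => [s||] S_le; last 2 first.
- by rewrite addye // leey.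
- by have [z /S_le] := approx 1 ltr01.
rewrite -EFinD lee_fin; apply: (@le_small_error _ _ _ M) => d d_gt0.
exists d; first by rewrite d_gt0 lexx.
by have [z /S_le] := approx d d_gt0; rewrite lee_fin => z_le x_le; lra.
Qed.

End Suprema.

Section DualNorms.
Variable R : realType.
Local Notation C := R[i].

Lemma dual_dnorm_finite n m (rho : 'M[C]_(n * m)) : (0 < m)%N -> psd rho ->
  exists2 p : R, dual_dnorm rho = p%:E & forall f, channel f -> rpairing rho f <= p.
Proof.
move=> m_gt0 hrho; have [f0 cf0] := channel_exists R n m_gt0.
have [f cf|p pE p_max] := @ereal_sup_EFin R _ (@channel R n m)
    (fun f => Re (pairing rho f)) (n%:R * retr rho) (ex_intro _ f0 cf0).
  have [w [hw w1 fE]] := channel_choi_mapP cf.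
  rewrite Re_pairing // fE rpairing_choi_map.
  have := psd_trM_ge0 hrho (psd_le_trace hw).
  rewrite mulmxBr retrB subr_ge0 (psd_trE hw) -scalemx1 -scalemxAr mulmx1 retrZ.
  by rewrite (retr_ptr1 w1).
by exists p => // f cf; rewrite -Re_pairing //; exact: p_max.
Qed.

Lemma psucc_finite (I : finType) n (lam : I -> R) (rho : I -> 'M[C]_n) :
  ensemble lam rho -> exists2 p : R, psucc lam rho = p%:E &
    forall M, measurement M -> psucc_with lam rho M <= p.
Proof.
move=> hE; have /card_gt0P[i0 _] := ensemble_card_gt0 hE.
have [lam_ge0 lam1 hrho] := hE; apply: (ereal_sup_EFin (b := 1)).
  exists (fun i => if i == i0 then 1%:M else 0); split=> [i|].
    by case: ifP => _; [exact: psd1|exact: psd0].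
  by rewrite -big_mkcond big_pred1_eq.
move=> M [hM M1]; rewrite psucc_withE -lam1; apply: ler_sum => i _.
rewrite ler_piMr //; have : psd (1%:M - M i).
  by rewrite -M1 (bigD1 i) //= [M i + _]addrC addrK; exact: psd_sum.
move=> /(psd_trM_ge0 (hrho i).1); rewrite mulmxBr mulmx1 retrB {1}/retr (hrho i).2.
by rewrite subr_ge0.
Qed.

End DualNorms.

Section Equivalence.
Variable R : realType.
Local Notation C := R[i].
Variables (a0 a1 a0' a1' b0 b1 : nat).
Variables (Phi1 : lmap R (a0 * b0) (a1 * b1)) (Phi2 : lmap R (a0' * b0) (a1' * b1)).
Variable eps : R.
Hypotheses (cPhi1 : channel Phi1) (cPhi2 : channel Phi2) (eps_ge0 : 0 <= eps).

Lemma deltaAA_leP : (deltaAA Phi1 Phi2 <= eps%:E)%E <-> forall e : R, 0 < e ->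
  exists2 Psi, superch_outputs Phi1 Psi & cb_test_bounded (Phi2 \- Psi) (eps / 2 + e).
Proof.
have half_ge0 e : 0 < e -> 0 <= eps / 2 + e by move=> ?; rewrite addr_ge0 ?divr_ge0 // ltW.
split=> [delta_le e e_gt0|simulated].
  have : (deltaAA Phi1 Phi2 < (2 * (eps / 2 + e))%:E)%E.
    by apply: le_lt_trans delta_le _; rewrite lte_fin; lra.
  move=> /ereal_inf_lt[_ [Psi [outPsi ->]] /ltW dnorm_le]; exists Psi => //.
  have cPsi := channel_superch_outputs cPhi1 outPsi.
  apply: cb_test_bounded_subC => //.
  exact/(dnorm_leP (half_ge0 _ e_gt0) (hp_traceless_sub cPsi cPhi2)).
apply/lee_addgt0Pr => e e_gt0; have e2_gt0 : 0 < e / 2 by lra.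
have [Psi outPsi tPsi] := simulated _ e2_gt0.
have cPsi := channel_superch_outputs cPhi1 outPsi.
apply: (@le_trans _ _ (dnorm (Psi \- Phi2))); first by apply: ereal_inf_lbound; exists Psi.
have -> : (eps%:E + e%:E)%E = (2 * (eps / 2 + e / 2))%:E by rewrite -EFinD; congr _%:E; lra.
apply/(dnorm_leP (half_ge0 _ e2_gt0) (hp_traceless_sub cPsi cPhi2)).
exact: cb_test_bounded_subC.
Qed.

Section SimulationBounds.
Variables (r0 r1 : nat).
Hypotheses (b0_gt0 : (0 < b0)%N) (b1_gt0 : (0 < b1)%N).
Hypotheses (r0_gt0 : (0 < r0)%N) (r1_gt0 : (0 < r1)%N).
Hypothesis delta_le : (deltaAA Phi1 Phi2 <= eps%:E)%E.

Lemma sup_pairing_le_deltaAA (rho : 'M[C]_((r0 * b0) * (r1 * b1))) : density rho ->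
  (@sup_pairing R a0' a1' r0 r1 b0 b1 rho Phi2
   <= @sup_pairing R a0 a1 r0 r1 b0 b1 rho Phi1 + (eps / 2)%:E * dual_dnorm rho)%E.
Proof.
move=> [hrho _]; have r0b0_gt0 : (0 < r0 * b0)%N by rewrite muln_gt0 r0_gt0.
have r1b1_gt0 : (0 < r1 * b1)%N by rewrite muln_gt0 r1_gt0.
have [p -> p_max] := dual_dnorm_finite r1b1_gt0 hrho.
apply: ge_ereal_sup => _ [_ [[u [pre [post [u_gt0 cpre cpost ->]]]] ->]].
rewrite Re_pairing; last exact: channel_supch.
rewrite -EFinM; apply: (le_ereal_sup_small_error (M := p)) => e e_gt0.
have [Psi outPsi tPsi] := deltaAA_leP.1 delta_le e e_gt0.
have cPsi := channel_superch_outputs cPhi1 outPsi.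
exists (rpairing rho (supch_apply pre post Psi)).
  exists (supch_apply pre post Psi); split.
    exact: superch_outputs_comp u_gt0 cpre cpost cPhi1.1 outPsi.
  by rewrite Re_pairing //; exact: channel_supch.
have [lD _ _] := hp_traceless_sub cPhi2 cPsi.
have := rpairing_le_dual_norm r0b0_gt0 r1b1_gt0 (supch_linear _ _ _)
  (cb_test_bounded_supch cpre cpost lD tPsi) hrho p_max.
by rewrite supchB rpairingB mulrDl lerBlDl.
Qed.

Lemma PM_le_deltaAA k l (lam : 'I_k * 'I_l -> R)
    (rho : 'I_k * 'I_l -> 'M[C]_((r0 * b0) * (r1 * b1))) (M : 'I_l -> 'M[C]_(b1 * b1)) :
  ensemble lam rho -> measurement M ->
  (@PM R a0' a1' b0 b1 r0 r1 k l Phi2 M lam rho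
   <= @PM R a0 a1 b0 b1 r0 r1 k l Phi1 M lam rho + (eps / 2)%:E * psucc lam rho)%E.
Proof.
move=> hE hM; have [p -> p_max] := psucc_finite hE.
rewrite !PM_guess_value; apply: ge_ereal_sup => _ [u [alpha [N [u_gt0 calpha hN ->]]]].
rewrite -EFinM; apply: (le_ereal_sup_small_error (M := p)) => e e_gt0.
have [Psi outPsi tPsi] := deltaAA_leP.1 delta_le e e_gt0.
have cPsi := channel_superch_outputs cPhi1 outPsi.
exists (guess_value lam rho M (preprocess alpha Psi) N).
  case: outPsi => u0 [pre [post [u0_gt0 cpre cpost ->]]].
  have [N' hN' valN'] := guess_value_supch (b0 := b0) (b1 := b1) cpre cpost cPhi1.1 calpha hN.
  exists (u * u0)%N, (compose_pre alpha pre), N'; split=> //.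
  - by rewrite muln_gt0 u_gt0.
  - exact: channel_compose_pre.
  - by rewrite valN'.
have [lD _ _] := hp_traceless_sub cPhi2 cPsi.
have lpre : linear (preprocess alpha (Phi2 \- Psi)) by exact: preprocess_linear.
have n_gt0 : (0 < r0 * b0 * (r1 * b1))%N by rewrite !muln_gt0 r0_gt0 b0_gt0 r1_gt0.
have := guess_value_le_psucc n_gt0 lpre (cb_test_bounded_preprocess calpha lD tPsi) hE hN hM p_max.
by rewrite preprocessB guess_valueB mulrDl lerBlDl.
Qed.

End SimulationBounds.

Hypotheses (a0_gt0 : (0 < a0)%N) (a0'_gt0 : (0 < a0')%N) (a1'_gt0 : (0 < a1')%N).
Hypotheses (b0_gt0 : (0 < b0)%N) (b1_gt0 : (0 < b1)%N).

Lemma deltaAA_le_dominated_states :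
  (forall (rho : 'M[C]_(a0' * b0 * (a1' * b1))) s (t d : R),
     density rho -> density s -> 0 < t -> 0 < d -> psd (t%:C *: (s *t 1%:M) - rho) ->
     exists2 Psi, superch_outputs Phi1 Psi & rpairing rho (Phi2 \- Psi) <= eps / 2 * t + d) ->
  (deltaAA Phi1 Phi2 <= eps%:E)%E.
Proof.
move=> simulated; apply/deltaAA_leP => e e_gt0; have e2_gt0 : 0 < e / 2 by lra.
have -> : eps / 2 + e = (eps / 2 + e / 2) + e / 2 by lra.
apply: minimax_channels => //.
- by rewrite muln_gt0 a0'_gt0.
- by move=> Psi; exact: channel_superch_outputs.
- by move=> t Psi Psi' t01; exact: superch_outputs_convex cPhi1.1 t01.
- exact: superch_outputs_nonempty.
move=> T [hT [s hs hsT]]; have [T0|T_neq0] := eqVneq T 0.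
  have [Psi outPsi] := superch_outputs_nonempty a0' Phi1 a0_gt0 a1'_gt0.
  exists Psi => //; rewrite T0 /rpairing (lin0 (tmap_linear _ _)) mul0mx raddf0.
  by rewrite addr_ge0 ?divr_ge0 // ltW.
have tau_gt0 := psd_retr_gt0 hT T_neq0; have taui_gt0 : 0 < (retr T)^-1 by rewrite invr_gt0.
have [|Psi outPsi gap_le] := simulated _ _ _ (e / 2 / retr T)
  (density_normalize hT T_neq0) hs taui_gt0 (divr_gt0 e2_gt0 tau_gt0).
  by rewrite -scalerBr; exact: psdZ (ltW taui_gt0) hsT.
exists Psi => //; rewrite -(scale_normalize hT) rpairingZ mulrC -ler_pdivlMr //.
by rewrite mulrDl.
Qed.

Lemma deltaAA_le_sup_pairing :
  (forall rho : 'M[C]_((a0' * b0) * (a1' * b1)), density rho ->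
    (@sup_pairing R a0' a1' a0' a1' b0 b1 rho Phi2
     <= @sup_pairing R a0 a1 a0' a1' b0 b1 rho Phi1 + (eps / 2)%:E * dual_dnorm rho)%E) ->
  (deltaAA Phi1 Phi2 <= eps%:E)%E.
Proof.
move=> pairing_le; apply: deltaAA_le_dominated_states => rho s t d hrho [_ s1] t_gt0 d_gt0 hs.
have Phi2_le : ((rpairing rho Phi2)%:E <= @sup_pairing R a0' a1' a0' a1' b0 b1 rho Phi2)%E.
  apply: ereal_sup_ubound; exists Phi2; rewrite Re_pairing //; split=> //.
  exact: superch_outputs_refl cPhi2.1.
have dual_le : ((eps / 2)%:E * dual_dnorm rho <= (eps / 2 * t)%:E)%E.
  rewrite [leRHS]EFinM; apply: lee_wpmul2l; first by rewrite lee_fin divr_ge0.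
  apply: ge_ereal_sup => _ [f [cf ->]]; rewrite lee_fin Re_pairing //.
  have [w [hw w1 ->]] := channel_choi_mapP cf; rewrite rpairing_choi_map.
  have := psd_trM_ge0 hs hw; rewrite mulmxBl -scalemxAl retrB retrZ subr_ge0.
  by rewrite {2}/retr mxtrace_tens1_mul w1 mulmx1 s1 mulr1.
have := le_trans Phi2_le (le_trans (pairing_le _ hrho) (leeD2l _ dual_le)).
move=> /(ereal_sup_approx d_gt0)[_ [Psi [outPsi ->]]]; rewrite lte_fin Re_pairing.
  move=> gap_lt; exists Psi => //; rewrite rpairingB; move: gap_lt.
  by move: (rpairing rho Phi2) (rpairing rho Psi) => x y; lra.
exact: channel_superch_outputs outPsi.
Qed.

Lemma deltaAA_le_PM :
  (forall k l (lam : 'I_k * 'I_l -> R)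
     (rho : 'I_k * 'I_l -> 'M[C]_((a0' * b0) * (a1' * b1))) (M : 'I_l -> 'M[C]_(b1 * b1)),
     ensemble lam rho -> measurement M ->
     (@PM R a0' a1' b0 b1 a0' a1' k l Phi2 M lam rho
      <= @PM R a0 a1 b0 b1 a0' a1' k l Phi1 M lam rho + (eps / 2)%:E * psucc lam rho)%E) ->
  (deltaAA Phi1 Phi2 <= eps%:E)%E.
Proof.
move=> PM_le; apply: deltaAA_le_dominated_states => rho s t d hrho hs t_gt0 d_gt0 hsrho.
have [k [U dU]] := unitary_design_exists R a1'_gt0.
have [l [V dV]] := unitary_design_exists R b1_gt0.
pose z := game_scale R b1 a1' k l.
have z_gt0 : 0 < z by exact: game_scale_gt0 dU dV a1'_gt0 b1_gt0.
have Phi2_le : ((z * rpairing rho Phi2)%:E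
    <= PM Phi2 (game_measurement V) (@game_prior R k l) (game_state U V rho))%E.
  have [u [pre [post [u_gt0 cpre cpost Phi2E]]]] := superch_outputs_refl cPhi2.1.
  have [N hN NE] := game_lower rho dU dV a1'_gt0 (preprocess_linear pre Phi2) cpost.
  rewrite PM_guess_value; apply: ereal_sup_ubound; exists u, pre, N; split=> //.
  by rewrite NE -supch_applyE -Phi2E.
have psucc_le : ((eps / 2)%:E * psucc (@game_prior R k l) (game_state U V rho)
    <= (eps / 2 * (z * t))%:E)%E.
  rewrite [leRHS]EFinM; apply: lee_wpmul2l; first by rewrite lee_fin divr_ge0.
  apply: ge_ereal_sup => _ [M [hM ->]]; rewrite lee_fin.
  exact: game_psucc_le hs hsrho hM.
have game_le := PM_le _ _ _ _ _ (ensemble_game dU dV hrho) (measurement_game dV b1_gt0).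
have := le_trans Phi2_le (le_trans game_le (leeD2l _ psucc_le)).
rewrite PM_guess_value => /(ereal_sup_approx (mulr_gt0 z_gt0 d_gt0)).
move=> [_ [u' [alpha [N' [u'_gt0 calpha hN' ->]]]]].
have [post' cpost' ->] := game_upper rho dU dV a1'_gt0 (preprocess_linear alpha Phi1) hN'.
rewrite -supch_applyE lte_fin -/z => gap_lt; exists (supch_apply alpha post' Phi1).
  by exists u', alpha, post'.
rewrite rpairingB -(ler_pM2l z_gt0); move: gap_lt.
by move: (rpairing rho Phi2) (rpairing rho _) => x y; lra.
Qed.

End Equivalence.

Theorem theorem8 (R : realType) (a0 a1 a0' a1' b0 b1 : nat)
  (Phi1 : lmap R (a0 * b0) (a1 * b1)) (Phi2 : lmap R (a0' * b0) (a1' * b1))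
  (eps : R) :
  (0 < a0)%N -> (0 < a1)%N -> (0 < a0')%N -> (0 < a1')%N ->
  (0 < b0)%N -> (0 < b1)%N ->
  channel Phi1 -> channel Phi2 -> 0 <= eps ->
  let cond_i := (deltaAA Phi1 Phi2 <= eps%:E)%E in
  let cond_ii (r0 r1 : nat) :=
    forall rho : 'M[R[i]]_((r0 * b0) * (r1 * b1)), density rho ->
      (@sup_pairing R a0' a1' r0 r1 b0 b1 rho Phi2
       <= @sup_pairing R a0 a1 r0 r1 b0 b1 rho Phi1
          + (eps / 2)%:E * dual_dnorm rho)%E in
  let cond_iii (r0 r1 : nat) :=
    forall (k l : nat) (lam : 'I_k * 'I_l -> R)
           (rho : 'I_k * 'I_l -> 'M[R[i]]_((r0 * b0) * (r1 * b1)))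
           (M : 'I_l -> 'M[R[i]]_(b1 * b1)),
      ensemble lam rho -> measurement M ->
      (@PM R a0' a1' b0 b1 r0 r1 k l Phi2 M lam rho
       <= @PM R a0 a1 b0 b1 r0 r1 k l Phi1 M lam rho
          + (eps / 2)%:E * psucc lam rho)%E in
  [/\ cond_i <-> (forall r0 r1 : nat, (0 < r0)%N -> (0 < r1)%N -> cond_ii r0 r1),
      cond_i <-> (forall r0 r1 : nat, (0 < r0)%N -> (0 < r1)%N -> cond_iii r0 r1),
      cond_i <-> cond_ii a0' a1'
    & cond_i <-> cond_iii a0' a1'].
Proof.
move=> a0_gt0 a1_gt0 a0'_gt0 a1'_gt0 b0_gt0 b1_gt0 cPhi1 cPhi2 eps_ge0 cond_i cond_ii cond_iii.
have i_ii r0 r1 : (0 < r0)%N -> (0 < r1)%N -> cond_i -> cond_ii r0 r1.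
  by move=> r0_gt0 r1_gt0 delta_le rho; exact: sup_pairing_le_deltaAA.
have i_iii r0 r1 : (0 < r0)%N -> (0 < r1)%N -> cond_i -> cond_iii r0 r1.
  by move=> r0_gt0 r1_gt0 delta_le k l lam rho M; exact: PM_le_deltaAA.
have ii_i : cond_ii a0' a1' -> cond_i by exact: deltaAA_le_sup_pairing.
have iii_i : cond_iii a0' a1' -> cond_i by exact: deltaAA_le_PM.
by split; split; auto.
Qed.
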